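(* Suppose that $f$ is an analytic characteristic function on the strip $V_0=\{s\in\mathbb C:0<\mathrm{Re}(s)<4\}$. Then the Riemann hypothesis and the simple zeros conjecture hold: every nonreal zero $z$ of $\zeta$ satisfies $\mathrm{Re}(z)=\tfrac12$ and $\zeta'(z)\ne0$.
   Context: $\zeta$ is the Riemann zeta-function, $\xi(s)=\tfrac12\pi^{-s/2}s(s-1)\Gamma(s/2)\zeta(s)$, $n(s)=\sin(\pi s/4)\cdot 2\xi(\tfrac12+s)$ and $f(s)=1/n(s)$. A function $j$ is an analytic characteristic function on a vertical strip $V$ if $j$ is analytic on $V$ and $j(s)=\int_{\mathbb R}e^{sy}d\mu(y)$ (convergent for all $s\in V$) for a positive measure $\mu$ on $\mathbb R$. *)

(* Defs.v *)
From HB Require Import structures.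
From mathcomp Require Import all_boot all_order all_algebra.
From mathcomp Require Import complex.
From mathcomp Require Import all_classical all_reals all_analysis.

Set Implicit Arguments.
Unset Strict Implicit.
Unset Printing Implicit Defensive.

Import Order.TTheory GRing.Theory Num.Theory.
Import numFieldNormedType.Exports.

Local Open Scope classical_set_scope.
Local Open Scope ring_scope.
Local Open Scope complex_scope.

(* The complex numbers over R, as a normed module over themselves: the [^o]
   is what carries the topology of the modulus, hence also limits and complex
   derivatives. *)
Notation Cplx R := ((R[i])^o).

Section ComplexFunctions.
Context {R : realType}.
Implicit Types (s w : Cplx R) (t : R).

Definition cexp s : Cplx R :=
  (expR (complex.Re s) * cos (complex.Im s))
    +i* (expR (complex.Re s) * sin (complex.Im s)).

Definition csin s : Cplx R :=
  (cexp ('i * s) - cexp (- ('i * s))) / (2%:R * 'i).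

(* t ^ s with the principal branch, for a real t > 0 *)
Definition rcpow t s : Cplx R := cexp (s * (ln t)%:C).

Section Integral.
Context (d : measure_display) (T : measurableType d).

Definition cintegrable (mu : {measure set T -> \bar R}) (D : set T) (g : T -> Cplx R) :=
  mu.-integrable D (fun x => (complex.Re (g x))%:E) /\
  mu.-integrable D (fun x => (complex.Im (g x))%:E).

Definition cintegral (mu : {measure set T -> \bar R}) (D : set T) (g : T -> Cplx R)
    : Cplx R :=
  Rintegral mu D (fun x => complex.Re (g x))
    +i* Rintegral mu D (fun x => complex.Im (g x)).

End Integral.

(* For open V, analyticity on V is complex differentiability at each point. *)
Definition analytic_on (V : set (Cplx R)) (g : Cplx R -> Cplx R) :=
  forall s, V s -> derivable g s 1.

Definition vstrip (a b : R) : set (Cplx R) := [set s | a < complex.Re s < b].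

Definition analytic_char_fun (V : set (Cplx R)) (j : Cplx R -> Cplx R) :=
  analytic_on V j /\
  exists mu : {measure set (measurableTypeR R) -> \bar R},
    forall s, V s ->
      cintegrable mu setT (fun y : measurableTypeR R => cexp (s * y%:C)) /\
      j s = cintegral mu setT (fun y : measurableTypeR R => cexp (s * y%:C)).

(* Euler's integral, meaningful for Re s > 0 *)
Definition Gamma_integral s : Cplx R :=
  cintegral (@lebesgue_measure R) `]0, +oo[
    (fun t => rcpow t (s - 1) * (expR (- t))%:C).

(* Gamma s = Gamma (s + k) / (s (s + 1) ... (s + k - 1)), where k is large
   enough for Re (s + k) > 0; the value at the poles 0, -1, -2, ... is junk. *)
Definition cGamma s : Cplx R :=
  let k := (Num.truncn `|complex.Re s|).+1 in
  Gamma_integral (s + k%:R) / \prod_(0 <= i < k) (s + i%:R).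

(* zeta is the analytic continuation to C \ {1} of the Dirichlet series
   \sum_(n >= 1) n ^ (- s), Re s > 1. This determines zeta everywhere but at
   its pole 1, where its value is arbitrary. *)
Definition is_riemann_zeta (zeta : Cplx R -> Cplx R) :=
  analytic_on [set s | s != 1] zeta /\
  forall s, 1 < complex.Re s ->
    series (fun n => rcpow n.+1%:R (- s)) @ \oo --> zeta s.

Section Xi.
Variable zeta : Cplx R -> Cplx R.

Definition xi_formula s : Cplx R :=
  2%:R^-1 * rcpow pi (- (s / 2%:R)) * s * (s - 1) * cGamma (s / 2%:R) * zeta s.

(* The formula has removable singularities at 1 (pole of zeta) and at
   0, -2, -4, ... (poles of Gamma (s / 2)), where xi takes the limit value;
   elsewhere the limit is the value of the formula. *)
Definition xi s : Cplx R := lim (xi_formula w @[w --> s^']).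

Definition nfun s : Cplx R := csin (pi%:C * s / 4%:R) * (2%:R * xi (2%:R^-1 + s)).

(* A zero of nfun gets the junk value 0^-1 = 0, which is not a removable
   singularity: analyticity of ffun on V forces nfun not to vanish on V. *)
Definition ffun s : Cplx R := 1 / nfun s.

End Xi.

End ComplexFunctions.

(* Main.v *)
Require Import Defs.
From HB Require Import structures.
From mathcomp Require Import all_boot all_order all_algebra.
From mathcomp Require Import complex ring lra.
From mathcomp Require Import all_classical all_reals all_analysis measurable_realfun.
Import Order.TTheory GRing.Theory Num.Theory.
Import numFieldNormedType.Exports.
Set Implicit Arguments.
Unset Strict Implicit.
Unset Printing Implicit Defensive.
Local Open Scope classical_set_scope.
Local Open Scope ring_scope.
Local Open Scope complex_scope.

(* Let xiL s be the continuation of pi^(-s/2) Gamma(s/2) zeta(s) given by Riemann's integral of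
   the theta function; it is symmetric under s -> 1 - s and holomorphic outside {0, 1}.  For
   Re s > 0 the function n(s) is sin(pi s/4) w (w - 1) xiL(w) with w = 1/2 + s.  Analyticity of
   f = 1/n on 0 < Re s < 4 means that xiL has no nonreal zero with 1/2 < Re w < 9/2.  To the right
   of this strip neither Gamma nor the Dirichlet series vanishes, and the functional equation
   covers Re w < 1/2, so nonreal zeros of zeta have real part 1/2.
   The representation f(s) = int e^(sy) dmu(y) with mu >= 0 gives |f(t + iy)| <= C f(t) for
   t > 0.  Since n has a simple zero at 0 (because xiL(1/2) <> 0), |n(t + iy)| is at least of
   order t as t -> 0+, so that n has no multiple zero at iy. *)

(** * Complex differentiability *)

(** All complex analysis here rests on Goursat's theorem for rectangles. Composed with the
    exponential it gives a mean value inequality on circles, and this gives the identity theorem,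
    without power series or residues. Integrals are estimated through real and imaginary parts, at
    the price of a factor 2. High powers absorb it in the identity theorem; in the last step a ratio
    of 3 beats it. The functional equation of theta comes from Poisson summation with the Fejér
    kernel: Cesàro means of the Fourier side converge without any theory of Fourier series, and all
    errors are explicit. Gamma is handled by Euler's integral only. That it has no zeros where this
    is needed is drawn from the hypothesis on f: a zero of Gamma(w/2) would be a zero of xiL in the
    strip already known to be free of them. Since 1/0 = 0, a zero of n is not at once a singularity
    of f. But f would be continuous there with value 0 while n is small nearby, so n would vanish on
    a disc, and the identity theorem would carry this to xiL(1/2). The latter is nonzero by a
    numerical estimate: the integral of psi(t) t^(-3/4) over [1, oo[ is at most 8/7, and a zero
    would need the value 2. *)

Section CplxBasics.
Context {R : realType}.
Implicit Types (s w z h d : R[i]) (f g : R[i] -> R[i]).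

(** The norm on [R[i]] takes its values in [R[i]]; a modulus with values in [R] opens the estimates
    to [lra] and [nra]. *)
Definition cmod z : R := Normc.normc z.

Lemma cmodE z : cmod z = Num.sqrt (complex.Re z ^+ 2 + complex.Im z ^+ 2).
Proof. by case: z. Qed.

Lemma cmod_ge0 z : 0 <= cmod z.
Proof. by rewrite cmodE sqrtr_ge0. Qed.

Lemma cmod0 : cmod 0 = 0. Proof. exact: Normc.normc0. Qed.
Lemma cmod1 : cmod 1 = 1. Proof. exact: Normc.normc1. Qed.
Lemma cmodM z w : cmod (z * w) = cmod z * cmod w. Proof. exact: Normc.normcM. Qed.
Lemma cmodV z : cmod z^-1 = (cmod z)^-1. Proof. exact: Normc.normcV. Qed.
Lemma cmodN z : cmod (- z) = cmod z. Proof. exact: normcN. Qed.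
Lemma cmodD z w : cmod (z + w) <= cmod z + cmod w. Proof. exact: le_normcD. Qed.
Lemma cmodX z n : cmod (z ^+ n) = cmod z ^+ n.
Proof. by elim: n => [|n IH]; rewrite ?expr0 ?cmod1// !exprS cmodM IH. Qed.

Lemma cmod_norm z : `|z| = (cmod z)%:C.
Proof. by rewrite normc_def cmodE. Qed.

Lemma cmod_eq0 z : (cmod z == 0) = (z == 0).
Proof.
apply/eqP/eqP => [|->]; [exact: Normc.eq0_normc|exact: cmod0].
Qed.

Lemma cmod_gt0 z : (0 < cmod z) = (z != 0).
Proof. by rewrite lt_def cmod_eq0 cmod_ge0 andbT. Qed.

Lemma cmodB z w : cmod (z - w) = cmod (w - z).
Proof. by rewrite -cmodN opprB. Qed.

Lemma cmodBD z w : cmod z - cmod w <= cmod (z - w).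
Proof. by rewrite lerBlDr (le_trans _ (cmodD _ _))// subrK. Qed.

Lemma cmod_real (r : R) : cmod r%:C = `|r|.
Proof. by rewrite cmodE/= expr0n/= addr0 sqrtr_sqr. Qed.

Lemma Re_le_cmod z : `|complex.Re z| <= cmod z.
Proof.
rewrite cmodE -sqrtr_sqr ler_sqrt ?addr_ge0 ?sqr_ge0//.
by rewrite lerDl sqr_ge0.
Qed.

Lemma Im_le_cmod z : `|complex.Im z| <= cmod z.
Proof.
rewrite cmodE -sqrtr_sqr ler_sqrt ?addr_ge0 ?sqr_ge0//.
by rewrite lerDr sqr_ge0.
Qed.

Lemma cmod_le_ReIm z : cmod z <= `|complex.Re z| + `|complex.Im z|.
Proof.
rewrite {1}(complexE z) (le_trans (cmodD _ _))// cmodM !cmod_real.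
by rewrite cmodE/= expr0n/= expr1n add0r sqrtr1 mul1r.
Qed.

Lemma ReD z w : complex.Re (z + w) = complex.Re z + complex.Re w.
Proof. by case: z w => [a b] [c e]. Qed.
Lemma ImD z w : complex.Im (z + w) = complex.Im z + complex.Im w.
Proof. by case: z w => [a b] [c e]. Qed.
Lemma ReN z : complex.Re (- z) = - complex.Re z.
Proof. by case: z. Qed.
Lemma ImN z : complex.Im (- z) = - complex.Im z.
Proof. by case: z. Qed.
Lemma ReM z w : complex.Re (z * w) =
  complex.Re z * complex.Re w - complex.Im z * complex.Im w.
Proof. by case: z w => [a b] [c e]. Qed.
Lemma ImM z w : complex.Im (z * w) =
  complex.Re z * complex.Im w + complex.Im z * complex.Re w.
Proof. by case: z w => [a b] [c e]. Qed.

Lemma complex_ext z w : complex.Re z = complex.Re w ->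
  complex.Im z = complex.Im w -> z = w.
Proof. by case: z w => [a b] [c e] /= -> ->. Qed.

Lemma natC n : (n%:R : R[i]) = (n%:R)%:C.
Proof. by rewrite rmorph_nat. Qed.

(** Multiplied out instead of a quotient: [h = 0] is harmless, and in the chain rule the increment
    of the inner function may vanish. *)
Definition cderiv f s d := forall e, 0 < e ->
  exists2 r, 0 < r & forall h, cmod h < r ->
    cmod (f (s + h) - f s - d * h) <= e * cmod h.

Definition cdiff f s := exists d, cderiv f s d.

Definition ccont f s := forall e, 0 < e ->
  exists2 r, 0 < r & forall h, cmod h < r -> cmod (f (s + h) - f s) < e.

Lemma cderiv_cont f s d : cderiv f s d -> ccont f s.
Proof.
move=> fd e e0; have [r r0 H] := fd 1 ltr01.
have d1 : 0 < 1 + cmod d by rewrite ltr_wpDr// cmod_ge0.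
exists (Num.min r (e / (1 + cmod d))); first by rewrite lt_min r0 divr_gt0.
move=> h; rewrite lt_min => /andP[hr]; rewrite ltr_pdivlMr// => he.
have -> : f (s + h) - f s = (f (s + h) - f s - d * h) + d * h by ring.
rewrite (le_lt_trans (cmodD _ _))// (le_lt_trans _ he)//.
by rewrite mulrDr mulr1 cmodM lerD// ?(le_trans (H h hr))// ?mul1r// mulrC.
Qed.

Lemma cdiff_cont f s : cdiff f s -> ccont f s.
Proof. by case=> d /cderiv_cont. Qed.

Lemma cderiv_cst (c : R[i]) s : cderiv (fun=> c) s 0.
Proof.
move=> e e0; exists 1 => // h _.
by rewrite subrr mul0r subr0 cmod0 mulr_ge0 ?cmod_ge0// ltW.
Qed.

Lemma cderiv_id s : cderiv id s 1.
Proof.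
move=> e e0; exists 1 => // h _.
rewrite (_ : id (s + h) - id s - 1 * h = 0); last by rewrite /=; ring.
by rewrite cmod0 mulr_ge0 ?cmod_ge0// ltW.
Qed.

Lemma cderivD f g s d1 d2 : cderiv f s d1 -> cderiv g s d2 ->
  cderiv (fun z => f z + g z) s (d1 + d2).
Proof.
move=> fd gd e e0; have e20 : 0 < e / 2 by rewrite divr_gt0.
have [r r0 H] := fd _ e20; have [q q0 K] := gd _ e20.
exists (Num.min r q); first by rewrite lt_min r0 q0.
move=> h; rewrite lt_min => /andP[hr hq].
have -> : f (s + h) + g (s + h) - (f s + g s) - (d1 + d2) * h =
  (f (s + h) - f s - d1 * h) + (g (s + h) - g s - d2 * h) by ring.
rewrite (le_trans (cmodD _ _))// (le_trans (lerD (H h hr) (K h hq)))//.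
by rewrite -mulrDl -splitr.
Qed.

Lemma cderivM f g s d1 d2 : cderiv f s d1 -> cderiv g s d2 ->
  cderiv (fun z => f z * g z) s (d1 * g s + f s * d2).
Proof.
move=> fd gd e e0.
(* [A] dominates 1 and the three moduli, so each of the four error terms below is at most
   [t * A * cmod h], with [t * A <= e / 4]. *)
pose A := 1 + cmod (g s) + cmod (f s) + cmod d1.
have A1 : 1 <= A by rewrite /A -!addrA lerDl !addr_ge0 ?cmod_ge0.
have A0 : 0 < A by rewrite (lt_le_trans _ A1).
have eA : 0 < Num.min 1 (e / (A * 4)).
  by rewrite lt_min ltr01 divr_gt0// mulr_gt0.
set t := Num.min 1 _ in eA.
have [r r0 H] := fd _ eA; have [q q0 K] := gd _ eA.
have [q' q'0 K'] := cderiv_cont gd eA.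
exists (Num.min r (Num.min q q')); first by rewrite !lt_min r0 q0.
move=> h; rewrite !lt_min => /andP[hr /andP[hq hq']].
have -> : f (s + h) * g (s + h) - f s * g s - (d1 * g s + f s * d2) * h =
  (f (s + h) - f s - d1 * h) * g s
   + (f (s + h) - f s - d1 * h) * (g (s + h) - g s)
   + d1 * h * (g (s + h) - g s) + f s * (g (s + h) - g s - d2 * h) by ring.
have t1 : t <= 1 by rewrite ge_min lexx.
have te : t * A <= e / 4.
  rewrite (le_trans (ler_wpM2r (ltW A0) (_ : t <= e / (A * 4))))//.
    by rewrite ge_min lexx orbT.
  by rewrite invfM mulrA mulrAC divfK// gt_eqF.
have h0 := cmod_ge0 h.
have Ag : cmod (g s) <= A.
  by rewrite /A; have := (cmod_ge0 (f s), cmod_ge0 d1, cmod_ge0 (g s)) => -[[]]; lra.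
have Af : cmod (f s) <= A.
  by rewrite /A; have := (cmod_ge0 (f s), cmod_ge0 d1, cmod_ge0 (g s)) => -[[]]; lra.
have Ad : cmod d1 <= A.
  by rewrite /A; have := (cmod_ge0 (f s), cmod_ge0 d1, cmod_ge0 (g s)) => -[[]]; lra.
have key a b : 0 <= a -> 0 <= b -> a <= t * cmod h -> b <= A -> a * b <= e / 4 * cmod h.
  move=> a0 b0 ah bA; rewrite (le_trans (ler_pM a0 b0 ah bA))//.
  by rewrite mulrAC ler_wpM2r.
have -> : e * cmod h = e / 4 * cmod h + e / 4 * cmod h + e / 4 * cmod h + e / 4 * cmod h.
  by field.
rewrite (le_trans (cmodD _ _))// lerD//; last first.
  by rewrite cmodM mulrC key ?cmod_ge0// K.
rewrite (le_trans (cmodD _ _))// lerD//; last first.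
  rewrite cmodM cmodM -mulrA mulrC key ?mulr_ge0 ?cmod_ge0//.
  by rewrite mulrC ler_wpM2r// ltW// K'.
rewrite (le_trans (cmodD _ _))// lerD//; rewrite cmodM key ?cmod_ge0 ?H//.
by rewrite (le_trans (ltW (K' _ hq')))// (le_trans t1).
Qed.

Lemma cderiv_comp f g s d1 d2 : cderiv f s d1 -> cderiv g (f s) d2 ->
  cderiv (fun z => g (f z)) s (d2 * d1).
Proof.
move=> fd gd e e0.
pose A := 1 + cmod d1 + cmod d2.
have A1 : 1 <= A by rewrite /A -!addrA lerDl !addr_ge0 ?cmod_ge0.
have A0 : 0 < A by rewrite (lt_le_trans _ A1).
have eA : 0 < Num.min 1 (e / (A * 2)).
  by rewrite lt_min ltr01 divr_gt0// mulr_gt0.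
set t := Num.min 1 _ in eA.
have t1 : t <= 1 by rewrite ge_min lexx.
have te : t * A <= e / 2.
  rewrite (le_trans (ler_wpM2r (ltW A0) (_ : t <= e / (A * 2))))//.
    by rewrite ge_min lexx orbT.
  by rewrite invfM mulrA mulrAC divfK// gt_eqF.
have [r r0 H] := fd _ eA; have [q q0 K] := gd _ eA.
have [q' q'0 K'] := cderiv_cont fd q0.
exists (Num.min r q'); first by rewrite !lt_min r0 q'0.
move=> h; rewrite !lt_min => /andP[hr hq].
have := K _ (K' h hq); rewrite (addrC (f s)) subrK => {}K.
have {}H := H h hr.
have -> : g (f (s + h)) - g (f s) - d2 * d1 * h =
  (g (f (s + h)) - g (f s) - d2 * (f (s + h) - f s))
   + d2 * (f (s + h) - f s - d1 * h) by ring.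
have h0 := cmod_ge0 h.
have B : cmod (f (s + h) - f s) <= A * cmod h.
  have -> : f (s + h) - f s = (f (s + h) - f s - d1 * h) + d1 * h by ring.
  rewrite (le_trans (cmodD _ _))// cmodM.
  have := cmod_ge0 d2; move: H t1 h0; rewrite /A; nra.
rewrite (le_trans (cmodD _ _))// cmodM (splitr e) mulrDl lerD//.
  rewrite (le_trans K)// (le_trans (ler_wpM2l (ltW eA) B))// mulrA.
  by rewrite ler_wpM2r.
rewrite (le_trans (ler_wpM2l (cmod_ge0 _) H))// mulrA ler_wpM2r// (le_trans _ te)//.
rewrite mulrC ler_wpM2l ?(ltW eA)// /A.
by have := cmod_ge0 d1; lra.
Qed.

Lemma cderiv_near f g s d : (exists2 r, 0 < r & forall z, cmod (z - s) < r -> f z = g z) ->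
  cderiv f s d -> cderiv g s d.
Proof.
move=> [r r0 fg] fd e e0; have [q q0 H] := fd e e0.
exists (Num.min r q); first by rewrite lt_min r0.
move=> h; rewrite lt_min => /andP[hr hq].
rewrite -!fg ?H// ?subrr ?cmod0//.
by rewrite addrC addKr.
Qed.

Lemma cderiv_inv s : s != 0 -> cderiv (fun z => z^-1) s (- (s ^- 2)).
Proof.
move=> s0 e e0.
have c0 : 0 < cmod s by rewrite cmod_gt0.
exists (Num.min (cmod s / 2) (e * cmod s ^+ 3 / 2)).
  by rewrite lt_min !divr_gt0// mulr_gt0// exprn_gt0.
move=> h; rewrite lt_min => /andP[h1 h2].
have sh : cmod s / 2 <= cmod (s + h).
  have := cmodBD s (- h); rewrite opprK cmodN; lra.
have sh0 : s + h != 0 by rewrite -cmod_gt0 (lt_le_trans _ sh)// divr_gt0.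
have -> : (s + h)^-1 - s^-1 - - s ^- 2 * h = h * (h * (s ^- 2 * (s + h)^-1)).
  by field; rewrite s0 sh0.
rewrite cmodM mulrC ler_wpM2r ?cmod_ge0// !cmodM !cmodV cmodX.
rewrite mulrA ler_pdivrMr ?(lt_le_trans _ sh) ?divr_gt0//.
rewrite ler_pdivrMr ?exprn_gt0//.
rewrite (le_trans (ltW h2))//.
have -> : e * cmod s ^+ 3 / 2 = e * (cmod s / 2) * cmod s ^+ 2 by ring.
by rewrite ler_wpM2r ?exprn_ge0 ?cmod_ge0// ler_wpM2l// ltW.
Qed.

Lemma cdiff_cst (c : R[i]) s : cdiff (fun=> c) s. Proof. by eexists; exact: cderiv_cst. Qed.
Lemma cdiff_id s : cdiff id s. Proof. by eexists; exact: cderiv_id. Qed.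
Lemma cdiffD f g s : cdiff f s -> cdiff g s -> cdiff (fun z => f z + g z) s.
Proof. by move=> [d1 H1] [d2 H2]; eexists; exact: cderivD H1 H2. Qed.
Lemma cdiffM f g s : cdiff f s -> cdiff g s -> cdiff (fun z => f z * g z) s.
Proof. by move=> [d1 H1] [d2 H2]; eexists; exact: cderivM H1 H2. Qed.
Lemma cdiff_comp f g s : cdiff f s -> cdiff g (f s) -> cdiff (fun z => g (f z)) s.
Proof. by move=> [d1 H1] [d2 H2]; eexists; exact: cderiv_comp H1 H2. Qed.
Lemma cdiffN f s : cdiff f s -> cdiff (fun z => - f z) s.
Proof.
move=> fd; have := cdiffM (cdiff_cst (-1) s) fd.
by rewrite (_ : (fun z => -1 * f z) = (fun z => - f z))//; apply/funext => z; rewrite mulN1r.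
Qed.
Lemma cdiffB f g s : cdiff f s -> cdiff g s -> cdiff (fun z => f z - g z) s.
Proof. by move=> fd gd; exact: (cdiffD fd (cdiffN gd)). Qed.
Lemma cdiffV f s : f s != 0 -> cdiff f s -> cdiff (fun z => (f z)^-1) s.
Proof. by move=> f0 fd; apply: (cdiff_comp fd); eexists; exact: cderiv_inv. Qed.
Lemma cdiffX f n s : cdiff f s -> cdiff (fun z => f z ^+ n) s.
Proof.
move=> fd; elim: n => [|n IH]; first exact: (cdiff_cst 1).
rewrite (_ : (fun z => _) = (fun z => f z * f z ^+ n)); first exact: cdiffM.
by apply/funext => z; rewrite exprS.
Qed.
Lemma cdiff_near f g s : (exists2 r, 0 < r & forall z, cmod (z - s) < r -> f z = g z) ->
  cdiff f s -> cdiff g s.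
Proof. by move=> fg [d fd]; exists d; exact: cderiv_near fg fd. Qed.

End CplxBasics.

(** * Real derivatives and a second order Taylor bound *)

Section RealDerive.
Context {R : realType}.
Implicit Types (f g : R -> R) (x a b c : R).

Lemma rderE f x a b : is_derive x 1 f a -> a = b -> is_derive x 1 f b.
Proof. by move=> h <-. Qed.
Lemma rder_cst c x : is_derive x 1 (fun=> c) 0.
Proof. exact: is_derive_cst. Qed.
Lemma rder_id x : is_derive x 1 (fun t : R => t) 1.
Proof. exact: is_derive_id. Qed.
Lemma rderD f g x a b : is_derive x 1 f a -> is_derive x 1 g b ->
  is_derive x 1 (fun t => f t + g t) (a + b).
Proof. by move=> *; exact: is_deriveD. Qed.
Lemma rderB f g x a b : is_derive x 1 f a -> is_derive x 1 g b ->
  is_derive x 1 (fun t => f t - g t) (a - b).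
Proof. by move=> *; exact: is_deriveB. Qed.
Lemma rderN f x a : is_derive x 1 f a -> is_derive x 1 (fun t => - f t) (- a).
Proof. by move=> *; exact: is_deriveN. Qed.
Lemma rderM f g x a b : is_derive x 1 f a -> is_derive x 1 g b ->
  is_derive x 1 (fun t => f t * g t) (f x * b + g x * a).
Proof. by move=> fa gb; exact: is_deriveM. Qed.
Lemma rderZ f x c a : is_derive x 1 f a -> is_derive x 1 (fun t => c * f t) (c * a).
Proof. by move=> fa; have := rderM (rder_cst c x) fa; rewrite mulr0 addr0. Qed.
Lemma rder_comp f g x a b : is_derive (g x) 1 f a -> is_derive x 1 g b ->
  is_derive x 1 (fun t => f (g t)) (a * b).
Proof. by move=> *; exact: is_derive1_comp. Qed.
Lemma rder_exp g x b : is_derive x 1 g b ->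
  is_derive x 1 (fun t => expR (g t)) (expR (g x) * b).
Proof. by move=> *; apply: rder_comp. Qed.
Lemma rder_cos g x b : is_derive x 1 g b ->
  is_derive x 1 (fun t => cos (g t)) (- sin (g x) * b).
Proof. by move=> *; apply: rder_comp. Qed.
Lemma rder_sin g x b : is_derive x 1 g b ->
  is_derive x 1 (fun t => sin (g t)) (cos (g x) * b).
Proof. by move=> *; apply: rder_comp. Qed.
Lemma rder_ln g x b : 0 < g x -> is_derive x 1 g b ->
  is_derive x 1 (fun t => ln (g t)) ((g x)^-1 * b).
Proof. by move=> g0 gb; apply: rder_comp; apply: is_derive1_ln. Qed.
Lemma rder_continuous f x a : is_derive x 1 f a -> {for x, continuous f}.
Proof. by move=> fa; apply: differentiable_continuous; apply/derivable1_diffP; case: fa. Qed.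

(** Two mean value steps: [f 1 = f' c], then [f' c = f'' d * c] with [c <= 1]. The factor 1/2 of
    Taylor's formula is given up. *)
Lemma taylor2_bound f f' f'' M : f 0 = 0 -> f' 0 = 0 ->
  (forall x, is_derive x 1 f (f' x)) -> (forall x, is_derive x 1 f' (f'' x)) ->
  (forall x, 0 <= x <= 1 -> `|f'' x| <= M) -> `|f 1| <= M.
Proof.
move=> f0 f'0 df df' fM.
have wc g g' : (forall x, is_derive x 1 g (g' x)) -> forall a b, {within `[a, b], continuous g}.
  by move=> dg a b; apply: continuous_subspaceT => x; exact: rder_continuous (dg x).
have [c] := @MVT R f f' 0 1 ltr01 (fun x _ => df x) (wc _ _ df 0 1).
rewrite in_itv/= f0 !subr0 mulr1 => /andP[c0 c1] ->.
have [d] := @MVT R f' f'' 0 c c0 (fun x _ => df' x) (wc _ _ df' 0 c).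
rewrite in_itv/= f'0 !subr0 => /andP[d0 dc] ->.
rewrite normrM (ger0_norm (ltW c0)) (le_trans _ (fM d _))//.
  by rewrite ler_piMr// ltW.
by rewrite (ltW d0) (ltW (lt_trans dc c1)).
Qed.

End RealDerive.

(** * The complex exponential *)

Section Cexp.
Context {R : realType}.
Implicit Types (s w z h d : R[i]).

(* [cexp], typed so that ring operations are inferred on [R[i]] rather than on [R[i]^o] *)
Definition expC (z : R[i]) : R[i] := cexp z.

Lemma Re_expC z : complex.Re (expC z) = expR (complex.Re z) * cos (complex.Im z).
Proof. by []. Qed.
Lemma Im_expC z : complex.Im (expC z) = expR (complex.Re z) * sin (complex.Im z).
Proof. by []. Qed.

Lemma expC0 : expC 0 = 1.
Proof. by apply: complex_ext; rewrite /= expR0 ?cos0 ?sin0 ?mulr1 ?mulr0. Qed.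

Lemma expCD z w : expC (z + w) = expC z * expC w.
Proof.
case: z w => [a b] [c d]; rewrite /expC /cexp/=; apply: complex_ext => /=.
  by rewrite expRD cosD; ring.
by rewrite expRD sinD; ring.
Qed.

Lemma cmod_expC z : cmod (expC z) = expR (complex.Re z).
Proof.
rewrite cmodE Re_expC Im_expC !exprMn -mulrDr cos2Dsin2 mulr1 sqrtr_sqr.
by rewrite ger0_norm// expR_ge0.
Qed.

Lemma expC_neq0 z : expC z != 0.
Proof. by rewrite -cmod_gt0 cmod_expC expR_gt0. Qed.

Lemma expCN z : expC (- z) = (expC z)^-1.
Proof. by apply: (mulIf (expC_neq0 z)); rewrite -expCD addNr expC0 mulVf ?expC_neq0. Qed.

Lemma expC_real (r : R) : expC r%:C = (expR r)%:C.
Proof. by apply: complex_ext; rewrite /= ?cos0 ?sin0 ?mulr1 ?mulr0. Qed.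

(** The span of [e^(ta) cos(tb)] and [e^(ta) sin(tb)] is stable under differentiation; in the
    coordinates [(u, v)] one formula serves for the first and the second derivative. *)
Lemma rder_expcos (a b u v x : R) :
  is_derive x 1 (fun t => expR (t * a) * (u * cos (t * b) + v * sin (t * b)))
  (expR (x * a) * ((a * u + b * v) * cos (x * b) + (a * v - b * u) * sin (x * b))).
Proof.
have da (y : R) : is_derive x 1 (fun t => t * y) y.
  by apply: (rderE (rderM (rder_id x) (rder_cst y x))); ring.
apply: (rderE (rderM (rder_exp (da a))
  (rderD (rderZ u (rder_cos (da b))) (rderZ v (rder_sin (da b)))))).
by ring.
Qed.

(** Along the segment from 0 to [h], [taylor2_bound] applies to the real and to the imaginary part,
    whose second derivatives are parts of [h ^+ 2 * expC (x * h)]. The 2 comes from adding both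
    parts. *)
Lemma expC_taylor2 h : cmod (expC h - 1 - h) <= 2 * (cmod h ^+ 2 * expR (cmod h)).
Proof.
case: h => a b; set h := a +i* b.
(* The weights [(1, 0)] and [(0, 1)] select the real and the imaginary part, so that one computation
   covers both. *)
have key (u v : R) : `|u| <= 1 -> `|v| <= 1 -> `|u| + `|v| = 1 ->
  `|u * (expR a * cos b - 1 - a) + v * (expR a * sin b - b)| <= cmod h ^+ 2 * expR (cmod h).
  move=> u1 v1 uv.
  pose f t := expR (t * a) * (u * cos (t * b) + v * sin (t * b)) - (u + t * (u * a + v * b)).
  pose f' t := expR (t * a) * ((a * u + b * v) * cos (t * b) + (a * v - b * u) * sin (t * b)) - (u * a + v * b).
  pose f'' t := expR (t * a) * ((a * (a * u + b * v) + b * (a * v - b * u)) * cos (t * b) +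
     (a * (a * v - b * u) - b * (a * u + b * v)) * sin (t * b)).
  have dl (c d x : R) : is_derive x 1 (fun t => c + t * d) d.
    apply: (rderE (rderD (rder_cst c x) (rderM (rder_id x) (rder_cst d x)))); ring.
  have -> : u * (expR a * cos b - 1 - a) + v * (expR a * sin b - b) = f 1.
    by rewrite /f !mul1r; ring.
  apply: (@taylor2_bound _ f f' f'').
  - by rewrite /f !mul0r expR0 cos0 sin0; ring.
  - by rewrite /f' !mul0r expR0 cos0 sin0; ring.
  - by move=> x; exact: rderB (rder_expcos _ _ _ _ _) (dl _ _ _).
  - by move=> x; apply: (rderE (rderB (rder_expcos _ _ _ _ _) (rder_cst _ _))); rewrite subr0.
  - move=> x /andP[x0 x1].
    have -> : f'' x = expR (x * a) * (u * complex.Re (h ^+ 2 * (cos (x * b) +i* sin (x * b)))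
               + v * complex.Im (h ^+ 2 * (cos (x * b) +i* sin (x * b)))).
      by rewrite /f'' ReM ImM expr2 ReM ImM /=; ring.
    set w := h ^+ 2 * _.
    have wE : cmod w = cmod h ^+ 2.
      by rewrite /w cmodM cmodX [X in _ * X]cmodE/= cos2Dsin2 sqrtr1 mulr1.
    rewrite mulrC normrM ler_pM// -?wE.
      rewrite (le_trans (ler_normD _ _))// !normrM -[leRHS]mul1r -uv mulrDl.
      by rewrite lerD// ler_wpM2l// ?Re_le_cmod ?Im_le_cmod.
    rewrite ger0_norm ?expR_ge0// ler_expR (le_trans (ler_norm _))// normrM.
    rewrite -[leRHS]mul1r ler_pM// ?(ger0_norm x0)//.
    exact: (Re_le_cmod h).
have K1 := key 1 0 _ _ _; have K2 := key 0 1 _ _ _.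
rewrite (le_trans (cmod_le_ReIm _))// mulr2n mulrDl mul1r lerD//.
  have := K1; rewrite !normr1 !normr0 !mul1r !mul0r !addr0 /=.
  by rewrite ?subr0; apply.
have := K2; rewrite !normr1 !normr0 !mul1r !mul0r !add0r /=.
by rewrite ?subr0; apply.
Qed.

Lemma cderiv_expC s : cderiv expC s (expC s).
Proof.
move=> e e0.
set A := cmod (expC s) * 2 * expR 1.
have A0 : 0 < A by rewrite !mulr_gt0// ?expR_gt0// cmod_expC expR_gt0.
exists (Num.min 1 (e / A)); first by rewrite lt_min ltr01 divr_gt0.
move=> h; rewrite lt_min => /andP[h1]; rewrite ltr_pdivlMr// => h2.
have -> : expC (s + h) - expC s - expC s * h = (expC s) * (expC h - 1 - h).
  by rewrite expCD; ring.
rewrite cmodM (le_trans (ler_wpM2l (cmod_ge0 _) (expC_taylor2 h)))//.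
have h0 := cmod_ge0 h.
have E : expR (cmod h) <= expR 1 by rewrite ler_expR ltW.
rewrite [leLHS](_ : _ = cmod h * (cmod (expC s) * 2 * expR (cmod h)) * cmod h); last by ring.
rewrite ler_wpM2r// (le_trans _ (ltW h2))// ler_wpM2l// /A ler_wpM2l//.
by rewrite mulr_ge0// cmod_ge0.
Qed.

Lemma cdiff_expC (f : R[i] -> R[i]) s : cdiff f s -> cdiff (fun z => expC (f z)) s.
Proof. by move=> fd; apply: (cdiff_comp fd); eexists; exact: cderiv_expC. Qed.

End Cexp.

(** * Integrals of complex-valued functions *)

Section Cint.
Context {R : realType} (d : measure_display) (T : measurableType d).
Context (mu : {measure set T -> \bar R}) (D : set T).
Hypothesis mD : measurable D.
Implicit Types (f g : T -> R) (u v : T -> R[i]) (c : R[i]).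

Definition rintegrable f := mu.-integrable D (EFin \o f).

Lemma rintegrableD f g : rintegrable f -> rintegrable g -> rintegrable (fun x => f x + g x).
Proof. by move=> If Ig; have := integrableD mD If Ig; apply: eq_integrable. Qed.

Lemma rintegrableZ (r : R) f : rintegrable f -> rintegrable (fun x => r * f x).
Proof. by move=> If; have := integrableZl mD r If; apply: eq_integrable. Qed.

Lemma rintegrableN f : rintegrable f -> rintegrable (fun x => - f x).
Proof.
move=> If; have := rintegrableZ (-1) If; apply: eq_integrable => // x _ /=.
by rewrite mulN1r.
Qed.

Lemma rintegrableB f g : rintegrable f -> rintegrable g -> rintegrable (fun x => f x - g x).
Proof. by move=> If Ig; exact: rintegrableD If (rintegrableN Ig). Qed.

Lemma rintegrable_norm f : rintegrable f -> rintegrable (fun x => `|f x|).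
Proof. exact: integrable_norm. Qed.

Lemma rintegrable_eq f g : (forall x, D x -> f x = g x) -> rintegrable f -> rintegrable g.
Proof. by move=> fg; apply: eq_integrable => // x; rewrite inE => Dx /=; rewrite fg. Qed.

Lemma rintegrable_dom f g : measurable_fun D f -> (forall x, D x -> `|f x| <= g x) ->
  rintegrable g -> rintegrable f.
Proof.
move=> mf fg; apply: le_integrable => //; first exact/measurable_EFinP.
by move=> x Dx /=; rewrite lee_fin (le_trans (fg x Dx))// ler_norm.
Qed.

Lemma rintegrable_mfun f : rintegrable f -> measurable_fun D f.
Proof. by move=> /measurable_int/measurable_EFinP. Qed.

Definition cint u : R[i] := cintegral mu D u.
Lemma Re_cint u : complex.Re (cint u) = \int[mu]_(x in D) complex.Re (u x). Proof. by []. Qed.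
Lemma Im_cint u : complex.Im (cint u) = \int[mu]_(x in D) complex.Im (u x). Proof. by []. Qed.

Definition cintble u := cintegrable mu D u.

Lemma cintble_eq u v : (forall x, D x -> u x = v x) -> cintble u -> cintble v.
Proof.
by move=> uv [U1 U2]; split; [move: U1|move: U2]; apply: rintegrable_eq => x Dx; rewrite uv.
Qed.

Lemma cint_eq u v : (forall x, D x -> u x = v x) -> cint u = cint v.
Proof.
by move=> uv; rewrite /cint /cintegral; congr (_ +i* _); apply: eq_Rintegral => x;
  rewrite inE => Dx; rewrite uv.
Qed.

Lemma cintbleD u v : cintble u -> cintble v -> cintble (fun x => u x + v x).
Proof.
move=> [U1 U2] [V1 V2]; split.
  by apply: rintegrable_eq (rintegrableD U1 V1) => x _; rewrite ReD.
by apply: rintegrable_eq (rintegrableD U2 V2) => x _; rewrite ImD.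
Qed.

Lemma cintbleZ c u : cintble u -> cintble (fun x => c * u x).
Proof.
move=> [U1 U2]; split.
  apply: rintegrable_eq (rintegrableB (rintegrableZ (complex.Re c) U1)
    (rintegrableZ (complex.Im c) U2)) => x _; by rewrite ReM.
apply: rintegrable_eq (rintegrableD (rintegrableZ (complex.Re c) U2)
    (rintegrableZ (complex.Im c) U1)) => x _; by rewrite ImM.
Qed.

Lemma cintbleN u : cintble u -> cintble (fun x => - u x).
Proof.
move=> U; apply: cintble_eq (cintbleZ (-1) U) => x _; by rewrite mulN1r.
Qed.

Lemma cintbleB u v : cintble u -> cintble v -> cintble (fun x => u x - v x).
Proof. by move=> U V; exact: cintbleD U (cintbleN V). Qed.

Lemma cintD u v : cintble u -> cintble v -> cint (fun x => u x + v x) = cint u + cint v.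
Proof.
move=> [U1 U2] [V1 V2]; rewrite /cint /cintegral; apply: complex_ext; rewrite /= ?ReD ?ImD/=.
  by rewrite -RintegralD//; apply: eq_Rintegral => x _; rewrite ReD.
by rewrite -RintegralD//; apply: eq_Rintegral => x _; rewrite ImD.
Qed.

Lemma cintZ c u : cintble u -> cint (fun x => c * u x) = c * cint u.
Proof.
move=> [U1 U2]; rewrite /cint /cintegral; apply: complex_ext; rewrite /= ?ReM ?ImM/=.
  rewrite -!RintegralZl// -RintegralB//; try exact: rintegrableZ.
  by apply: eq_Rintegral => x _; rewrite ReM.
rewrite -!RintegralZl// -RintegralD//; try exact: rintegrableZ.
by apply: eq_Rintegral => x _; rewrite ImM.
Qed.

Lemma cintN u : cintble u -> cint (fun x => - u x) = - cint u.
Proof. by move=> U; rewrite -mulN1r -cintZ//; apply: cint_eq => x _; rewrite mulN1r. Qed.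

Lemma cintB u v : cintble u -> cintble v -> cint (fun x => u x - v x) = cint u - cint v.
Proof. by move=> U V; rewrite cintD ?cintN//; exact: cintbleN. Qed.

Lemma cintble_dom u g : measurable_fun D (fun x => complex.Re (u x)) ->
  measurable_fun D (fun x => complex.Im (u x)) ->
  (forall x, D x -> cmod (u x) <= g x) -> rintegrable g -> cintble u.
Proof.
move=> m1 m2 ug Ig; split; apply: rintegrable_dom Ig => // x Dx.
  by rewrite (le_trans (Re_le_cmod _))// ug.
by rewrite (le_trans (Im_le_cmod _))// ug.
Qed.

(** Both parts are bounded separately, whence the 2; this avoids rotating the integral onto the real
    axis. *)
Lemma cint_le u g : cintble u -> (forall x, D x -> cmod (u x) <= g x) -> rintegrable g ->
  cmod (cint u) <= 2 * \int[mu]_(x in D) g x.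
Proof.
move=> [U1 U2] ug Ig; rewrite (le_trans (cmod_le_ReIm _))// mulr2n mulrDl mul1r lerD//=.
  rewrite (le_trans (le_normr_Rintegral _ U1))//; apply: le_Rintegral => //.
    exact: rintegrable_norm.
  by move=> x Dx; rewrite (le_trans (Re_le_cmod _))// ug.
rewrite (le_trans (le_normr_Rintegral _ U2))//; apply: le_Rintegral => //.
  exact: rintegrable_norm.
by move=> x Dx; rewrite (le_trans (Im_le_cmod _))// ug.
Qed.

End Cint.
Arguments rintegrable {R d T} mu D f.
Arguments cintble {R d T} mu D u.
Arguments cint {R d T} mu D u.

(** * Integrals over segments *)

Section SegmentIntegral.
Context {R : realType}.
Notation leb := (@lebesgue_measure R).
Implicit Types (a b c : R) (f : R -> R) (u v : R -> R[i]).

Definition ccontR u x := forall e, 0 < e ->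
  exists2 r, 0 < r & forall y : R, `|y - x| < r -> cmod (u y - u x) < e.

Lemma ccontR_Re u x : ccontR u x -> {for x, continuous (fun t => complex.Re (u t))}.
Proof.
move=> uc; apply/cvgrPdist_lt => e e0; have [r r0 H] := uc e e0.
apply/nbhs_ballP; exists r => //= y; rewrite /ball/= distrC => /H.
by apply: le_lt_trans; rewrite distrC -ReN -ReD Re_le_cmod.
Qed.

Lemma ccontR_Im u x : ccontR u x -> {for x, continuous (fun t => complex.Im (u t))}.
Proof.
move=> uc; apply/cvgrPdist_lt => e e0; have [r r0 H] := uc e e0.
apply/nbhs_ballP; exists r => //= y; rewrite /ball/= distrC => /H.
by apply: le_lt_trans; rewrite distrC -ImN -ImD Im_le_cmod.
Qed.

Definition seg a b : set R := `[a, b]%classic.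

Lemma mseg a b : measurable (seg a b : set (measurableTypeR R)). Proof. exact: measurable_itv. Qed.

Lemma rintegrable_seg f a b : (forall x, seg a b x -> {for x, continuous f}) ->
  rintegrable leb (seg a b) f.
Proof.
move=> fc; apply: continuous_compact_integrable; first exact: segment_compact.
by apply: continuous_in_subspaceT => x; rewrite inE => /fc.
Qed.

Lemma cintble_seg u a b : (forall x, seg a b x -> ccontR u x) -> cintble leb (seg a b) u.
Proof.
by move=> uc; split; apply: rintegrable_seg => x /uc; [exact: ccontR_Re|exact: ccontR_Im].
Qed.

Lemma rint_split f a b c : a <= c -> c <= b -> rintegrable leb (seg a b) f ->
  \int[leb]_(x in seg a b) f x = \int[leb]_(x in seg a c) f x + \int[leb]_(x in seg c b) f x.
Proof.
move=> ac cb If.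
have := @Rintegral_itvB R f (BLeft a) (BRight b) c If.
rewrite !bnd_simp => /(_ ac cb) E; apply/eqP; rewrite addrC -subr_eq E; apply/eqP.
rewrite Rintegral_itv_obnd_cbnd//; apply: integrableS If => //; first exact: mseg.
by move=> x; rewrite /seg/= !in_itv/= => /andP[cx ->]; rewrite andbT (le_trans ac)// ltW.
Qed.

Lemma cint_split u a b c : a <= c -> c <= b -> cintble leb (seg a b) u ->
  cint leb (seg a b) u = cint leb (seg a c) u + cint leb (seg c b) u.
Proof.
move=> ac cb [U1 U2]; rewrite /cint /cintegral; apply: complex_ext; rewrite /= ?ReD ?ImD/=.
  exact: (rint_split ac cb U1).
exact: (rint_split ac cb U2).
Qed.

Lemma rint_cst_seg a b (k : R) : a <= b -> \int[leb]_(x in seg a b) k = k * (b - a).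
Proof.
move=> ab; rewrite Rintegral_cst; last exact: mseg.
have E : leb (seg a b) = (b - a)%:E.
  apply: etrans (lebesgue_measure_itv _) _; rewrite /= lte_fin.
  by case: ltgtP ab => // -> _; rewrite subrr.
by rewrite -[b - a]/(fine (b - a)%:E) -E.
Qed.

Lemma cint_seg_le u a b (M : R) : a <= b -> cintble leb (seg a b) u ->
  (forall x, seg a b x -> cmod (u x) <= M) -> cmod (cint leb (seg a b) u) <= 2 * (M * (b - a)).
Proof.
move=> ab U uM; rewrite -rint_cst_seg//; apply: cint_le => //; first exact: mseg.
by apply: rintegrable_seg => x _; exact: cst_continuous.
Qed.

Lemma rint_FTC (f F : R -> R) a b : a <= b -> (forall x, seg a b x -> {for x, continuous f}) ->
  (forall x, seg a b x -> is_derive x 1 F (f x)) ->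
  \int[leb]_(x in seg a b) f x = F b - F a.
Proof.
rewrite le_eqVlt => /predU1P[<- _ _|ab fc dF].
  by rewrite /seg set_itv1 Rintegral_set1 subrr.
rewrite /Rintegral (@continuous_FTC2 R f F a b)//.
- by apply: continuous_in_subspaceT => x; rewrite inE => /fc.
- have cF x : seg a b x -> {for x, continuous F} by move=> /dF; exact: rder_continuous.
  split.
  + by move=> x xab; case: (dF x _) => //; exact: subset_itv_oo_cc xab.
  + by apply: cvg_at_right_filter; apply: cF; rewrite /seg/= in_itv/= lexx ltW.
  + by apply: cvg_at_left_filter; apply: cF; rewrite /seg/= in_itv/= lexx ltW.
- move=> x xab; rewrite derive1E; case: (dF x _) => //; exact: subset_itv_oo_cc xab.
Qed.

End SegmentIntegral.

(** * Goursat's theorem on rectangles *)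

Section Goursat.
Context {R : realType}.
Notation leb := (@lebesgue_measure R).
Implicit Types (x y w l e : R) (h g : R[i] -> R[i]) (z c d p : R[i]).

Lemma ccont_hline h x y : ccont h (x +i* y) -> ccontR (fun t => h (t +i* y)) x.
Proof.
move=> hc e e0; have [r r0 H] := hc e e0; exists r => // t tx.
have -> : t +i* y = x +i* y + (t - x)%:C by apply: complex_ext => /=; ring.
by apply: H; rewrite cmod_real.
Qed.

Lemma ccont_vline h x y : ccont h (x +i* y) -> ccontR (fun t => h (x +i* t)) y.
Proof.
move=> hc e e0; have [r r0 H] := hc e e0; exists r => // t tx.
have -> : x +i* t = x +i* y + 'i * (t - y)%:C by apply: complex_ext => /=; ring.
by apply: H; rewrite cmodM cmod_real cmodE/= expr0n/= add0r expr1n sqrtr1 mul1r.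
Qed.

Definition rect x0 x1 y0 y1 z := x0 <= complex.Re z <= x1 /\ y0 <= complex.Im z <= y1.

(** The contour integral over the boundary, counterclockwise: [dz = dx] on horizontal sides and
    [dz = i dy] on vertical ones. *)
Definition loop h x0 x1 y0 y1 : R[i] :=
  cint leb (seg x0 x1) (fun x => h (x +i* y0)) - cint leb (seg x0 x1) (fun x => h (x +i* y1))
  + 'i * (cint leb (seg y0 y1) (fun y => h (x1 +i* y)) - cint leb (seg y0 y1) (fun y => h (x0 +i* y))).

Definition ccont_on h x0 x1 y0 y1 := forall z, rect x0 x1 y0 y1 z -> ccont h z.

Lemma hline_int h x0 x1 y0 y1 y : ccont_on h x0 x1 y0 y1 -> y0 <= y <= y1 ->
  cintble leb (seg x0 x1) (fun x => h (x +i* y)).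
Proof.
move=> hc yy; apply: cintble_seg => x xx; apply: ccont_hline; apply: hc.
by split=> //=; move: xx; rewrite /seg/= in_itv.
Qed.

Lemma vline_int h x0 x1 y0 y1 x : ccont_on h x0 x1 y0 y1 -> x0 <= x <= x1 ->
  cintble leb (seg y0 y1) (fun y => h (x +i* y)).
Proof.
move=> hc xx; apply: cintble_seg => y yy; apply: ccont_vline; apply: hc.
by split=> //=; move: yy; rewrite /seg/= in_itv.
Qed.

Lemma cint_cst_seg x0 x1 c : x0 <= x1 -> cint leb (seg x0 x1) (fun=> c) = (x1 - x0)%:C * c.
Proof.
move=> x01; rewrite /cint /cintegral; apply: complex_ext; rewrite ?ReM ?ImM /=.
  by rewrite (rint_cst_seg _ x01) mul0r subr0 mulrC.
by rewrite (rint_cst_seg _ x01) mul0r addr0 mulrC.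
Qed.

Lemma loopD h g x0 x1 y0 y1 : x0 <= x1 -> y0 <= y1 ->
  ccont_on h x0 x1 y0 y1 -> ccont_on g x0 x1 y0 y1 ->
  loop (fun z => h z + g z) x0 x1 y0 y1 = loop h x0 x1 y0 y1 + loop g x0 x1 y0 y1.
Proof.
move=> x01 y01 hc gc; rewrite /loop.
rewrite !cintD; try exact: mseg; try (apply: hline_int; [eassumption|by rewrite ?lexx ?y01]);
  try (apply: vline_int; [eassumption|by rewrite ?lexx ?x01]).
by ring.
Qed.

(** On opposite sides the function differs by a constant, and the two resulting multiples of
    ['i * d] times the area cancel. *)
Lemma loop_affine c d x0 x1 y0 y1 : x0 <= x1 -> y0 <= y1 ->
  loop (fun z => c + d * z) x0 x1 y0 y1 = 0.
Proof.
move=> x01 y01; rewrite /loop.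
have hc : ccont_on (fun z => c + d * z) x0 x1 y0 y1.
  move=> z _; apply: cdiff_cont; apply: cdiffD (cdiff_cst _ _) _.
  exact: cdiffM (cdiff_cst _ _) (cdiff_id _).
set h := fun z => c + d * z in hc *.
rewrite -(cintB (mseg _ _) (hline_int hc _) (hline_int hc _)) ?lexx ?y01//.
rewrite -(cintB (mseg _ _) (vline_int hc _) (vline_int hc _)) ?lexx ?x01//.
have -> : (fun x => h (x +i* y0) - h (x +i* y1)) = (fun=> d * ('i * (y0 - y1)%:C)).
  apply/funext => x; rewrite /h (_ : x +i* y0 = x +i* y1 + 'i * (y0 - y1)%:C); first by ring.
  by apply: complex_ext => /=; ring.
have -> : (fun y => h (x1 +i* y) - h (x0 +i* y)) = (fun=> d * (x1 - x0)%:C).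
  apply/funext => y; rewrite /h (_ : x1 +i* y = x0 +i* y + (x1 - x0)%:C); first by ring.
  by apply: complex_ext => /=; ring.
rewrite !cint_cst_seg// -(opprB y1) rmorphN/=.
by ring.
Qed.

Lemma loop_le h x0 x1 y0 y1 (M : R) : x0 <= x1 -> y0 <= y1 -> ccont_on h x0 x1 y0 y1 ->
  (forall z, rect x0 x1 y0 y1 z -> cmod (h z) <= M) ->
  cmod (loop h x0 x1 y0 y1) <= 4 * (M * ((x1 - x0) + (y1 - y0))).
Proof.
move=> x01 y01 hc hM.
have H y : y0 <= y <= y1 -> cmod (cint leb (seg x0 x1) (fun x => h (x +i* y))) <= 2 * (M * (x1 - x0)).
  move=> yy; apply: cint_seg_le => //; first exact: hline_int hc yy.
  by move=> x; rewrite /seg/= in_itv/= => xx; apply: hM; split.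
have V x : x0 <= x <= x1 -> cmod (cint leb (seg y0 y1) (fun y => h (x +i* y))) <= 2 * (M * (y1 - y0)).
  move=> xx; apply: cint_seg_le => //; first exact: vline_int hc xx.
  by move=> y; rewrite /seg/= in_itv/= => yy; apply: hM; split.
have ci : cmod ('i : R[i]) = 1 by rewrite cmodE/= expr0n/= add0r expr1n sqrtr1.
rewrite /loop (le_trans (cmodD _ _))// (le_trans (lerD (cmodD _ _) (lexx _)))// cmodM ci mul1r.
rewrite (le_trans (lerD (lexx _) (cmodD _ _)))// !cmodN.
have := H y0; have := H y1; have := V x0; have := V x1; rewrite !lexx x01 y01.
move=> /(_ isT) v1 /(_ isT) v0 /(_ isT) h1 /(_ isT) h0.
by rewrite (le_trans (lerD (lerD h0 h1) (lerD v1 v0)))//; lra.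
Qed.

Lemma loop_splitx h x0 xm x1 y0 y1 : x0 <= xm -> xm <= x1 -> y0 <= y1 ->
  ccont_on h x0 x1 y0 y1 ->
  loop h x0 x1 y0 y1 = loop h x0 xm y0 y1 + loop h xm x1 y0 y1.
Proof.
move=> x0m xm1 y01 hc; rewrite /loop.
rewrite (cint_split x0m xm1 (hline_int hc _)) ?lexx ?y01//.
rewrite (cint_split x0m xm1 (hline_int hc _)) ?lexx ?y01//.
by ring.
Qed.

Lemma loop_splity h x0 x1 y0 ym y1 : y0 <= ym -> ym <= y1 -> x0 <= x1 ->
  ccont_on h x0 x1 y0 y1 ->
  loop h x0 x1 y0 y1 = loop h x0 x1 y0 ym + loop h x0 x1 ym y1.
Proof.
move=> y0m ym1 x01 hc; rewrite /loop.
rewrite (cint_split y0m ym1 (vline_int hc _)) ?lexx ?x01//.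
rewrite (cint_split y0m ym1 (vline_int hc _)) ?lexx ?x01//.
by ring.
Qed.

(** The supremum of the left ends works, since every right end bounds all left ends. *)
Lemma nested_point (u : nat -> R) w : 0 <= w -> (forall n, u n <= u n.+1) ->
  (forall n, u n.+1 + w / 2 ^+ n.+1 <= u n + w / 2 ^+ n) ->
  exists p : R, forall n, u n <= p <= u n + w / 2 ^+ n.
Proof.
move=> w0 u1 u2.
have mono m n : (m <= n)%N -> u m <= u n.
  by apply: (@homo_leq _ _ (fun a b => a <= b)) => // a b c; exact: le_trans.
have anti m n : (m <= n)%N -> u n + w / 2 ^+ n <= u m + w / 2 ^+ m.
  move=> mn; apply: (@homo_leq _ (fun n => u n + w / 2 ^+ n) (fun a b => b <= a)) mn => //.
  by move=> a b c ab bc; exact: le_trans bc ab.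
have ub n : ubound (range u) (u n + w / 2 ^+ n).
  move=> _ [m _ <-]; case: (leqP m n) => mn.
    by rewrite (le_trans (mono _ _ mn))// lerDl divr_ge0// exprn_ge0.
  by rewrite (le_trans _ (anti _ _ (ltnW mn)))// lerDl divr_ge0// exprn_ge0.
exists (sup (range u)) => n; apply/andP; split.
  by apply: ub_le_sup; [exists (u 0%N + w / 2 ^+ 0); exact: ub|exists n].
by apply: ge_sup; [exists (u 0%N); exists 0%N|exact: ub].
Qed.

Lemma pigeonhole4 (q q1 q2 q3 q4 : R) : q <= q1 + q2 + (q3 + q4) ->
  q1 < q / 4 -> q2 < q / 4 -> q3 < q / 4 -> q4 < q / 4 -> False.
Proof. lra. Qed.

Lemma dist_le_width (a b s t : R) : a <= s <= a + b -> a <= t <= a + b -> `|s - t| <= b.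
Proof. by move=> /andP[s1 s2] /andP[t1 t2]; rewrite ler_norml; apply/andP; split; lra. Qed.

(** Repeated quartering keeps a piece carrying at least a quarter of the integral, so the n-th piece
    carries at least [J / 4 ^+ n]. The pieces shrink to a point where [h] is affine up to a small
    multiple of the diameter, and this makes the n-th integral smaller than that. *)
Theorem goursat h x0 x1 y0 y1 : x0 <= x1 -> y0 <= y1 ->
  (forall z, rect x0 x1 y0 y1 z -> cdiff h z) -> loop h x0 x1 y0 y1 = 0.
Proof.
move=> x01 y01 hd.
pose w := x1 - x0; pose l := y1 - y0.
have w0 : 0 <= w by rewrite subr_ge0.
have l0 : 0 <= l by rewrite subr_ge0.
pose W n := w / 2 ^+ n; pose L n := l / 2 ^+ n.
have W0 n : 0 <= W n by rewrite divr_ge0// exprn_ge0.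
have L0 n : 0 <= L n by rewrite divr_ge0// exprn_ge0.
have WS n : W n = W n.+1 + W n.+1.
  by rewrite /W exprS invfM; field; rewrite expf_neq0.
have LS n : L n = L n.+1 + L n.+1.
  by rewrite /L exprS invfM; field; rewrite expf_neq0.
pose Q n (p : R * R) := loop h p.1 (p.1 + W n) p.2 (p.2 + L n).
pose ins n (p : R * R) := [/\ x0 <= p.1, p.1 + W n <= x1, y0 <= p.2 & p.2 + L n <= y1].
pose next n (p q : R * R) := [/\ ins n.+1 q,
  p.1 <= q.1 /\ q.1 + W n.+1 <= p.1 + W n,
  p.2 <= q.2 /\ q.2 + L n.+1 <= p.2 + L n &
  cmod (Q n p) / 4 <= cmod (Q n.+1 q)].
(* The condition [ins] is put under the existential, so that [choice] yields a total function;
   outside [ins] any witness does. *)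
have step (a : nat * (R * R)) : exists q, ins a.1 a.2 -> next a.1 a.2 q.
  case: a => n [a b] /=; have [/= i|] := pselect (ins n (a, b)); last by exists (0, 0).
  case: (i) => /= i1 i2 i3 i4; have := W0 n.+1; have := L0 n.+1 => Ln Wn.
  have hc : ccont_on h a (a + W n) b (b + L n).
    move=> z [/andP[z1 z2] /andP[z3 z4]]; apply: cdiff_cont; apply: hd; split; apply/andP; split.
    - exact: le_trans z1. - exact: le_trans i2. - exact: le_trans z3. - exact: le_trans i4.
  have aW : a + W n = a + W n.+1 + W n.+1 by rewrite -addrA -WS.
  have bL : b + L n = b + L n.+1 + L n.+1 by rewrite -addrA -LS.
  have E : Q n (a, b) = Q n.+1 (a, b) + Q n.+1 (a, b + L n.+1) +
      (Q n.+1 (a + W n.+1, b) + Q n.+1 (a + W n.+1, b + L n.+1)).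
    rewrite /Q/= (@loop_splitx h a (a + W n.+1) (a + W n)) ?lerDl//; try by rewrite aW lerDl.
    rewrite (@loop_splity h _ _ b (b + L n.+1) (b + L n)) ?lerDl//; try by rewrite bL lerDl.
      rewrite (@loop_splity h _ (a + W n) b (b + L n.+1) (b + L n)) ?lerDl//; try by rewrite ?aW ?bL lerDl.
        by rewrite -aW -bL.
      move=> z [/andP[z1 z2] z3]; apply: hc; split=> //; rewrite z2 andbT (le_trans _ z1)// lerDl//.
    move=> z [/andP[z1 z2] z3]; apply: hc; split=> //; rewrite z1 (le_trans z2)// aW lerDl//.
  have T : cmod (Q n (a, b)) <= cmod (Q n.+1 (a, b)) + cmod (Q n.+1 (a, b + L n.+1)) +
      (cmod (Q n.+1 (a + W n.+1, b)) + cmod (Q n.+1 (a + W n.+1, b + L n.+1))).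
    by rewrite E (le_trans (cmodD _ _))// lerD// cmodD.
  have mk a' b' : a <= a' -> a' + W n.+1 <= a + W n -> b <= b' -> b' + L n.+1 <= b + L n ->
      cmod (Q n (a, b)) / 4 <= cmod (Q n.+1 (a', b')) -> next n (a, b) (a', b').
    move=> h1 h2 h3 h4 h5; split=> //; split=> /=.
    - exact: le_trans h1. - exact: le_trans i2. - exact: le_trans h3. - exact: le_trans i4.
  have [|j1] := leP (cmod (Q n (a, b)) / 4) (cmod (Q n.+1 (a, b))).
    by exists (a, b) => _; apply: mk; rewrite // ?aW ?bL lerDl.
  have [|j2] := leP (cmod (Q n (a, b)) / 4) (cmod (Q n.+1 (a, b + L n.+1))).
    by exists (a, b + L n.+1) => _; apply: mk; rewrite // ?aW ?bL ?lexx ?lerDl.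
  have [|j3] := leP (cmod (Q n (a, b)) / 4) (cmod (Q n.+1 (a + W n.+1, b))).
    by exists (a + W n.+1, b) => _; apply: mk; rewrite // ?aW ?bL ?lexx ?lerDl.
  have [|j4] := leP (cmod (Q n (a, b)) / 4) (cmod (Q n.+1 (a + W n.+1, b + L n.+1))).
    by exists (a + W n.+1, b + L n.+1) => _; apply: mk; rewrite // ?aW ?bL ?lexx ?lerDl.
  by have := pigeonhole4 T j1 j2 j3 j4.
have [f fP] := choice step.
pose u := fix u n := if n is m.+1 then f (m, u m) else (x0, y0).
have E0 : W 0%N = x1 - x0 by rewrite /W expr0 divr1.
have E1 : L 0%N = y1 - y0 by rewrite /L expr0 divr1.
have insu n : ins n (u n).
  elim: n => [|n IH]; last by have [] := fP (n, u n) IH.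
    by rewrite /ins E0 E1 (addrC x0) (addrC y0) !subrK; split; exact: lexx.
have nextu n : next n (u n) (u n.+1) by exact: (fP (n, u n) (insu n)).
have [px pxP] : exists p : R, forall n, (u n).1 <= p <= (u n).1 + W n.
  by apply: nested_point => // n; have [_ [] ] := nextu n.
have [py pyP] : exists p : R, forall n, (u n).2 <= p <= (u n).2 + L n.
  by apply: nested_point => // n; have [_ _ [] ] := nextu n.
pose J := cmod (loop h x0 x1 y0 y1).
have QJ n : J / 4 ^+ n <= cmod (Q n (u n)).
  elim: n => [|n IH].
    rewrite expr0 divr1 /Q E0 E1 [(u 0%N).1 + _]addrC [(u 0%N).2 + _]addrC /=.
    by rewrite !subrK; exact: lexx.
  have [_ _ _] := nextu n; apply: le_trans.
  by rewrite exprSr invfM mulrA ler_wpM2r// invr_ge0.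
apply/eqP; rewrite -cmod_eq0 -/J; apply/negP => /negP J0.
have {}J0 : 0 < J by rewrite lt_def J0 cmod_ge0.
pose S := w + l; have S0 : 0 <= S by rewrite addr_ge0.
have S1 : 0 < 4 * (S ^+ 2 + 1) by rewrite mulr_gt0// ltr_wpDl// sqr_ge0.
have [d dP] : cdiff h (px +i* py).
  apply: hd; have [i1 i2 i3 i4] := insu 0%N.
  by have /andP[p1 p2] := pxP 0%N; have /andP[p3 p4] := pyP 0%N; split; apply/andP; split => /=;
    [exact: le_trans i1 p1|exact: le_trans p2 i2|exact: le_trans i3 p3|exact: le_trans p4 i4].
(* With this [e] the final bound [4 * e * S ^+ 2 / 4 ^+ n] falls below [J / 4 ^+ n]; the [+ 1]
   covers the degenerate case [S = 0]. *)
have [r r0 H] := dP (J / (4 * (S ^+ 2 + 1))) (divr_gt0 J0 S1).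
set e := J / _ in H.
have e0 : 0 < e by rewrite divr_gt0.
have [n nP] : exists n, S / 2 ^+ n < r.
  have := @cvg_geometric R S 2^-1; rewrite normfV gtr0_norm// invf_lt1// ltr1n => /(_ isT).
  move=> /cvgrPdist_lt /(_ _ r0) [n _ /(_ n (leqnn n))] /=.
  rewrite sub0r normrN ger0_norm ?mulr_ge0 ?exprn_ge0// => ?; exists n.
  by rewrite -exprVn.
have nS : W n + L n = S / 2 ^+ n by rewrite -mulrDl.
have [i1 i2 i3 i4] := insu n.
set p := px +i* py in dP H.
have zp z : rect (u n).1 ((u n).1 + W n) (u n).2 ((u n).2 + L n) z -> cmod (z - p) <= S / 2 ^+ n.
  move=> [z1 z2]; rewrite (le_trans (cmod_le_ReIm _))// -nS lerD//.
    by rewrite ReD ReN; exact: dist_le_width z1 (pxP n).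
  by rewrite ImD ImN; exact: dist_le_width z2 (pyP n).
(* The affine part has integral zero by [loop_affine]; what remains is [o(cmod (z - p))]. *)
pose g z := h z - (h p - d * p + d * z).
have gd z : rect (u n).1 ((u n).1 + W n) (u n).2 ((u n).2 + L n) z -> cdiff g z.
  move=> [/andP[z1 z2] /andP[z3 z4]]; apply: cdiffB.
    apply: hd; split; apply/andP; split.
    - exact: le_trans z1. - exact: le_trans i2. - exact: le_trans z3. - exact: le_trans i4.
  apply: cdiffD (cdiff_cst _ _) _; exact: cdiffM (cdiff_cst _ _) (cdiff_id _).
have : cmod (Q n (u n)) <= 4 * (e * (S / 2 ^+ n) * (W n + L n)).
  have -> : Q n (u n) = loop g (u n).1 ((u n).1 + W n) (u n).2 ((u n).2 + L n).
    rewrite /Q (_ : h = fun z => g z + (h p - d * p + d * z)); last first.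
      by apply/funext => z; rewrite subrK.
    rewrite loopD ?lerDl// ?loop_affine ?lerDl ?addr0//.
      by move=> z /gd /cdiff_cont.
    move=> z _; apply: cdiff_cont; apply: cdiffD (cdiff_cst _ _) _.
    exact: cdiffM (cdiff_cst _ _) (cdiff_id _).
  have WE (a b : R) : a + b - a = b by ring.
  rewrite -{2}(WE (u n).1 (W n)) -{2}(WE (u n).2 (L n)).
  apply: loop_le; rewrite ?lerDl//; first by move=> z /gd /cdiff_cont.
  move=> z zR; have := H (z - p); rewrite (addrC p) subrK => /(_ (le_lt_trans (zp z zR) nP)).
  rewrite (_ : h z - h p - d * (z - p) = g z); last by rewrite /g; ring.
  move=> /le_trans; apply; rewrite ler_wpM2l ?(ltW e0)//; exact: zp.
apply/negP; rewrite -ltNge; apply: lt_le_trans (QJ n).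
rewrite nS ltr_pdivlMr ?exprn_gt0//.
have -> : (4 : R) ^+ n = 2 ^+ n * 2 ^+ n by rewrite -exprMn -natrM.
rewrite [ltLHS](_ : _ = e * (4 * S ^+ 2)); last by field; rewrite expf_neq0.
by rewrite /e mulrAC ltr_pdivrMr// ltr_pM2l// ltr_pM2l// ltrDl.
Qed.

End Goursat.

(** * The identity theorem *)

Section Identity.
Context {R : realType}.
Notation leb := (@lebesgue_measure R).
Implicit Types (x y r e : R) (f h g : R[i] -> R[i]) (z c a v : R[i]).

Lemma ccontR_bounded (u : R -> R[i]) x0 x1 : x0 <= x1 ->
  (forall x, seg x0 x1 x -> ccontR u x) ->
  exists M, forall x, seg x0 x1 x -> cmod (u x) <= M.
Proof.
move=> x01 uc.
have B (k : R -> R) : (forall x, seg x0 x1 x -> {for x, continuous k}) ->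
    exists M, forall x, seg x0 x1 x -> `|k x| <= M.
  move=> kc; have kc' : {within seg x0 x1, continuous (fun x => `|k x|)}.
    apply: continuous_in_subspaceT => x; rewrite inE => /kc xc.
    exact: continuous_comp xc (@norm_continuous _ _ _).
  have [c _ cP] := EVT_max x01 kc'.
  by exists `|k c| => x xx; exact: cP.
have [M1 B1] := B _ (fun x xx => ccontR_Re (uc x xx)).
have [M2 B2] := B _ (fun x xx => ccontR_Im (uc x xx)).
exists (M1 + M2) => x xx; rewrite (le_trans (cmod_le_ReIm _))//.
by rewrite lerD ?B1 ?B2.
Qed.

Lemma expC_polar x y : expC (x +i* y) = (expR x)%:C * (cos y +i* sin y).
Proof. by apply: complex_ext; rewrite ?ReM ?ImM /=; ring. Qed.

Lemma cmod_cis y : cmod (cos y +i* sin y) = 1 :> R.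
Proof. by rewrite cmodE/= cos2Dsin2 sqrtr1. Qed.

(* Cauchy's mean value property: in logarithmic coordinates the circles around
   [a] become the vertical sides of rectangles whose horizontal sides cancel by
   periodicity, so that the circle can be shrunk to [a] *)
Lemma mean_value_le f a r R0 M : 0 < r < R0 ->
  (forall z, cmod (z - a) < R0 -> cdiff f z) ->
  (forall y, seg 0 (pi *+ 2) y -> cmod (f (a + r%:C * (cos y +i* sin y))) <= M) ->
  cmod (f a) <= 2 * M.
Proof.
move=> /andP[r0 rR] fd fM.
have p0 : 0 < pi *+ 2 :> R by rewrite pmulrn_lgt0// pi_gt0.
apply/ler_addgt0Pr => e e0.
have e20 : 0 < e / 2 by rewrite divr_gt0.
have fda : cdiff f a by apply: fd; rewrite subrr cmod0 (lt_trans r0).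
have [q q0 Hq] := cdiff_cont fda e20.
(* Radius of the inner circle: small enough that [f] is within [e / 2] of [f a] on it. *)
have [q' [q'0 q'q q'r]] : exists q', [/\ 0 < q', q' < q & q' <= r].
  exists (Num.min (q / 2) r); split; first by rewrite lt_min r0 divr_gt0.
    by rewrite gt_min ltr_pdivrMr// mulr2n mulrDr mulr1 ltrDl q0.
  by rewrite ge_min lexx orbT.
have lr : expR (ln r) = r by rewrite lnK ?posrE.
have lq : expR (ln q') = q' by rewrite lnK ?posrE.
pose h z := f (a + expC z).
have hd z : rect (ln q') (ln r) 0 (pi *+ 2) z -> cdiff h z.
  move=> [/andP[_ zr] _].
  apply: (@cdiff_comp _ (fun z => a + expC z) f).
    by apply: cdiffD (cdiff_cst _ _) _; exact: cdiff_expC (cdiff_id _).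
  apply: fd; rewrite (addrC a) addrK cmod_expC (le_lt_trans _ rR)//.
  by rewrite -lr ler_expR.
have q'ln : ln q' <= ln r by rewrite ler_ln.
have := goursat q'ln (ltW p0) hd.
rewrite /loop.
have -> : (fun x => h (x +i* (pi *+ 2))) = (fun x => h (x +i* 0)).
  apply/funext => x; rewrite /h !expC_polar cos0 sin0.
  by rewrite cos2pi sin2pi.
rewrite subrr add0r => /eqP; rewrite mulf_eq0 => /orP[|].
  by rewrite eq_complex/= oner_eq0 andbF.
rewrite subr_eq0 => /eqP E.
have hc : ccont_on h (ln q') (ln r) 0 (pi *+ 2) by move=> z /hd /cdiff_cont.
have I1 := vline_int hc (x := ln r); rewrite lexx q'ln in I1; have {}I1 := I1 isT.
have I0 := vline_int hc (x := ln q'); rewrite lexx q'ln in I0; have {}I0 := I0 isT.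
have B1 : cmod (cint leb (seg 0 (pi *+ 2)) (fun y => h (ln r +i* y))) <= 2 * (M * (pi *+ 2 - 0)).
  apply: (cint_seg_le (ltW p0) I1).
  by move=> y yy; rewrite /h expC_polar lr; exact: fM yy.
have Ic : cintble leb (seg 0 (pi *+ 2)) (fun=> f a).
  apply: cintble_seg => x _ e' e'0; exists 1; first exact: ltr01.
  by move=> y _; rewrite subrr cmod0.
have B0 : cmod (cint leb (seg 0 (pi *+ 2)) (fun y => h (ln q' +i* y) - f a)) <= 2 * (e / 2 * (pi *+ 2 - 0)).
  apply: (cint_seg_le (ltW p0) (cintbleB (mseg 0 (pi *+ 2)) I0 Ic)).
  move=> y yy; apply: ltW; apply: Hq; rewrite expC_polar cmodM cmod_cis cmod_real mulr1 lq.
  by rewrite (ger0_norm (ltW q'0)).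
have pE : cmod (cint leb (seg 0 (pi *+ 2)) (fun=> f a)) = pi *+ 2 * cmod (f a).
  by rewrite (cint_cst_seg _ (ltW p0)) subr0 cmodM cmod_real (ger0_norm (ltW p0)).
rewrite -(ler_pM2l p0) -pE.
(* The integral of the constant [f a] is the one over the outer circle minus their difference; by
   [E] the latter can be computed on the inner circle, where the integrand is small. *)
rewrite -[cint _ _ (fun=> f a)](subKr (cint leb (seg 0 (pi *+ 2)) (fun y => h (ln r +i* y)))).
apply: le_trans (cmodD _ _) _; rewrite cmodN {2}E -(cintB (mseg 0 (pi *+ 2)) I0 Ic).
apply: le_trans (lerD B1 B0) _; rewrite !subr0.
by rewrite le_eqVlt; apply/orP; left; apply/eqP; field.
Qed.

Lemma geometric_lt (K q e : R) : 0 <= q < 1 -> 0 < e -> exists n, K * q ^+ n < e.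
Proof.
move=> /andP[q0 q1] e0.
have := @cvg_geometric R K q; rewrite ger0_norm// => /(_ q1).
move=> /cvgrPdist_lt /(_ _ e0) [n _ /(_ n (leqnn n))] /=.
by rewrite sub0r normrN => H; exists n; rewrite (le_lt_trans (ler_norm _)).
Qed.

(* Apply [mean_value_le] at [a] to [f z / (z - c) ^+ n] and let [n] tend to
   infinity: the circle of radius [2 * p] around [a] is further from [c] than [a]. *)
Lemma identity_local f c a e p : 0 < e ->
  (forall z, cmod (z - c) < 3 * p -> cdiff f z) ->
  (forall z, cmod (z - c) < e -> f z = 0) ->
  cmod (a - c) < p -> f a = 0.
Proof.
move=> e0 fd fz ap.
have [/fz //|ae] := ltP (cmod (a - c)) e.
set t := cmod (a - c) in ap ae.
have t0 : 0 < t by rewrite (lt_le_trans e0).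
have p0 : 0 < p by rewrite (lt_trans t0).
have pi0 : 0 <= pi *+ 2 :> R by rewrite mulrn_wge0// pi_ge0.
have near_c z : cmod (z - a) < 3 * p - t -> cmod (z - c) < 3 * p.
  move=> za; have -> : z - c = (z - a) + (a - c) by ring.
  by rewrite (le_lt_trans (cmodD _ _))// -ltrBrDr.
have rad : 0 < 2 * p < 3 * p - t by apply/andP; split; lra.
have circ y : cmod (a + (2 * p)%:C * (cos y +i* sin y) - a) = 2 * p.
  by rewrite addrAC subrr add0r cmodM cmod_cis cmod_real mulr1 ger0_norm// mulr_ge0// ltW.
have [M MP] : exists M, forall y, seg 0 (pi *+ 2) y ->
    cmod (f (a + (2 * p)%:C * (cos y +i* sin y))) <= M.
  apply: ccontR_bounded => // y _.
  have H : cdiff (fun z => f (a + expC z)) (ln (2 * p) +i* y).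
    apply: (@cdiff_comp _ (fun z => a + expC z) f).
      by apply: cdiffD (cdiff_cst _ _) _; exact: cdiff_expC (cdiff_id _).
    apply: fd; apply: near_c; rewrite expC_polar lnK ?posrE ?mulr_gt0// circ.
    by case/andP: rad.
  have := ccont_vline (cdiff_cont H).
  rewrite (_ : (fun y => _) = (fun y => f (a + (2 * p)%:C * (cos y +i* sin y))))//.
  by apply/funext => x; rewrite expC_polar lnK// posrE mulr_gt0.
have M0 : 0 <= M.
  by rewrite (le_trans _ (MP 0 _)) ?cmod_ge0// /seg/= in_itv/= lexx.
apply/eqP; rewrite -cmod_eq0 eq_le cmod_ge0 andbT.
apply/ler_addgt0Pr => d d0; rewrite add0r.
(* The distance from [a] to [c] against the least distance from the circle to [c]. The mean value
   inequality reads [cmod (f a) <= 2 * M * q ^+ n], so its factor 2 does no harm. *)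
pose q := t / (2 * p - t).
have pt : 0 < 2 * p - t by lra.
have [n nP] : exists n, 2 * M * q ^+ n < d.
  apply: geometric_lt => //; apply/andP; split; first by rewrite divr_ge0// ltW.
  by rewrite ltr_pdivrMr// mul1r; lra.
pose g z := f z * ((z - c) ^+ n)^-1.
have gd z : cmod (z - a) < 3 * p - t -> cdiff g z.
  (* At [c] itself the quotient is differentiable because [f], hence [g], vanishes identically
     nearby. *)
  move=> za; have [->|zc] := eqVneq z c.
    apply: (cdiff_near _ (cdiff_cst 0 c)); exists e => // w wc.
    by rewrite /g fz// mul0r.
  apply: cdiffM; first by apply: fd; exact: near_c.
  apply: cdiffV; first by rewrite expf_neq0// subr_eq0.
  by apply: cdiffX; apply: cdiffB (cdiff_id _) (cdiff_cst _ _).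
have := mean_value_le rad gd (M := M / (2 * p - t) ^+ n).
have gM y : seg 0 (pi *+ 2) y ->
    cmod (g (a + (2 * p)%:C * (cos y +i* sin y))) <= M / (2 * p - t) ^+ n.
  move=> yy; rewrite /g cmodM cmodV cmodX ler_pM ?cmod_ge0 ?MP//.
    by rewrite invr_ge0 exprn_ge0 ?cmod_ge0.
  have H : 2 * p - t <= cmod (a + (2 * p)%:C * (cos y +i* sin y) - c).
    set w := a + _; rewrite -(circ y) -/w.
    have -> : w - a = (w - c) - (a - c) by ring.
    by rewrite lerBlDr (le_trans (cmodD _ _))// cmodN.
  rewrite lef_pV2 ?posrE ?exprn_gt0//; last exact: lt_le_trans H.
  by rewrite lerXn2r// ?nnegrE ?cmod_ge0// ltW.
move=> /(_ gM); rewrite /g cmodM cmodV cmodX -/t ler_pdivrMr ?exprn_gt0// => /le_trans; apply.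
rewrite (le_trans _ (ltW nP))// /q expr_div_n.
by rewrite le_eqVlt; apply/orP; left; apply/eqP; ring.
Qed.

(** A chain of discs: the segment is cut into [n] steps shorter than [p]. [identity_local] turns
    vanishing near a point, however small the neighbourhood, into vanishing on the disc of radius
    [p], which contains a neighbourhood of the next point. *)
Lemma identity_segment f a v p : 0 < p ->
  (forall t z, 0 <= t <= 1 -> cmod (z - (a + t%:C * v)) < 3 * p -> cdiff f z) ->
  (exists2 e, 0 < e & forall z, cmod (z - a) < e -> f z = 0) ->
  exists2 e, 0 < e & forall z, cmod (z - (a + v)) < e -> f z = 0.
Proof.
move=> p0 fd fa.
pose n := (Num.truncn (cmod v / p)).+1.
have np : cmod v < n%:R * p.
  by rewrite -ltr_pdivrMr// truncnS_gt.
have n0 : 0 < n%:R :> R by rewrite ltr0n.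
suff H k : (k <= n)%N ->
    exists2 e, 0 < e & forall z, cmod (z - (a + (k%:R / n%:R)%:C * v)) < e -> f z = 0.
  by have := H n (leqnn n); rewrite divff ?gt_eqF// mul1r.
elim: k => [_|k IH kn]; first by rewrite mul0r mul0r addr0.
have [e e0 fz] := IH (ltnW kn).
exists (p - cmod v / n%:R); first by rewrite subr_gt0 ltr_pdivrMr// mulrC.
move=> z zP; apply: (identity_local e0 _ fz (p := p)).
  move=> w; apply: fd; rewrite divr_ge0// ler_pdivrMr// mul1r ler_nat.
  by rewrite (leq_trans _ kn).
have -> : z - (a + (k%:R / n%:R)%:C * v) = (z - (a + (k.+1%:R / n%:R)%:C * v)) + (n%:R^-1)%:C * v.
  rewrite -natr1 mulrDl mul1r rmorphD/=; ring.
rewrite (le_lt_trans (cmodD _ _))// -ltrBrDr.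
by rewrite cmodM cmod_real ger0_norm ?invr_ge0// (mulrC n%:R^-1).
Qed.

End Identity.

(** * Measurability of complex-valued functions *)

Section Cmeas.
Context {R : realType} (d : measure_display) (T : measurableType d) (D : set T).
Implicit Types (u v : T -> R[i]) (f a : T -> R).

Definition cmeas u := measurable_fun D (fun x => complex.Re (u x)) /\
  measurable_fun D (fun x => complex.Im (u x)).

Lemma cmeasM u v : cmeas u -> cmeas v -> cmeas (fun x => u x * v x).
Proof.
move=> [u1 u2] [v1 v2]; split.
  rewrite (_ : (fun x => _) = (fun x => complex.Re (u x) * complex.Re (v x)
    - complex.Im (u x) * complex.Im (v x))); last by apply/funext => x; rewrite ReM.
  by apply: measurable_funB; exact: measurable_funM.
rewrite (_ : (fun x => _) = (fun x => complex.Re (u x) * complex.Im (v x)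
    + complex.Im (u x) * complex.Re (v x))); last by apply/funext => x; rewrite ImM.
by apply: measurable_funD; exact: measurable_funM.
Qed.

Lemma cmeas_real f : measurable_fun D f -> cmeas (fun x => (f x)%:C).
Proof. by move=> mf; split => //; exact: measurable_cst. Qed.

Lemma cmeas_expC (s : R[i]) a : measurable_fun D a -> cmeas (fun x => expC (s * (a x)%:C)).
Proof.
move=> ma; have m1 (k : R) : measurable_fun D (fun x => k * a x).
  by apply: measurable_funM => //; exact: measurable_cst.
have ->: (fun x => expC (s * (a x)%:C)) = (fun x =>
   (expR (complex.Re s * a x) * cos (complex.Im s * a x)) +i*
   (expR (complex.Re s * a x) * sin (complex.Im s * a x))).
  by apply/funext => x; rewrite /expC /cexp ReM ImM/= !mulr0 subr0 add0r.
split; apply: measurable_funM => /=; (apply: measurableT_comp; last exact: m1).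
- exact: measurable_expR. - apply: continuous_measurable_fun; exact: continuous_cos.
- exact: measurable_expR. - apply: continuous_measurable_fun; exact: continuous_sin.
Qed.

End Cmeas.

(** * Integrals depending holomorphically on a parameter *)

Section Parametric.
Context {R : realType} (d : measure_display) (T : measurableType d).
Context (mu : {measure set T -> \bar R}) (D : set T) (mD : measurable D).
Variables (a : T -> R) (phi : T -> R[i]) (al be : R).
Hypothesis ma : measurable_fun D a.
Hypothesis mphi : cmeas D phi.
Hypothesis Iphi : forall t : R, al < t < be ->
  rintegrable mu D (fun x => cmod (phi x) * expR (t * a x)).

(** One shape for all transforms below: [a t = - t] gives Laplace integrals, [a = ln] Mellin
    transforms. *)
Definition param (s : R[i]) : R[i] := cint mu D (fun x => expC (s * (a x)%:C) * phi x).

Lemma param_int s : al < complex.Re s < be ->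
  cintble mu D (fun x => expC (s * (a x)%:C) * phi x).
Proof.
move=> sI; have [m1 m2] := cmeasM (cmeas_expC s ma) mphi.
apply: (cintble_dom _ m1 m2 _ (Iphi sI)) => // x Dx.
by rewrite cmodM cmod_expC ReM/= mulr0 subr0 mulrC.
Qed.

Lemma sqr_le_expR (x : R) : 0 <= x -> x ^+ 2 <= 4 * expR x.
Proof.
move=> x0; have E : expR x = expR (x / 2) ^+ 2 by rewrite -expRM_natr divfK.
have := expR_ge1Dx (x / 2); rewrite E; set y := expR _ => H.
have : x / 2 <= y by lra.
nra.
Qed.

(** According to the sign of [y], the left side is one of the two terms on the right. *)
Lemma expR_norm_le (t k y : R) : 0 <= k -> expR (t * y) * expR (k * `|y|) <= 
  expR ((t + k) * y) + expR ((t - k) * y).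
Proof.
move=> k0; rewrite -expRD; have [y0|y0] := leP 0 y.
  by rewrite ger0_norm// -mulrDl lerDl expR_ge0.
by rewrite ltr0_norm// mulrN -mulNr -mulrDl lerDr expR_ge0.
Qed.

(** Differentiation under the integral by a direct estimate. The second order remainder of
    [expC (h * a)] is at most a constant times [cmod h ^+ 2 * expR (2 * k * |a|)]: one factor
    [expR (k * |a|)] absorbs the square of [a], the other the exponential in [h]. [expR_norm_le]
    then bounds it by the integrable [B]. *)
Lemma param_deriv s : al < complex.Re s < be ->
  cintble mu D (fun x => (a x)%:C * (expC (s * (a x)%:C) * phi x)) /\
  cderiv param s (cint mu D (fun x => (a x)%:C * (expC (s * (a x)%:C) * phi x))).
Proof.
move=> sI; have /andP[s1 s2] := sI; set t := complex.Re s in sI s1 s2.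
(* A quarter of the distance to the edge of the strip: the exponents [t - 2 * k] and [t + 2 * k]
   used in [B] stay inside. *)
have [k [k0 k1 k2]] : exists k : R, [/\ 0 < k, al < t - 2 * k & t + 2 * k < be].
  exists (Num.min ((t - al) / 4) ((be - t) / 4)).
  have A : Num.min ((t - al) / 4) ((be - t) / 4) <= (t - al) / 4 by rewrite ge_min lexx.
  have B : Num.min ((t - al) / 4) ((be - t) / 4) <= (be - t) / 4 by rewrite ge_min lexx orbT.
  by split; [rewrite lt_min !divr_gt0// subr_gt0|lra|lra].
pose B x := cmod (phi x) * expR ((t + 2 * k) * a x) + cmod (phi x) * expR ((t - 2 * k) * a x).
have IB : rintegrable mu D B.
  by apply: rintegrableD => //; apply: Iphi; apply/andP; split; lra.
have eB x : cmod (phi x) * (expR (t * a x) * (expR (k * `|a x|) * expR (k * `|a x|))) <= B x.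
  rewrite /B -mulrDr ler_wpM2l ?cmod_ge0//.
  have -> : expR (k * `|a x|) * expR (k * `|a x|) = expR (2 * k * `|a x|).
    by rewrite -expRD; congr expR; ring.
  by apply: expR_norm_le; rewrite mulr_ge0// ltW.
have ce x : cmod (expC (s * (a x)%:C)) = expR (t * a x).
  by rewrite cmod_expC ReM/= mulr0 subr0.
have E0 x : 1 <= expR (k * `|a x|) by rewrite -expR0 ler_expR mulr_ge0// ltW.
have Id : cintble mu D (fun x => (a x)%:C * (expC (s * (a x)%:C) * phi x)).
  have [m1 m2] := cmeasM (cmeas_real ma) (cmeasM (cmeas_expC s ma) mphi).
  apply: (cintble_dom _ m1 m2 _ (rintegrableZ mD k^-1 IB)) => // x Dx.
  rewrite ler_pdivlMl// (le_trans _ (eB x))// !cmodM ce cmod_real.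
  rewrite [leLHS](_ : _ = cmod (phi x) * (expR (t * a x) * (k * `|a x|))); last by ring.
  rewrite !ler_wpM2l ?cmod_ge0 ?expR_ge0//.
  rewrite -[leLHS]mul1r ler_pM// ?mulr_ge0// ?(ltW k0)//.
  by rewrite (le_trans _ (expR_ge1Dx _))// lerDr.
split=> // e e0.
pose I := \int[mu]_(x in D) B x.
have I0 : 0 <= I.
  by apply: Rintegral_ge0 => x _; rewrite addr_ge0// mulr_ge0 ?cmod_ge0 ?expR_ge0.
(* The 16 is the 8 of the pointwise bound times the 2 of [cint_le]; the [+ 1] makes [K] positive
   even if [I = 0]. *)
pose K := 16 / k ^+ 2 * I + 1.
have K0 : 0 < K by rewrite ltr_wpDl// mulr_ge0// divr_ge0// exprn_ge0// ltW.
have kK : 0 < Num.min k (e / K) by rewrite lt_min k0 divr_gt0.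
have [j [j0 j1 j2]] : exists j : R, [/\ 0 < j, j <= k & j * K <= e].
  by exists (Num.min k (e / K)); rewrite kK -ler_pdivlMr// !ge_min !lexx orbT.
exists j => // h hj.
have hk : cmod h <= k by rewrite (le_trans (ltW hj)).
have shI : al < complex.Re (s + h) < be.
  have := Re_le_cmod h; rewrite ReD ler_norml -/t => /andP[h1 h2].
  by apply/andP; split; lra.
rewrite /param (mulrC _ h) -(cintZ mD h Id) -(cintB mD (param_int shI) (param_int sI)).
rewrite -(cintB mD (cintbleB mD (param_int shI) (param_int sI)) (cintbleZ mD h Id)).
have bound x : D x -> cmod (expC ((s + h) * (a x)%:C) * phi x - expC (s * (a x)%:C) * phi x
    - h * ((a x)%:C * (expC (s * (a x)%:C) * phi x))) <= 8 / k ^+ 2 * cmod h ^+ 2 * B x.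
  move=> Dx; have -> : expC ((s + h) * (a x)%:C) * phi x - expC (s * (a x)%:C) * phi x
    - h * ((a x)%:C * (expC (s * (a x)%:C) * phi x)) =
    expC (s * (a x)%:C) * phi x * (expC (h * (a x)%:C) - 1 - h * (a x)%:C).
    by rewrite mulrDl expCD; ring.
  rewrite cmodM (le_trans (ler_wpM2l (cmod_ge0 _) (expC_taylor2 _)))//.
  rewrite !cmodM ce cmod_real.
  have hx : expR (cmod h * `|a x|) <= expR (k * `|a x|) by rewrite ler_expR ler_wpM2r.
  have ax : `|a x| ^+ 2 <= 4 / k ^+ 2 * expR (k * `|a x|).
    have := @sqr_le_expR (k * `|a x|); rewrite mulr_ge0 ?(ltW k0)// => /(_ isT).
    by rewrite exprMn -ler_pdivlMl ?exprn_gt0// mulrCA mulrA.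
  rewrite exprMn.
  rewrite [leLHS](_ : _ = 2 * cmod h ^+ 2 * (cmod (phi x) * (expR (t * a x) * 
     (`|a x| ^+ 2 * expR (cmod h * `|a x|))))); last by ring.
  rewrite [leRHS](_ : _ = 2 * cmod h ^+ 2 * (4 / k ^+ 2 * B x)); last by ring.
  apply: ler_wpM2l; first by rewrite mulr_ge0// sqr_ge0.
  rewrite (le_trans _ (ler_wpM2l _ (eB x)))//; last by rewrite divr_ge0// sqr_ge0.
  rewrite [leRHS](_ : _ = cmod (phi x) * (expR (t * a x) * (4 / k ^+ 2 * expR (k * `|a x|) * 
    expR (k * `|a x|)))); last by ring.
  apply: ler_wpM2l; first exact: cmod_ge0.
  apply: ler_wpM2l; first exact: expR_ge0.
  by apply: ler_pM; rewrite ?sqr_ge0 ?expR_ge0.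
have If := cintbleB mD (cintbleB mD (param_int shI) (param_int sI)) (cintbleZ mD h Id).
apply: le_trans (cint_le mD If bound (rintegrableZ mD _ IB)) _.
rewrite RintegralZl// -/I.
have -> : 2 * (8 / k ^+ 2 * cmod h ^+ 2 * I) = cmod h * (16 / k ^+ 2 * I) * cmod h by ring.
apply: ler_wpM2r; first exact: cmod_ge0.
apply: le_trans j2; apply: ler_pM; [exact: cmod_ge0| |exact: ltW|by rewrite /K lerDl].
by rewrite mulr_ge0// divr_ge0// sqr_ge0.
Qed.

Lemma param_cdiff s : al < complex.Re s < be -> cdiff param s.
Proof. by move=> /param_deriv[_ ?]; eexists; eassumption. Qed.

End Parametric.

(** * Complex sequences and limit theorems for integrals *)

Section Ccvg.
Context {R : realType}.
Implicit Types (u v : nat -> R[i]) (l m c : R[i]).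

Definition ccvg u l := (fun n => complex.Re (u n)) @ \oo --> complex.Re l /\
  (fun n => complex.Im (u n)) @ \oo --> complex.Im l.

Lemma ccvg_unique u l m : ccvg u l -> ccvg u m -> l = m.
Proof.
move=> [l1 l2] [m1 m2]; apply: complex_ext.
  exact: (cvg_unique _ l1 m1).
exact: (cvg_unique _ l2 m2).
Qed.

Lemma ccvg_eq u v l : (forall n, u n = v n) -> ccvg u l -> ccvg v l.
Proof. by move=> /funext ->. Qed.

Lemma ccvg_cst c : ccvg (fun=> c) c.
Proof. by split; exact: cvg_cst. Qed.

Lemma ccvgD u v l m : ccvg u l -> ccvg v m -> ccvg (fun n => u n + v n) (l + m).
Proof.
move=> [u1 u2] [v1 v2]; split; rewrite ?ReD ?ImD.
  by under eq_fun do rewrite ReD; exact: cvgD.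
by under eq_fun do rewrite ImD; exact: cvgD.
Qed.

Lemma ccvgM u v l m : ccvg u l -> ccvg v m -> ccvg (fun n => u n * v n) (l * m).
Proof.
move=> [u1 u2] [v1 v2]; split; rewrite ?ReM ?ImM.
  by under eq_fun do rewrite ReM; apply: cvgB; exact: cvgM.
by under eq_fun do rewrite ImM; apply: cvgD; exact: cvgM.
Qed.

End Ccvg.

Section DCT.
Context {R : realType} (d : measure_display) (T : measurableType d).
Context (mu : {measure set T -> \bar R}) (D : set T) (mD : measurable D).

Lemma rint_dct (f_ : nat -> T -> R) (f g : T -> R) :
  (forall n, measurable_fun D (f_ n)) -> (forall x, D x -> f_^~ x @ \oo --> f x) ->
  rintegrable mu D g -> (forall n x, D x -> `|f_ n x| <= g x) ->
  rintegrable mu D f /\ (fun n => \int[mu]_(x in D) f_ n x) @ \oo --> \int[mu]_(x in D) f x.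
Proof.
move=> mf_ ff Ig fg.
have mf : measurable_fun D f by exact: (measurable_fun_cvg mf_ ff).
have ae1 : {ae mu, forall x, D x -> (fun n => (f_ n x)%:E) @ \oo --> (f x)%:E}.
  by apply: aeW => x Dx; apply: cvg_EFin; [exact: nearW|exact: ff].
have ae2 : {ae mu, forall x n, D x -> (`|(f_ n x)%:E| <= (g x)%:E)%E}.
  by apply: aeW => x n Dx /=; rewrite lee_fin fg.
have emf_ n : measurable_fun D (fun x => (f_ n x)%:E) by exact/measurable_EFinP.
have emf : measurable_fun D (fun x => (f x)%:E) by exact/measurable_EFinP.
have [If _ cv] := dominated_convergence mD emf_ emf ae1 Ig ae2.
split=> //; apply: fine_cvg; rewrite fineK; last exact: integrable_fin_num If.
exact: cv.
Qed.

Lemma cint_dct (u_ : nat -> T -> R[i]) (u : T -> R[i]) (g : T -> R) :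
  (forall n, cmeas D (u_ n)) -> (forall x, D x -> ccvg (u_^~ x) (u x)) ->
  rintegrable mu D g -> (forall n x, D x -> cmod (u_ n x) <= g x) ->
  cintble mu D u /\ ccvg (fun n => cint mu D (u_ n)) (cint mu D u).
Proof.
move=> mu_ uu Ig ug.
have [I1 c1] := rint_dct (fun n => (mu_ n).1) (fun x Dx => (uu x Dx).1) Ig
  (fun n x Dx => le_trans (Re_le_cmod _) (ug n x Dx)).
have [I2 c2] := rint_dct (fun n => (mu_ n).2) (fun x Dx => (uu x Dx).2) Ig
  (fun n x Dx => le_trans (Im_le_cmod _) (ug n x Dx)).
by split; split.
Qed.

(** Dominated convergence for [f] cut off to [Dn n], with [|f|] as the dominating function. *)
Lemma rint_exhaust (Dn : nat -> set T) (f : T -> R) : (forall n, measurable (Dn n)) ->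
  (forall n, Dn n `<=` D) -> (forall x, D x -> exists N, forall n, (N <= n)%N -> Dn n x) ->
  rintegrable mu D f -> (fun n => \int[mu]_(x in Dn n) f x) @ \oo --> \int[mu]_(x in D) f x.
Proof.
move=> mDn sDn eDn If.
have E n : \int[mu]_(x in Dn n) f x = \int[mu]_(x in D) (f \_ (Dn n)) x.
  by rewrite -Rintegral_mkcondr setIidr.
under eq_fun do rewrite E.
have mf := rintegrable_mfun If.
have [] // := @rint_dct (fun n => f \_ (Dn n)) f (fun x => `|f x|).
- by move=> n; apply/measurable_restrict => //; rewrite setIidr//; exact: measurable_funS mf.
- move=> x Dx; have [N NP] := eDn x Dx; apply: cvg_near_cst.
  by exists N => // n /= /NP xn; rewrite patchE mem_set.
- exact: rintegrable_norm.
- by move=> n x Dx; rewrite patchE; case: ifP; rewrite ?normr0.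
Qed.

Lemma cint_exhaust (Dn : nat -> set T) (u : T -> R[i]) : (forall n, measurable (Dn n)) ->
  (forall n, Dn n `<=` D) -> (forall x, D x -> exists N, forall n, (N <= n)%N -> Dn n x) ->
  cintble mu D u -> ccvg (fun n => cint mu (Dn n) u) (cint mu D u).
Proof. by move=> m s e [U1 U2]; split; exact: rint_exhaust. Qed.

(** Monotone convergence; this turns bounds on integrals over segments, where primitives are
    available, into integrability on a half-line. *)
Lemma rint_ge0_exhaust (Dn : nat -> set T) (f : T -> R) (C : R) : (forall n, measurable (Dn n)) ->
  nondecreasing_seq Dn -> D = \bigcup_n Dn n -> measurable_fun D f ->
  (forall x, D x -> 0 <= f x) -> (forall n, rintegrable mu (Dn n) f) ->
  (forall n, \int[mu]_(x in Dn n) f x <= C) -> rintegrable mu D f.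
Proof.
move=> mDn nDn DE mf f0 If fC; apply/integrableP; split; first exact/measurable_EFinP.
have sD n : Dn n `<=` D by rewrite DE; exact: bigcup_sup.
have -> : (\int[mu]_(x in D) `|(EFin \o f) x|)%E = (\int[mu]_(x in D) (f x)%:E)%E.
  by apply: eq_integral => x; rewrite inE => Dx /=; rewrite ger0_norm// f0.
have cv : (\int[mu]_(x in Dn i) (f x)%:E @[i --> \oo] --> \int[mu]_(x in D) (f x)%:E)%E.
  rewrite DE; apply: ge0_nondecreasing_set_cvg_integral => //.
    by move=> i; apply/measurable_EFinP; exact: measurable_funS mf.
  by move=> i x Dx; rewrite lee_fin f0//; exact: sD Dx.
apply: (@le_lt_trans _ _ C%:E); last by rewrite ltry.
rewrite -(cvg_lim _ cv)//; apply: lime_le; first by apply/cvg_ex; eexists; exact: cv.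
apply: nearW => n; have := fC n; rewrite -lee_fin /Rintegral fineK//.
exact: integrable_fin_num (If n).
Qed.

End DCT.

(** * Integrals over the positive half-line *)

Section HalfLine.
Context {R : realType}.
Notation leb := (@lebesgue_measure R).

Definition posR : set (measurableTypeR R) := `]0, +oo[%classic.

Lemma mposR : measurable posR. Proof. exact: measurable_itv. Qed.

Lemma posRP (x : R) : posR x = (0 < x) :> Prop.
Proof. by rewrite /posR/= in_itv/= andbT. Qed.

Lemma measurable_posR (f : R -> R) : (forall x, 0 < x -> {for x, continuous f}) ->
  measurable_fun posR f.
Proof.
move=> fc; apply: open_continuous_measurable_fun; first exact: interval_open.
move=> x; rewrite inE => xp; apply: fc; move: xp; by rewrite posRP.
Qed.

(** Segments invariant under [t -> 1 / t], so that they can be folded at 1 when theta's functional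
    equation is used. *)
Definition exh (n : nat) : set (measurableTypeR R) := seg (n.+1%:R^-1) (n.+1%:R).

Lemma exh_le n : (n.+1%:R : R)^-1 <= n.+1%:R.
Proof. by rewrite (@le_trans _ _ 1)// ?invf_le1// ?ler1n. Qed.

Lemma exh_sub n : exh n `<=` posR.
Proof.
move=> x; rewrite posRP /exh /seg/= in_itv/= => /andP[nx _].
by rewrite (lt_le_trans _ nx).
Qed.

Lemma exh_mem (x : R) : posR x -> exists N, forall n, (N <= n)%N -> exh n x.
Proof.
rewrite posRP => x0; pose N := maxn (Num.truncn x).+1 (Num.truncn x^-1).+1.
exists N => n Nn; rewrite /exh /seg/= in_itv/=; apply/andP; split.
  rewrite invf_ple ?posrE// (le_trans (ltW (truncnS_gt _)))// ler_nat.
  by rewrite (leq_trans (leq_maxr _ _) (leq_trans Nn _)).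
rewrite (le_trans (ltW (truncnS_gt _)))// ler_nat.
by rewrite (leq_trans (leq_maxl _ _) (leq_trans Nn _)).
Qed.

Lemma rintegrable_FTC (f F : R -> R) (C : R) :
  (forall x : R, 0 < x -> {for x, continuous f}) -> (forall x : R, 0 < x -> 0 <= f x) ->
  (forall x : R, 0 < x -> is_derive x 1 F (f x)) -> (forall x : R, 0 < x -> `|F x| <= C) ->
  rintegrable leb posR f.
Proof.
move=> fc f0 dF FC; apply: (rint_ge0_exhaust mposR (Dn := exh) (C := C + C)).
- by move=> n; exact: mseg.
- move=> m n mn; apply/subsetPset => x; rewrite /exh /seg/= !in_itv/= => /andP[mx xm].
  rewrite (le_trans _ mx) ?(le_trans xm) ?ler_nat//.
  by rewrite lef_pV2 ?posrE// ler_nat.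
- apply/seteqP; split=> [x /exh_mem[N NP]|x [n _]]; first by exists N => //; exact: NP.
  exact: exh_sub.
- exact: measurable_posR.
- by move=> x; rewrite posRP; exact: f0.
- by move=> n; apply: rintegrable_seg => x /exh_sub; rewrite posRP; exact: fc.
- move=> n.
  have fcn (x : R) : seg (n.+1%:R^-1) (n.+1%:R) x -> {for x, continuous f}.
    by move=> /(@exh_sub n); rewrite posRP; exact: fc.
  have dFn (x : R) : seg (n.+1%:R^-1) (n.+1%:R) x -> is_derive x 1 F (f x).
    by move=> /(@exh_sub n); rewrite posRP; exact: dF.
  rewrite /exh (rint_FTC (exh_le n) fcn dFn).
  have p1 : 0 < (n.+1%:R : R) by [].
  have p2 : 0 < (n.+1%:R : R)^-1 by rewrite invr_gt0.
  by rewrite (le_trans (ler_norm _))// (le_trans (ler_normB _ _))// lerD ?FC.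
Qed.

End HalfLine.

(** * Change of variables *)

Section Substitution.
Context {R : realType}.
Notation leb := (@lebesgue_measure R).

Lemma primitive_gt (k : R -> R) (lo a b : R) : lo < a -> a <= b ->
  (forall x : R, lo < x -> {for x, continuous k}) ->
  exists K : R -> R, forall x : R, a <= x <= b -> is_derive x 1 K (k x).
Proof.
move=> a0 ab kc.
(* The lower limit lies strictly between [lo] and [a], and integrability is taken up to [b + 1], so
   that the derivatives at [a] and [b] are two-sided. *)
exists (fun x => \int[leb]_(t in seg ((a + lo) / 2) x) k t) => x /andP[ax xb].
have a2 : (a + lo) / 2 < x by lra.
have Ik : rintegrable leb (seg ((a + lo) / 2) (b + 1)) k.
  by apply: rintegrable_seg => y; rewrite /seg/= in_itv/= => /andP[y1 _]; apply: kc; lra.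
have xb1 : x < b + 1 by lra.
have [|d1 d2] := @continuous_FTC1_closed R k ((a + lo) / 2) x (b + 1) xb1 Ik a2.
  by apply: kc; rewrite (lt_le_trans a0).
by apply: DeriveDef; [exact: d1|rewrite -derive1E].
Qed.

Lemma continuous_rder_comp (k G : R -> R) (g : R) (x : R) : is_derive x 1 G g ->
  {for G x, continuous k} -> {for x, continuous (fun t => k (G t))}.
Proof. by move=> /rder_continuous Gc kc; exact: continuous_comp Gc kc. Qed.

(** With a primitive [K] of [k], both sides equal [K (G b) - K (G a)]. *)
Lemma subst_inc (k G g : R -> R) (lo a b : R) : a <= b -> (forall x : R, lo < x -> {for x, continuous k}) ->
  (forall x, seg a b x -> is_derive x 1 G (g x)) -> (forall x, seg a b x -> {for x, continuous g}) ->
  lo < G a -> G a <= G b -> (forall x, seg a b x -> G a <= G x <= G b) ->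
  \int[leb]_(t in seg (G a) (G b)) k t = \int[leb]_(u in seg a b) (k (G u) * g u).
Proof.
move=> ab kc dG gc Ga Gab Gx.
have [K dK] := primitive_gt Ga Gab kc.
have kc' (x : R) : seg (G a) (G b) x -> {for x, continuous k}.
  by rewrite /seg/= in_itv/= => /andP[x1 _]; apply: kc; exact: lt_le_trans x1.
have dK' (x : R) : seg (G a) (G b) x -> is_derive x 1 K (k x).
  by rewrite /seg/= in_itv/=; exact: dK.
rewrite (rint_FTC Gab kc' dK').
have c' (x : R) : seg a b x -> {for x, continuous (fun u => k (G u) * g u)}.
  move=> xab; apply: continuousM; last exact: gc.
  apply: continuous_rder_comp (dG x xab) _; apply: kc.
  by have /andP[+ _] := Gx x xab; exact: lt_le_trans.
have d' (x : R) : seg a b x -> is_derive x 1 (fun u => K (G u)) (k (G x) * g x).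
  by move=> xab; exact: (rder_comp (dK _ (Gx x xab)) (dG x xab)).
by rewrite (rint_FTC ab c' d').
Qed.

Lemma subst_dec (k G g : R -> R) (lo a b : R) : a <= b -> (forall x : R, lo < x -> {for x, continuous k}) ->
  (forall x, seg a b x -> is_derive x 1 G (- g x)) -> (forall x, seg a b x -> {for x, continuous g}) ->
  lo < G b -> G b <= G a -> (forall x, seg a b x -> G b <= G x <= G a) ->
  \int[leb]_(t in seg (G b) (G a)) k t = \int[leb]_(u in seg a b) (k (G u) * g u).
Proof.
move=> ab kc dG gc Ga Gab Gx.
have [K dK] := primitive_gt Ga Gab kc.
have kc' (x : R) : seg (G b) (G a) x -> {for x, continuous k}.
  by rewrite /seg/= in_itv/= => /andP[x1 _]; apply: kc; exact: lt_le_trans x1.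
have dK' (x : R) : seg (G b) (G a) x -> is_derive x 1 K (k x).
  by rewrite /seg/= in_itv/=; exact: dK.
rewrite (rint_FTC Gab kc' dK').
have c' (x : R) : seg a b x -> {for x, continuous (fun u => k (G u) * g u)}.
  move=> xab; apply: continuousM; last exact: gc.
  apply: continuous_rder_comp (dG x xab) _; apply: kc.
  by have /andP[+ _] := Gx x xab; exact: lt_le_trans.
have d' (x : R) : seg a b x -> is_derive x 1 (fun u => - K (G u)) (k (G x) * g x).
  move=> xab; apply: (rderE (rderN (rder_comp (dK _ (Gx x xab)) (dG x xab)))).
  by rewrite mulrN opprK.
by rewrite (rint_FTC ab c' d') opprK addrC.
Qed.

Lemma cint_ext2 (d1 d2 : measure_display) (T1 : measurableType d1) (T2 : measurableType d2)
  (m1 : {measure set T1 -> \bar R}) (m2 : {measure set T2 -> \bar R})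
  (D1 : set T1) (D2 : set T2) (u : T1 -> R[i]) (v : T2 -> R[i]) :
  \int[m1]_(x in D1) complex.Re (u x) = \int[m2]_(x in D2) complex.Re (v x) ->
  \int[m1]_(x in D1) complex.Im (u x) = \int[m2]_(x in D2) complex.Im (v x) ->
  cint m1 D1 u = cint m2 D2 v.
Proof. by rewrite /cint /cintegral => -> ->. Qed.

Lemma cint_scale (u : R -> R[i]) (c a b : R) : 0 < c -> 0 < a -> a <= b ->
  (forall x : R, 0 < x -> ccontR u x) ->
  cint leb (seg (c * a) (c * b)) u = cint leb (seg a b) (fun x => c%:C * u (c * x)).
Proof.
move=> c0 a0 ab uc.
have dG (x : R) : seg a b x -> is_derive x 1 (fun t => c * t) c.
  by move=> _; apply: (rderE (rderZ c (rder_id x))); rewrite mulr1.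
have cc (x : R) : seg a b x -> {for x, continuous (fun=> c)}.
  by move=> _; exact: cst_continuous.
have Gx (x : R) : seg a b x -> c * a <= c * x <= c * b.
  by rewrite /seg/= in_itv/= !ler_pM2l.
have ca : 0 < c * a by rewrite mulr_gt0.
have cab : c * a <= c * b by rewrite ler_pM2l.
apply: cint_ext2.
  rewrite (subst_inc ab (fun x x0 => ccontR_Re (uc x x0)) dG cc ca cab Gx).
  by apply: eq_Rintegral => x _; rewrite ReM/= mul0r subr0 mulrC.
rewrite (subst_inc ab (fun x x0 => ccontR_Im (uc x x0)) dG cc ca cab Gx).
by apply: eq_Rintegral => x _; rewrite ImM/= mul0r addr0 mulrC.
Qed.

Lemma cint_invert (u : R -> R[i]) (a b : R) : 0 < a -> a <= b ->
  (forall x : R, 0 < x -> ccontR u x) ->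
  cint leb (seg b^-1 a^-1) u = cint leb (seg a b) (fun x => ((x ^+ 2)^-1)%:C * u x^-1).
Proof.
move=> a0 ab uc.
have b0 : 0 < b by rewrite (lt_le_trans a0).
have x0 (x : R) : seg a b x -> 0 < x.
  by rewrite /seg/= in_itv/= => /andP[+ _]; exact: lt_le_trans.
have dG (x : R) : seg a b x -> is_derive x 1 (fun t => t^-1) (- (x ^+ 2)^-1).
  by move=> /x0 xp; apply: (rderE (is_deriveV _ (is_derive_id x 1)));
    rewrite ?gt_eqF// scaler1.
have cc (x : R) : seg a b x -> {for x, continuous (fun y : R => (y ^+ 2)^-1)}.
  move=> /x0 xp; apply: continuousV; first by rewrite expf_neq0// gt_eqF.
  exact: exprn_continuous.
have Gx (x : R) : seg a b x -> b^-1 <= x^-1 <= a^-1.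
  move=> xs; have xp := x0 x xs; move: xs; rewrite /seg/= in_itv/= => /andP[ax xb].
  by rewrite !lef_pV2 ?posrE// xb.
have ca : 0 < b^-1 by rewrite invr_gt0.
have cab : b^-1 <= a^-1 by rewrite lef_pV2 ?posrE.
apply: cint_ext2.
  rewrite (subst_dec ab (fun x x0 => ccontR_Re (uc x x0)) dG cc ca cab Gx).
  by apply: eq_Rintegral => x _; rewrite ReM/= mul0r subr0 mulrC.
rewrite (subst_dec ab (fun x x0 => ccontR_Im (uc x x0)) dG cc ca cab Gx).
by apply: eq_Rintegral => x _; rewrite ImM/= mul0r addr0 mulrC.
Qed.

End Substitution.

(** * Real and complex powers of a positive variable *)

Section Powers.
Context {R : realType}.
Notation leb := (@lebesgue_measure R).
Implicit Types (w s z : R[i]) (x t c : R).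

Definition pw w t : R[i] := expC (w * (ln t)%:C).
Definition rp (a t : R) : R := expR (a * ln t).

Lemma cmod_pw w t : cmod (pw w t) = rp (complex.Re w) t.
Proof. by rewrite /pw cmod_expC ReM/= mulr0 subr0. Qed.

Lemma rp_gt0 (a t : R) : 0 < rp a t. Proof. exact: expR_gt0. Qed.

Lemma rpD (a b t : R) : rp (a + b) t = rp a t * rp b t.
Proof. by rewrite /rp mulrDl expRD. Qed.

Lemma rp1 t : 0 < t -> rp 1 t = t.
Proof. by move=> t0; rewrite /rp mul1r lnK. Qed.

Lemma pwD w z t : pw (w + z) t = pw w t * pw z t.
Proof. by rewrite /pw mulrDl expCD. Qed.

Lemma pw1 t : 0 < t -> pw 1 t = t%:C.
Proof. by move=> t0; rewrite /pw mul1r expC_real lnK. Qed.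

Lemma pw_sub1 w t : 0 < t -> pw w t = t%:C * pw (w - 1) t.
Proof. by move=> t0; rewrite -(pw1 t0) -pwD addrC subrK. Qed.

Lemma pw_real (a t : R) : pw a%:C t = (rp a t)%:C.
Proof. by rewrite /pw -rmorphM expC_real. Qed.

Lemma pwM w x t : 0 < x -> 0 < t -> pw w (x * t) = pw w x * pw w t.
Proof. by move=> x0 t0; rewrite /pw lnM// rmorphD/= mulrDr expCD. Qed.

Lemma pwV w t : 0 < t -> pw w t^-1 = pw (- w) t.
Proof. by move=> t0; rewrite /pw lnV// rmorphN/= mulrN mulNr. Qed.

Lemma pw_neq0 w t : pw w t != 0.
Proof. exact: expC_neq0. Qed.

Lemma pwN w t : pw (- w) t = (pw w t)^-1.
Proof. by rewrite /pw mulNr expCN. Qed.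

Lemma rder_rp a t : 0 < t -> is_derive t 1 (rp a) (a * rp (a - 1) t).
Proof.
move=> t0; apply: (rderE (rder_exp (rderZ a (rder_ln t0 (rder_id t))))).
by rewrite mulr1 /rp mulrBl mul1r expRD expRN lnK//; ring.
Qed.

Lemma rp_continuous a t : 0 < t -> {for t, continuous (rp a)}.
Proof. by move=> /(rder_rp a) /rder_continuous. Qed.

Lemma ccontR_ReIm (u : R -> R[i]) x : {for x, continuous (fun t => complex.Re (u t))} ->
  {for x, continuous (fun t => complex.Im (u t))} -> ccontR u x.
Proof.
move=> /cvgrPdist_lt c1 /cvgrPdist_lt c2 e e0.
have e2 : 0 < e / 2 by rewrite divr_gt0.
have /nbhs_ballP[r1 r10 H1] := c1 _ e2; have /nbhs_ballP[r2 r20 H2] := c2 _ e2.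
exists (Num.min r1 r2); first by rewrite lt_min; apply/andP.
move=> y; rewrite lt_min => /andP[y1 y2].
rewrite (le_lt_trans (cmod_le_ReIm _))// (splitr e) ltrD//.
  by rewrite ReD ReN distrC; apply: H1; rewrite /ball/= distrC.
by rewrite ImD ImN distrC; apply: H2; rewrite /ball/= distrC.
Qed.

Lemma ccontRM (u v : R -> R[i]) x : ccontR u x -> ccontR v x -> ccontR (fun t => u t * v t) x.
Proof.
move=> uc vc; have u1 := ccontR_Re uc; have u2 := ccontR_Im uc.
have v1 := ccontR_Re vc; have v2 := ccontR_Im vc; apply: ccontR_ReIm.
  rewrite (_ : (fun t => _) = (fun t => complex.Re (u t) * complex.Re (v t)
    - complex.Im (u t) * complex.Im (v t))); last by apply/funext => t; rewrite ReM.
  by apply: continuousB; exact: continuousM.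
rewrite (_ : (fun t => _) = (fun t => complex.Re (u t) * complex.Im (v t)
    + complex.Im (u t) * complex.Re (v t))); last by apply/funext => t; rewrite ImM.
by apply: continuousD; exact: continuousM.
Qed.

Lemma ccontR_real (f : R -> R) x : {for x, continuous f} -> ccontR (fun t => (f t)%:C) x.
Proof. by move=> fc; apply: ccontR_ReIm => //=; exact: cst_continuous. Qed.

Lemma ccontR_expC w (f : R -> R) x : {for x, continuous f} -> ccontR (fun t => expC (w * (f t)%:C)) x.
Proof.
move=> /cvgrPdist_lt fc e e0.
have : cdiff (fun z => expC (w * z)) (f x)%:C.
  by apply: cdiff_expC; apply: cdiffM (cdiff_cst _ _) (cdiff_id _).
move=> /cdiff_cont /(_ e e0)[r r0 H]; have /nbhs_ballP[q q0 K] := fc _ r0.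
exists q => // y yx; have := H (f y - f x)%:C.
have -> : (f x)%:C + (f y - f x)%:C = (f y)%:C by apply: complex_ext => /=; ring.
rewrite cmod_real; apply.
by rewrite distrC; apply: K; rewrite /ball/= distrC.
Qed.

Lemma ccontR_pw w t : 0 < t -> ccontR (pw w) t.
Proof. by move=> t0; apply: ccontR_expC; exact: continuous_ln. Qed.

Lemma measurable_lnpos : measurable_fun (@posR R) (@ln R).
Proof. by apply: measurable_posR => x; exact: continuous_ln. Qed.

(** Comparison with [f], the derivative of the bounded function [F t = - (1 + t^a)^-1]: this handles
    0 and infinity at once. What is needed is [(1 + t^a)^2 <= (1 + K)^2 e^(ct)]. *)
Lemma gamma_integrable (a c : R) : 0 < a -> 0 < c ->
  rintegrable leb posR (fun t => rp (a - 1) t * expR (- (c * t))).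
Proof.
move=> a0 c0.
pose f t := a * rp (a - 1) t * (1 + rp a t) ^- 2.
pose F t := - (1 + rp a t)^-1.
have p1 t : 0 < 1 + rp a t by rewrite ltr_wpDl// rp_gt0.
have If : rintegrable leb posR f.
  apply: (@rintegrable_FTC _ f F 1) => t t0.
  - apply: continuousM.
      by apply: continuousM; [exact: cst_continuous|exact: rp_continuous].
    apply: continuousV; first by rewrite expf_neq0// gt_eqF.
    apply: (@continuous_comp _ _ _ (fun t => 1 + rp a t) (fun y => y ^+ 2)).
      by apply: continuousD; [exact: cst_continuous|exact: rp_continuous].
    exact: exprn_continuous.
  - by rewrite mulr_ge0 ?mulr_ge0 ?(ltW a0) ?(ltW (rp_gt0 _ _))// invr_ge0 exprn_ge0// ltW.
  - have := rderN (is_deriveV _ (rderD (rder_cst 1 t) (rder_rp a t0))).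
    move=> /(_ (lt0r_neq0 (p1 t))) /rderE; apply.
    by rewrite /f add0r scaleNr opprK /GRing.scale/= mulrC.
  - rewrite normrN normfV ger0_norm ?(ltW (p1 t))// invf_le1//.
    by rewrite lerDl ltW// rp_gt0.
(* From [ln y <= y] at [y = c * t / (2 * a)], multiplied by [a]: [t^a <= (2a/c)^a e^(ct/2)]. *)
pose K := expR (a * ln (2 * a / c)).
have K0 : 0 < K by exact: expR_gt0.
have ca : 0 < 2 * a / c by rewrite divr_gt0// mulr_gt0.
have bnd t : 0 < t -> rp a t <= K * expR (c * t / 2).
  move=> t0; rewrite /rp /K -expRD ler_expR.
  have y0 : 0 < c * t / (2 * a) by rewrite divr_gt0 ?mulr_gt0.
  have tE : t = (2 * a / c) * (c * t / (2 * a)) by field; rewrite !gt_eqF.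
  rewrite {1}tE lnM ?posrE// mulrDr lerD2l.
  have := ltW (ln_sublinear y0) => H.
  rewrite (le_trans (ler_wpM2l (ltW a0) H))// le_eqVlt; apply/orP; left; apply/eqP.
  by field; rewrite gt_eqF.
apply: (rintegrable_dom mposR _ _ (rintegrableZ mposR ((1 + K) ^+ 2 / a) If)).
  apply: measurable_posR => t t0; apply: continuousM; first exact: rp_continuous.
  exact: rder_continuous (rder_exp (rderN (rderZ c (rder_id t)))).
move=> t; rewrite posRP => t0.
rewrite ger0_norm ?mulr_ge0 ?expR_ge0 ?(ltW (rp_gt0 _ _))//.
have -> : (1 + K) ^+ 2 / a * f t = rp (a - 1) t * ((1 + K) ^+ 2 / (1 + rp a t) ^+ 2).
  by rewrite /f; field; rewrite (gt_eqF (p1 t)) gt_eqF.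
rewrite ler_wpM2l ?(ltW (rp_gt0 _ _))// ler_pdivlMr ?exprn_gt0// expRN ler_pdivrMl ?expR_gt0//.
have E : expR (c * t) = expR (c * t / 2) ^+ 2 by rewrite -expRM_natr divfK.
rewrite E mulrC -exprMn lerXn2r// ?nnegrE; [exact: ltW|by rewrite mulr_ge0 ?expR_ge0// addr_ge0// ltW|].
rewrite mulrDl mul1r lerD ?bnd//.
by rewrite -expR0 ler_expR divr_ge0 ?mulr_ge0// ltW.
Qed.

Lemma rp_expR_integrable (a c : R) : -1 < a -> 0 < c ->
  rintegrable leb posR (fun t => rp a t * expR (- (c * t))).
Proof.
move=> a0 c0; have a1 : 0 < a + 1 by lra.
by apply: (rintegrable_eq mposR _ (gamma_integrable a1 c0)) => t _; rewrite addrK.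
Qed.

End Powers.

(** * Euler's integral *)

Section GammaInt.
Context {R : realType}.
Notation leb := (@lebesgue_measure R).
Implicit Types (w s z : R[i]) (x t c : R).

Definition gammaI w : R[i] := Gamma_integral w.

(* [int_0^oo t ^ (w - 1) e ^ (- z t) dt] *)
Definition gammaL w z : R[i] := param leb posR (fun t => - t) (fun t => pw (w - 1) t) z.

Lemma cmeas_pw w : cmeas (@posR R) (pw w).
Proof. by apply: cmeas_expC; exact: measurable_lnpos. Qed.

Lemma mopp : measurable_fun (@posR R) (fun t : R => - t).
Proof. by apply: measurable_posR => x _; exact: oppr_continuous. Qed.

Lemma gammaL_dom w : 0 < complex.Re w -> forall t, 0 < t < t + 1 ->
  rintegrable leb posR (fun x => cmod (pw (w - 1) x) * expR (t * - x)).
Proof.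
move=> w0 t /andP[t0 _]; apply: (rintegrable_eq mposR _ (gamma_integrable w0 t0)) => x _.
by rewrite cmod_pw ReD ReN/= mulrN.
Qed.

Lemma gammaIE w : gammaI w = gammaL w 1.
Proof.
apply: (@cint_eq _ _ _ leb posR) => t; rewrite posRP => t0.
rewrite /rcpow -/(expC _) -/(pw _ _) mulrC; congr (_ * _).
by rewrite mul1r expC_real.
Qed.

Lemma gammaL_pos w c : 0 < complex.Re w -> 0 < c ->
  cintble leb posR (fun t => expC (c%:C * (- t)%:C) * pw (w - 1) t) /\
  cdiff (gammaL w) c%:C /\
  cderiv (gammaL w) c%:C (cint leb posR (fun t => (- t)%:C * (expC (c%:C * (- t)%:C) * pw (w - 1) t))).
Proof.
move=> w0 c0.
have H : forall t, 0 < t < c + 1 -> rintegrable leb posR (fun x => cmod (pw (w - 1) x) * expR (t * - x)).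
  by move=> t /andP[t0 _]; apply: gammaL_dom => //; rewrite t0 ltrDl ltr01.
have cI : 0 < complex.Re (c%:C) < c + 1 by rewrite /= c0 ltrDl ltr01.
split; first exact: (param_int mposR mopp (cmeas_pw _) H cI).
split; first exact: (param_cdiff mposR mopp (cmeas_pw _) H cI).
by have [] := param_deriv mposR mopp (cmeas_pw (w - 1)) H cI.
Qed.

(** Substitution [t -> c t] on the segments [exh n], whose images exhaust the half-line as well. *)
Lemma gammaL_scale w c : 0 < complex.Re w -> 0 < c -> gammaI w = pw w c * gammaL w c%:C.
Proof.
move=> w0 c0.
pose u (a t : R) := expC (a%:C * (- t)%:C) * pw (w - 1) t.
have uc (a t : R) : 0 < t -> ccontR (u a) t.
  by move=> t0; apply: ccontRM; [apply: ccontR_expC; exact: oppr_continuous|exact: ccontR_pw].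
have I1 : cintble leb posR (u 1) by have [] := gammaL_pos w0 ltr01.
have Ic : cintble leb posR (u c) by have [] := gammaL_pos w0 c0.
have S1 : ccvg (fun n => cint leb (exh n) (u c)) (gammaL w c%:C).
  exact: (cint_exhaust mposR (fun n => mseg _ _) (@exh_sub R) (@exh_mem R) Ic).
pose Dn n : set (measurableTypeR R) := seg (c * n.+1%:R^-1) (c * n.+1%:R).
have S2 : ccvg (fun n => cint leb (Dn n) (u 1)) (gammaI w).
  rewrite gammaIE; apply: (cint_exhaust mposR (fun n => mseg _ _) _ _ I1) => [n x|x].
    rewrite posRP /Dn /seg/= in_itv/= => /andP[+ _]; apply: lt_le_trans.
    by rewrite mulr_gt0// invr_gt0.
  rewrite posRP => x0; have xc : posR (x / c) by rewrite posRP divr_gt0.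
  have [N NP] := exh_mem xc; exists N => n /NP; rewrite /exh /Dn /seg/= !in_itv/=.
  by rewrite ler_pdivlMr// ler_pdivrMr// ![_ * c]mulrC.
apply: (ccvg_unique S2).
apply: ccvg_eq (ccvgM (ccvg_cst (pw w c)) S1) => n.
have n0 : 0 < (n.+1%:R : R)^-1 by rewrite invr_gt0.
rewrite /Dn (cint_scale c0 n0 (exh_le n) (uc 1)).
have Ien : cintble leb (exh n) (u c).
  by apply: cintble_seg => x /exh_sub; rewrite posRP; exact: uc.
rewrite -(cintZ (mseg _ _) _ Ien); apply: cint_eq => t /exh_sub; rewrite posRP => t0.
rewrite /u pwM//.
rewrite (pw_sub1 w c0).
have -> : (1 : R)%:C * (- (c * t))%:C = c%:C * (- t)%:C by rewrite mul1r -rmorphM/= mulrN.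
by ring.
Qed.

(** Real increments already determine a complex derivative; this compares functions whose equality
    is known on the real line only. *)
Lemma cderiv_real_unique (P Q : R[i] -> R[i]) (d1 d2 : R[i]) :
  cderiv P 0 d1 -> cderiv Q 0 d2 -> (forall x : R, P x%:C = Q x%:C) -> d1 = d2.
Proof.
move=> Pd Qd PQ; apply/eqP; rewrite -subr_eq0 -cmod_eq0 eq_le cmod_ge0 andbT.
apply/ler_addgt0Pr => e e0; rewrite add0r.
have e2 : 0 < e / 2 by rewrite divr_gt0.
have [r r0 H] := Pd _ e2; have [q q0 K] := Qd _ e2.
have [x [x0 xr xq]] : exists x : R, [/\ 0 < x, x < r & x < q].
  exists (Num.min r q / 2); have m0 : 0 < Num.min r q by rewrite lt_min r0 q0.
  have : Num.min r q / 2 < Num.min r q by rewrite ltr_pdivrMr// mulr2n mulrDr mulr1 ltrDl.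
  by rewrite lt_min => /andP[? ?]; split=> //; rewrite divr_gt0.
have xE : cmod x%:C = x by rewrite cmod_real gtr0_norm.
have := H x%:C; have := K x%:C; rewrite !xE add0r => /(_ xq) K1 /(_ xr) H1.
rewrite -(ler_pM2r x0) -{1}xE -cmodM.
have -> : (d1 - d2) * x%:C = (Q x%:C - Q 0 - d2 * x%:C) - (P x%:C - P 0 - d1 * x%:C).
  by rewrite PQ (PQ 0 : P 0 = Q 0); ring.
rewrite (le_trans (cmodD _ _))// cmodN (le_trans (lerD K1 H1))//.
by rewrite -mulrDl -splitr.
Qed.

(* Differentiate [gammaL_scale] with respect to [c] at [c = 1]. *)
Lemma gammaI_rec w : 0 < complex.Re w -> gammaI (w + 1) = w * gammaI w.
Proof.
move=> w0; have [I1 [_ D1]] := gammaL_pos w0 ltr01.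
(* The parameter is written [c = e^z], so that every real [z] gives a positive [c], and [c = 1]
   becomes [z = 0]. *)
have P1 : cderiv (fun z => gammaL w (expC z)) 0
    (cint leb posR (fun t => (- t)%:C * (expC ((1 : R)%:C * (- t)%:C) * pw (w - 1) t)) * 1).
  have := cderiv_expC (0 : R[i]); rewrite expC0 => e0.
  by apply: (cderiv_comp e0); rewrite expC0.
have Q1 : cderiv (fun z => expC (- w * z) * gammaI w) 0 (- w * gammaI w).
  have e1 : cderiv (fun z : R[i] => - w * z) 0 (- w).
    have := cderivM (cderiv_cst (- w) 0) (cderiv_id 0).
    by rewrite mul0r add0r mulr1.
  have e2 := cderiv_comp e1 (cderiv_expC (- w * 0)).
  have := cderivM e2 (cderiv_cst (gammaI w) 0).
  by rewrite !mulr0 expC0 mul1r addr0.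
have := cderiv_real_unique P1 Q1 _; rewrite mulr1 => E.
have {}E : cint leb posR (fun t => (- t)%:C * (expC ((1 : R)%:C * (- t)%:C) * pw (w - 1) t)) = - w * gammaI w.
  apply: E => x; rewrite expC_real (gammaL_scale w0 (expR_gt0 x)).
  by rewrite /pw expRK mulNr expCN mulKf// expC_neq0.
have w1 : 0 < complex.Re (w + 1) by rewrite ReD/= ltr_wpDr.
rewrite -[RHS]opprK -mulNr -E gammaIE.
have [I2 _] := gammaL_pos w1 ltr01.
rewrite /gammaL /param -[in LHS](opprK (cint _ _ _)) -(cintN mposR I2).
congr (- _); apply: cint_eq => t; rewrite posRP => t0.
rewrite addrK (pw_sub1 w t0) rmorphN/=; ring.
Qed.

Lemma gammaI_recn w k : 0 < complex.Re w ->
  gammaI (w + k%:R) = \prod_(0 <= i < k) (w + i%:R) * gammaI w.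
Proof.
move=> w0; elim: k => [|k IH]; first by rewrite addr0 big_geq// mul1r.
rewrite -natr1 addrA gammaI_rec ?IH.
  by rewrite big_nat_recr//= mulrA (mulrC (_ + _)).
by rewrite ReD natC/= ltr_wpDr// ler0n.
Qed.

(** Whatever shift [k] the definition takes, [gammaI_recn] cancels it. *)
Lemma cGammaE w : 0 < complex.Re w -> cGamma w = gammaI w.
Proof.
move=> w0; rewrite /cGamma -/(gammaI _) gammaI_recn// mulrAC divff ?mul1r//.
rewrite prodf_seq_neq0; apply/allP => i _ /=.
apply: contraTneq w0 => /(congr1 (@complex.Re R)); rewrite ReD natC/= => E.
by rewrite -leNgt (_ : complex.Re w = - i%:R) ?oppr_le0//; apply/eqP; rewrite -addr_eq0 E.
Qed.

(** As a function of [w], Euler's integral is a [param] with [a = ln], evaluated at [w - 1]. *)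
Lemma gammaI_cdiff w : 0 < complex.Re w -> cdiff gammaI w.
Proof.
move=> w0.
have E : gammaI = (fun w => param leb posR (@ln R) (fun t => (expR (- t))%:C) (w - 1)) by [].
rewrite E; apply: (@cdiff_comp _ (fun w => w - 1)).
  exact: cdiffB (cdiff_id _) (cdiff_cst _ _).
apply: (@param_cdiff _ _ _ _ _ mposR _ _ (-1) (complex.Re w)).
- exact: measurable_lnpos.
- apply: cmeas_real; apply: measurable_posR => x _.
  exact: rder_continuous (rder_exp (rderN (rder_id x))).
- move=> t /andP[t1 _]; apply: (rintegrable_eq mposR _ (rp_expR_integrable t1 ltr01)) => x _.
  by rewrite mul1r cmod_real ger0_norm ?expR_ge0// mulrC.
- by rewrite ReD ReN/=; apply/andP; split; lra.
Qed.

End GammaInt.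

(** * The Fejér kernel *)

Section Fejer.
Context {R : realType}.
Implicit Types (x y u : R).

Lemma rder_sum (F : nat -> R -> R) (G : nat -> R) x k :
  (forall i, is_derive x 1 (F i) (G i)) ->
  is_derive x 1 (fun t => \sum_(i < k) F i t) (\sum_(i < k) G i).
Proof.
move=> FG; elim: k => [|k IH].
  by rewrite big_ord0; under eq_fun do rewrite big_ord0; exact: rder_cst.
by rewrite big_ord_recr/=; under eq_fun do rewrite big_ord_recr/=; exact: rderD.
Qed.

(** Normalised to period 1: the sum of [e^(2 pi i j x)] over [|j| <= k]. The primitives below are
    those vanishing at 0. *)
Definition dirichlet (k : nat) x : R := 1 + \sum_(i < k) 2 * cos (2 * pi * i.+1%:R * x).
Definition dirichlet_prim (k : nat) x : R :=
  x + \sum_(i < k) sin (2 * pi * i.+1%:R * x) / (pi * i.+1%:R).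
Definition fejer (M : nat) x : R := M.+1%:R^-1 * \sum_(k < M.+1) dirichlet k x.
Definition fejer_prim (M : nat) x : R := M.+1%:R^-1 * \sum_(k < M.+1) dirichlet_prim k x.

Lemma sin_natpi n : sin (pi * n%:R) = 0 :> R.
Proof. by elim: n => [|n IH]; rewrite ?mulr0 ?sin0// -natr1 mulrDr mulr1 sinDpi IH oppr0. Qed.

Lemma sqr_sin_natpi n u : sin (pi * (n%:R + u)) ^+ 2 = sin (pi * u) ^+ 2 :> R.
Proof.
elim: n => [|n IH]; first by rewrite add0r.
by rewrite -natr1 addrAC mulrDr mulr1 sinDpi sqrrN IH.
Qed.

Lemma rder_dirichlet_prim k x : is_derive x 1 (dirichlet_prim k) (dirichlet k x).
Proof.
have H i : is_derive x 1 (fun t => sin (2 * pi * i.+1%:R * t) / (pi * i.+1%:R))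
   (2 * cos (2 * pi * i.+1%:R * x)).
  apply: (rderE (rderM (rder_sin (rderZ (2 * pi * i.+1%:R) (rder_id x))) 
    (rder_cst (pi * i.+1%:R)^-1 x))).
  have : pi != 0 :> R by rewrite gt_eqF// pi_gt0.
  move=> p0; have i0 : i.+1%:R != 0 :> R by rewrite pnatr_eq0.
  by move: p0 i0; move: (pi : R) (i.+1%:R : R) => p w p0 w0; field; rewrite ?p0 ?w0.
exact: (rderD (rder_id x) (rder_sum k H)).
Qed.

Lemma rder_fejer_prim M x : is_derive x 1 (fejer_prim M) (fejer M x).
Proof. exact: (rderZ _ (rder_sum M.+1 (fun k => rder_dirichlet_prim k x))). Qed.

(** Telescoping: with [b = pi x], [2 sin b cos (2(k+1)b) = sin ((2k+3)b) - sin ((2k+1)b)]. *)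
Lemma sin_dirichlet k x : sin (pi * x) * dirichlet k x = sin ((2 * k%:R + 1) * (pi * x)).
Proof.
elim: k => [|k IH].
  by rewrite /dirichlet big_ord0 addr0 mulr1 mulr0 add0r mul1r.
have -> : dirichlet k.+1 x = dirichlet k x + 2 * cos (2 * pi * k.+1%:R * x).
  by rewrite /dirichlet big_ord_recr/= addrA.
rewrite mulrDr IH -(natr1 k).
have -> : (2 * k%:R + 1) * (pi * x) = 2 * pi * (k%:R + 1) * x - pi * x by ring.
have -> : (2 * (k%:R + 1) + 1) * (pi * x) = 2 * pi * (k%:R + 1) * x + pi * x by ring.
by rewrite sinB sinD; ring.
Qed.

(** The closed form of the kernel, multiplied out so as to hold at integers too. It gives positivity
    and the decay [O(1/M)] off the integers. *)
Lemma sin_fejer M x : M.+1%:R * (sin (pi * x) ^+ 2 * fejer M x) = sin (M.+1%:R * (pi * x)) ^+ 2.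
Proof.
have m0 : M.+1%:R != 0 :> R by rewrite pnatr_eq0.
have -> : M.+1%:R * (sin (pi * x) ^+ 2 * fejer M x) =
    sin (pi * x) * \sum_(k < M.+1) sin (pi * x) * dirichlet k x.
  rewrite -mulr_sumr /fejer; set S := \sum_(k < _) _; by field.
have E n : sin (pi * x) * \sum_(k < n) sin ((2 * k%:R + 1) * (pi * x)) = sin (n%:R * (pi * x)) ^+ 2.
  elim: n => [|n IH]; first by rewrite big_ord0 mulr0 mul0r sin0 expr0n.
  rewrite big_ord_recr/= mulrDr IH -(natr1 n).
  have -> : (2 * n%:R + 1) * (pi * x) = n%:R * (pi * x) + n%:R * (pi * x) + pi * x by ring.
  have -> : (n%:R + 1) * (pi * x) = n%:R * (pi * x) + pi * x by ring.
  rewrite !sinD !cosD; set a := n%:R * (pi * x); set b := pi * x.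
  have ca := cos2sin2 a; have cb := cos2sin2 b.
  rewrite [RHS](_ : _ = sin a ^+ 2 * cos b ^+ 2 + cos a ^+ 2 * sin b ^+ 2 + 
    2 * sin a * cos a * sin b * cos b); last by ring.
  rewrite [LHS](_ : _ = sin a ^+ 2 + 2 * sin a * cos a * sin b * cos b + 
    (cos a ^+ 2 - sin a ^+ 2) * sin b ^+ 2); last by ring.
  by rewrite ca cb; ring.
by rewrite -E; congr (_ * _); apply: eq_bigr => k _; rewrite sin_dirichlet.
Qed.

Lemma fejer_ge0 M x : sin (pi * x) != 0 -> 0 <= fejer M x.
Proof.
move=> s0; have s2 : 0 < M.+1%:R * sin (pi * x) ^+ 2.
  by rewrite mulr_gt0// lt_def sqrf_eq0 s0 sqr_ge0.
by rewrite -(pmulr_rge0 _ s2) -mulrA sin_fejer sqr_ge0.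
Qed.

Lemma fejer_le M x : sin (pi * x) != 0 -> fejer M x <= (M.+1%:R * sin (pi * x) ^+ 2)^-1.
Proof.
move=> s0; have s2 : 0 < M.+1%:R * sin (pi * x) ^+ 2.
  by rewrite mulr_gt0// lt_def sqrf_eq0 s0 sqr_ge0.
rewrite -[leRHS]mulr1 ler_pdivlMl// -mulrA sin_fejer.
by rewrite -real_normK ?num_real// exprn_ile1// sin_max.
Qed.

(** All sine terms vanish at half-integers; hence each half period carries mass exactly 1/2. *)
Lemma dirichlet_prim_half (k n : nat) : dirichlet_prim k (n%:R / 2) = n%:R / 2.
Proof.
rewrite /dirichlet_prim big1 ?addr0// => i _.
rewrite (_ : 2 * pi * i.+1%:R * (n%:R / 2) = pi * (i.+1 * n)%:R); last first.
  by rewrite natrM; field.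
by rewrite sin_natpi mul0r.
Qed.

Lemma fejer_prim_half (M n : nat) : fejer_prim M (n%:R / 2) = n%:R / 2.
Proof.
rewrite /fejer_prim; under eq_bigr do rewrite dirichlet_prim_half.
by rewrite sumr_const card_ord -[X in _ * X]mulr_natl mulrA mulVf ?mul1r// pnatr_eq0.
Qed.

Lemma fejer_prim_nat (M n : nat) : fejer_prim M n%:R = n%:R.
Proof.
have := fejer_prim_half M (n * 2); rewrite natrM mulfK//.
Qed.

Lemma fejer_prim_mid (M n : nat) : fejer_prim M (n%:R + 2^-1) = n%:R + 2^-1.
Proof.
have -> : n%:R + 2^-1 = (n * 2 + 1)%:R / 2 :> R by rewrite natrD natrM; field.
exact: fejer_prim_half.
Qed.

Lemma fejer_prim_continuous M a b : {within `[a, b], continuous (fejer_prim M)}.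
Proof. by apply: continuous_subspaceT => x; exact: rder_continuous (rder_fejer_prim M x). Qed.

Lemma sin_pi_unit_neq0 (n : nat) x : n%:R < x < n.+1%:R -> sin (pi * x) != 0 :> R.
Proof.
rewrite -(natr1 n) => /andP[nx xn]; rewrite -sqrf_eq0 -(subrK n%:R x) addrC sqr_sin_natpi sqrf_eq0 gt_eqF//.
apply: sin_gt0_pi; rewrite mulr_gt0 ?pi_gt0 ?subr_gt0//=.
by rewrite gtr_pMr ?pi_gt0// ltrBlDl.
Qed.

Lemma fejer_prim_mono M (n : nat) a b : n%:R <= a -> a <= b -> b <= n.+1%:R ->
  fejer_prim M a <= fejer_prim M b.
Proof.
move=> na ab bn; have [c cab] := @MVT_segment R _ _ a b ab
  (fun x _ => rder_fejer_prim M x) (@fejer_prim_continuous M a b).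
move: ab; rewrite le_eqVlt => /predU1P[->//|ab].
have [d dab /eqP] := @MVT R _ _ a b ab
  (fun x _ => rder_fejer_prim M x) (@fejer_prim_continuous M a b).
rewrite subr_eq => /eqP -> _; rewrite lerDr mulr_ge0 ?subr_ge0 ?(ltW ab)//.
apply: fejer_ge0; apply: (@sin_pi_unit_neq0 n); move: dab; rewrite in_itv/= => /andP[ad db].
by rewrite (le_lt_trans na ad) (lt_le_trans db bn).
Qed.

(** The primitive increases from [n] to [n + 1] on this interval. *)
Lemma fejer_prim_dist M (n : nat) x : n%:R <= x <= n.+1%:R ->
  `|fejer_prim M x - (n%:R + 2^-1)| <= 2^-1.
Proof.
move=> /andP[nx xn].
have := fejer_prim_mono M (lexx _) nx xn; have := fejer_prim_mono M nx xn (lexx _).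
rewrite !fejer_prim_nat -(natr1 n) => h1 h2; rewrite ler_norml; apply/andP; split; lra.
Qed.

Lemma sin_pi_ge u v : 0 < u < 2^-1 -> u <= v <= 1 - u -> sin (pi * u) <= sin (pi * v) :> R.
Proof.
move=> /andP[u0 u2].
have p0 := pi_gt0 R.
have W w : u <= w <= 2^-1 -> sin (pi * u) <= sin (pi * w).
  move=> /andP[uw w2]; have [->//|E] := eqVneq u w.
  rewrite ltW// ltr_sin ?in_itv/= ?ltr_pM2l ?lt_neqAle ?E//;
    apply/andP; split; nra.
move=> /andP[uv vu]; have [v2|v2] := leP v 2^-1; first by apply: W; rewrite uv.
have -> : sin (pi * v) = sin (pi * (1 - v)).
  by rewrite mulrBr mulr1 sinB sinpi cospi; ring.
by apply: W; apply/andP; split; lra.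
Qed.

(** The primitive equals [n + 1/2] at the midpoint, and at distance [del] from the integers its
    slope is at most the right-hand side. So it tends to a step function jumping at the integers. *)
Lemma fejer_prim_far M (n : nat) (del x : R) : 0 < del < 2^-1 -> n%:R + del <= x <= n.+1%:R - del ->
  `|fejer_prim M x - (n%:R + 2^-1)| <= (M.+1%:R * sin (pi * del) ^+ 2)^-1.
Proof.
move=> dd /andP[nx xn]; have /andP[d0 d2] := dd.
have p0 := pi_gt0 R.
have s0 : 0 < sin (pi * del).
  by apply: sin_gt0_pi; apply/andP; split; nra.
have B c : n%:R + del <= c <= n.+1%:R - del -> `|fejer M c| <= (M.+1%:R * sin (pi * del) ^+ 2)^-1.
  rewrite -(natr1 n) => /andP[c1 c2].
  have c3 : sin (pi * c) != 0 by apply: (@sin_pi_unit_neq0 n); rewrite -(natr1 n); apply/andP; split; lra.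
  rewrite ger0_norm ?fejer_ge0// (le_trans (fejer_le M c3))//.
  have Ms : 0 < sin (pi * c) ^+ 2 by rewrite lt_def sqrf_eq0 c3 sqr_ge0.
  have P1 : M.+1%:R * sin (pi * c) ^+ 2 \is Num.pos by rewrite posrE mulr_gt0.
  have P2 : M.+1%:R * sin (pi * del) ^+ 2 \is Num.pos by rewrite posrE mulr_gt0// exprn_gt0.
  rewrite (lef_pV2 P1 P2) ler_pM2l//.
  rewrite -(subrK n%:R c) (addrC _ n%:R) sqr_sin_natpi lerXn2r ?nnegrE ?(ltW s0)//.
    by rewrite (le_trans (ltW s0))// sin_pi_ge//; apply/andP; split; lra.
  by rewrite sin_pi_ge//; apply/andP; split; lra.
have V a b : a <= b -> n%:R + del <= a -> b <= n.+1%:R - del -> b - a <= 1 ->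
    `|fejer_prim M b - fejer_prim M a| <= (M.+1%:R * sin (pi * del) ^+ 2)^-1.
  move=> ab na bn ab1; have [c + ->] := @MVT_segment R _ _ a b ab
    (fun x _ => rder_fejer_prim M x) (@fejer_prim_continuous M a b).
  rewrite in_itv/= => /andP[ac cb]; rewrite normrM (ger0_norm (_ : 0 <= b - a)) ?subr_ge0//.
  rewrite (le_trans (ler_piMr _ ab1))// B// (le_trans na ac) (le_trans cb bn)//.
rewrite -(fejer_prim_mid M n); move: xn V; rewrite -(natr1 n) => xn V.
have [xm|xm] := leP x (n%:R + 2^-1).
  by rewrite distrC; apply: V; lra.
by apply: V; lra.
Qed.

End Fejer.

(** * The theta function and its functional equation *)

Section Psi.
Context {R : realType}.
Implicit Types (t : R).

Lemma cvg_eqn (u v : nat -> R) (l : R) : (forall n, u n = v n) ->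
  u @ \oo --> l -> v @ \oo --> l.
Proof. by move=> /funext ->. Qed.

Definition psiN (N : nat) t : R := \sum_(i < N) expR (- (pi * i.+1%:R ^+ 2 * t)).
(** Jacobi's theta function is [1 + 2 * psi]. *)
Definition psi t : R := limn (fun N => psiN N t).

Lemma psi_ratio t : 0 < t -> 0 < expR (- (pi * t)) < 1.
Proof. by move=> t0; rewrite expR_gt0 -expR0 ltr_expR oppr_lt0 mulr_gt0 ?pi_gt0. Qed.

(** As [n^2 >= n], the terms lie below a geometric series; keeping its exact partial sum makes the
    induction close. *)
Lemma psiN_bound N t : 0 < t ->
  psiN N t <= expR (- (pi * t)) / (1 - expR (- (pi * t))) * (1 - expR (- (pi * t)) ^+ N).
Proof.
move=> t0; have /andP[q0 q1] := psi_ratio t0; set q := expR _ in q0 q1 *.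
elim: N => [|N IH]; first by rewrite /psiN big_ord0 expr0 subrr mulr0.
rewrite /psiN big_ord_recr/= -/(psiN N t).
have E : expR (- (pi * N.+1%:R ^+ 2 * t)) <= q ^+ N.+1.
  rewrite /q -expRM_natr ler_expR mulNr lerN2.
  rewrite [leRHS](_ : _ = pi * t * N.+1%:R ^+ 2); last by ring.
  by rewrite ler_wpM2l ?mulr_ge0 ?pi_ge0 ?(ltW t0)// expr2 ler_peMr// ler1n.
rewrite (le_trans (lerD IH E))// le_eqVlt; apply/orP; left; apply/eqP.
by rewrite exprS; field; rewrite gt_eqF// subr_gt0.
Qed.

Lemma psiN_le_ratio N t : 0 < t -> psiN N t <= expR (- (pi * t)) / (1 - expR (- (pi * t))).
Proof.
move=> t0; have /andP[q0 q1] := psi_ratio t0.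
by rewrite (le_trans (psiN_bound N t0))// ler_piMr ?divr_ge0 ?subr_ge0 ?(ltW q0) ?(ltW q1)// gerBl exprn_ge0// ltW.
Qed.

Lemma psiN_ge0 N t : 0 <= psiN N t.
Proof. by apply: sumr_ge0 => i _; exact: expR_ge0. Qed.

Lemma psiN_nd t : nondecreasing_seq (fun N => psiN N t).
Proof.
by apply/nondecreasing_seqP => N; rewrite /psiN big_ord_recr/= lerDl expR_ge0.
Qed.

Lemma psi_is_cvg t : 0 < t -> cvgn (fun N => psiN N t).
Proof.
move=> t0; apply: nondecreasing_is_cvgn; first exact: psiN_nd.
by exists (expR (- (pi * t)) / (1 - expR (- (pi * t)))) => _ [N _ <-]; exact: psiN_le_ratio.
Qed.

Lemma psi_cvg t : 0 < t -> (fun N => psiN N t) @ \oo --> psi t.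
Proof. exact: psi_is_cvg. Qed.

Lemma psiN_le N t : 0 < t -> psiN N t <= psi t.
Proof. by move=> t0; exact: (nondecreasing_cvgn_le (psiN_nd t) (psi_is_cvg t0)). Qed.

Lemma psi_ge0 t : 0 < t -> 0 <= psi t.
Proof. by move=> t0; rewrite (le_trans (psiN_ge0 0 t))// psiN_le. Qed.

Lemma psi_le_ratio t : 0 < t -> psi t <= expR (- (pi * t)) / (1 - expR (- (pi * t))).
Proof.
by move=> t0; apply: limr_le; [exact: psi_is_cvg|apply: nearW => N; exact: psiN_le_ratio].
Qed.

Lemma psi_le_exp t : 1 <= t -> psi t <= 2 * expR (- t).
Proof.
move=> t1; have t0 : 0 < t by lra.
rewrite (le_trans (psi_le_ratio t0))//.
(* [pi t >= 1] already gives [e^(-pi t) <= 1/2], so the denominator in [psi_le_ratio] costs at most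
   a factor 2. *)
have p2 : 2 <= pi :> R by exact: pi_ge2.
have E1 : expR (- (pi * t)) <= expR (- t) by rewrite ler_expR lerN2 ler_peMl// ?(ltW t0)//; lra.
have E2 : expR (- (pi * t)) <= 2^-1.
  rewrite -[leRHS]invrK -(invrK 2) expRN lef_pV2 ?posrE ?expR_gt0 ?invrK//.
  rewrite (le_trans _ (expR_ge1Dx _))//; nra.
have /andP[q0 q1] := psi_ratio t0.
rewrite ler_pdivrMr ?subr_gt0//; move: E1 E2 q0 (expR_gt0 (- t)).
move: (expR (- (pi * t))) (expR (- t)) => a b; nra.
Qed.

Lemma psi_term_cvg0 t : 0 < t -> (fun K => expR (- (pi * K.+1%:R ^+ 2 * t))) @ \oo --> (0 : R).
Proof.
move=> t0; have c := psi_cvg t0.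
have c1 : (fun N => psiN N.+1 t) @ \oo --> psi t by rewrite (cvg_shiftS (fun N => psiN N t)).
have H : (fun N => psiN N.+1 t - psiN N t) @ \oo --> psi t - psi t by exact: cvgB.
rewrite subrr in H; apply: cvg_eqn H => K.
by rewrite /psiN big_ord_recr/= addrAC subrr add0r.
Qed.

End Psi.

(** * Fourier integrals of the Gaussian *)

Section GaussFourier.
Context {R : realType}.
Notation leb := (@lebesgue_measure R).
Variable t : R.
Hypothesis t0 : 0 < t.

Definition gf (y : R) : R := expR (- (pi * t * y ^+ 2)).
Definition gf' (y : R) : R := - (2 * pi * t * y) * gf y.

Lemma rder_gf (y : R) : is_derive y 1 gf (gf' y).
Proof.
apply: (rderE (rder_exp (rderN (rderZ (pi * t) (rderM (rder_id y) (rder_id y)))))).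
by rewrite /gf' /gf expr2; ring.
Qed.

Lemma gf_continuous (y : R) : {for y, continuous gf}.
Proof. exact: rder_continuous (rder_gf y). Qed.

Lemma gf'_continuous (y : R) : {for y, continuous gf'}.
Proof.
exact: rder_continuous (rderM (rderN (rderZ (2 * pi * t) (rder_id y))) (rder_gf y)).
Qed.

Lemma gauss_fun_integrable : rintegrable leb `[0, +oo[ gauss_fun.
Proof. by apply: (integrableS _ _ _ (@integrableT_gauss R)). Qed.

Lemma pi_t_gt0 : 0 < pi * t. Proof. by rewrite mulr_gt0// pi_gt0. Qed.

Lemma rp_half : rp (- (1 / 2)) t = (Num.sqrt t)^-1.
Proof.
have sE : Num.sqrt t = rp (1 / 2) t.
  have H : rp (1 / 2) t ^+ 2 = t by rewrite expr2 -rpD -splitr rp1.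
  by rewrite -{1}H sqrtr_sqr ger0_norm// ltW// rp_gt0.
by rewrite sE /rp mulNr expRN.
Qed.

(** The Gauss integral over the half-line, [sqrt pi / 2], after scaling by [sqrt (pi t)]. *)
Lemma gf_integral_cvg : (fun K => \int[leb]_(y in seg 0 K%:R) gf y) @ \oo --> rp (- (1 / 2)) t / 2.
Proof.
pose c := Num.sqrt (pi * t).
have c0 : 0 < c by rewrite sqrtr_gt0 pi_t_gt0.
have c2 : c ^+ 2 = pi * t by rewrite sqr_sqrtr// ltW// pi_t_gt0.
have E (K : nat) : \int[leb]_(y in seg 0 K%:R) gf y = c^-1 * \int[leb]_(x in seg (c * 0) (c * K%:R)) gauss_fun x.
  have K0 : 0 <= K%:R :> R by [].
  have dG (x : R) : seg 0 K%:R x -> is_derive x 1 (fun u => c * u) c.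
    by move=> _; apply: (rderE (rderZ c (rder_id x))); rewrite mulr1.
  have cc (x : R) : seg 0 K%:R x -> {for x, continuous (fun=> c)}.
    by move=> _; exact: cst_continuous.
  (* [subst_inc] asks for a bound strictly below the left end, which is 0 here; -1 serves. *)
  have gc (x : R) : -1 < x -> {for x, continuous gauss_fun}.
    by move=> _; exact: continuous_gauss_fun.
  have l1 : -1 < c * 0 by rewrite mulr0.
  have l2 : c * 0 <= c * K%:R by rewrite ler_pM2l.
  have Gx (x : R) : seg 0 K%:R x -> c * 0 <= c * x <= c * K%:R.
    by rewrite /seg/= in_itv/= !ler_pM2l.
  rewrite (subst_inc K0 gc dG cc l1 l2 Gx) -RintegralZl; [|exact: mseg|].
    apply: eq_Rintegral => y _; by rewrite /gf /gauss_fun exprMn c2 [RHS]mulrC mulfK// gt_eqF.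
  apply: rintegrable_seg => x _; apply: continuousM; last exact: cst_continuous.
  by apply: continuous_rder_comp (rderZ c (rder_id x)) _; exact: continuous_gauss_fun.
have -> : rp (- (1 / 2)) t / 2 = c^-1 * (Num.sqrt pi / 2).
  rewrite rp_half /c sqrtrM ?pi_ge0// invfM mulrA; congr (_ / 2).
  by rewrite mulrAC mulVf ?mul1r// gt_eqF// sqrtr_gt0 pi_gt0.
under eq_fun do rewrite E.
apply: cvgMr.
have gE : Num.sqrt pi / 2 = \int[leb]_(x in `[0, +oo[) gauss_fun x.
  by rewrite /Rintegral integral0y_gauss.
rewrite gE mulr0; apply: rint_exhaust => //.
- by move=> n; exact: mseg.
- by move=> n x; rewrite /seg/= !in_itv/= => /andP[-> _].
- move=> x; rewrite /= in_itv/= andbT => x0; exists (Num.truncn (x / c)).+1 => n Nn.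
  rewrite /seg/= in_itv/= x0/= mulrC -ler_pdivrMr// (le_trans (ltW (truncnS_gt _)))//.
  by rewrite ler_nat.
- exact: gauss_fun_integrable.
Qed.

Definition gfcos (m : nat) (y : R) : R := gf y * cos (2 * pi * m%:R * y).

Lemma gfcos_continuous (m : nat) (y : R) : {for y, continuous (gfcos m)}.
Proof.
exact: rder_continuous (rderM (rder_gf y) (rder_cos (rderZ (2 * pi * m%:R) (rder_id y)))).
Qed.

(* Goursat's theorem for [exp (- pi t z ^+ 2)] on the rectangle [0, K] x [0, m / t]. *)
Lemma gfcos_integral_cvg (m : nat) :
  (fun K => \int[leb]_(y in seg 0 K%:R) gfcos m y) @ \oo -->
  rp (- (1 / 2)) t / 2 * expR (- (pi * m%:R ^+ 2 * t^-1)).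
Proof.
(* At height [b] the function [exp (- pi t z^2)] oscillates with frequency [t * b = m]. *)
pose b := m%:R / t.
have b0 : 0 <= b by rewrite divr_ge0// ltW.
have tb : t * b = m%:R by rewrite /b mulrC divfK// gt_eqF.
pose h (z : R[i]) := expC (- (pi * t)%:C * z ^+ 2).
have hE (x y : R) : h (x +i* y) = (expR (pi * t * y ^+ 2))%:C * 
    ((gf x)%:C * (cos (2 * pi * (t * y) * x) -i* sin (2 * pi * (t * y) * x))).
  have zE : - (pi * t)%:C * (x +i* y) ^+ 2 =
      (- (pi * t * x ^+ 2) + pi * t * y ^+ 2) +i* (- (2 * pi * (t * y) * x)).
    by apply: complex_ext; rewrite expr2 !(ReM, ImM) /=; ring.
  rewrite /h zE expC_polar expRD rmorphM/= cosN sinN /gf; ring.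
have reh (x y : R) : complex.Re (h (x +i* y)) = expR (pi * t * y ^+ 2) * (gf x * cos (2 * pi * (t * y) * x)).
  by rewrite hE !ReM ImM /=; ring.
have imh (y : R) : complex.Im (h (0 +i* y)) = 0.
  by rewrite hE mulr0 sin0 !ImM ReM /=; ring.
have hd z : cdiff h z.
  apply: cdiff_expC; apply: cdiffM (cdiff_cst _ _) _; exact: cdiffX (cdiff_id _).
pose e (K : nat) := complex.Im (cint leb (seg 0 b) (fun y => h (K%:R +i* y))).
(* Real part of the contour identity. On the left side, part of the imaginary axis, [h] is real and
   with [dz = i dy] contributes nothing; the right side gives [e K]. *)
have key (K : nat) : \int[leb]_(y in seg 0 K%:R) gf y - expR (pi * t * b ^+ 2) *
     \int[leb]_(y in seg 0 K%:R) gfcos m y = e K.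
  have K0 : 0 <= K%:R :> R by [].
  have := goursat K0 b0 (fun z _ => hd z); move=> /(congr1 (@complex.Re R)).
  have Ri : complex.Re ('i : R[i]) = 0 by [].
  have Ii : complex.Im ('i : R[i]) = 1 by [].
  rewrite /loop !(ReD, ReN, ReM) Ri Ii mul0r sub0r mul1r ImD ImN -/(e K).
  rewrite !Re_cint.
  have -> : \int[leb]_(x in seg 0 K%:R) complex.Re (h (x +i* 0)) = \int[leb]_(y in seg 0 K%:R) gf y.
    apply: eq_Rintegral => x _; rewrite reh !(mulr0, mul0r, expr2, expR0, mul1r, cos0).
    exact: mulr1.
  have -> : \int[leb]_(x in seg 0 K%:R) complex.Re (h (x +i* b)) = expR (pi * t * b ^+ 2) *
     \int[leb]_(y in seg 0 K%:R) gfcos m y.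
    rewrite -RintegralZl; [|exact: mseg|by apply: rintegrable_seg => x _; exact: gfcos_continuous].
    by apply: eq_Rintegral => x _; rewrite reh tb.
  have -> : complex.Im (cint leb (seg 0 b) (fun y => h (0 +i* y))) = 0.
    rewrite Im_cint -[RHS](mul0r (b - 0)) -(rint_cst_seg 0 b0); apply: eq_Rintegral => y _.
    exact: imh.
  by rewrite subr0 => /eqP; rewrite subr_eq0 => /eqP.
have ebnd (K : nat) : `|e K| <= 2 * (expR (pi * t * b ^+ 2) * gf K%:R * (b - 0)).
  rewrite (le_trans (Im_le_cmod _))//; apply: cint_seg_le => //.
    by apply: cintble_seg => y _; apply: ccont_vline; exact: cdiff_cont (hd _).
  move=> y ys; have /andP[y0 yb] : 0 <= y <= b by move: ys; rewrite /seg/= in_itv.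
  rewrite hE !cmodM !cmod_real.
  rewrite (_ : cmod (_ -i* _) = 1) ?mulr1; last by rewrite cmodE/= sqrrN cos2Dsin2 sqrtr1.
  rewrite !ger0_norm ?expR_ge0// ler_wpM2r ?expR_ge0// ler_expR ler_wpM2l ?(ltW pi_t_gt0)//.
  by rewrite lerXn2r.
have gK : (fun K : nat => gf K%:R) @ \oo --> (0 : R).
  have := psi_term_cvg0 t0; rewrite (cvg_shiftS (fun K : nat => expR (- (pi * K%:R ^+ 2 * t)))).
  by move=> H; apply: cvg_eqn H => K; rewrite /gf mulrAC.
have e_cvg : e @ \oo --> (0 : R).
  apply/cvgr0Pnorm_lt => d d0.
  have H : (fun K : nat => 2 * expR (pi * t * b ^+ 2) * b * gf K%:R) @ \oo -->
    2 * expR (pi * t * b ^+ 2) * b * 0 by exact: cvgMr.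
  rewrite mulr0 in H; move/cvgr0Pnorm_lt : H => /(_ d d0).
  apply: filterS => K; apply: le_lt_trans; rewrite (le_trans (ebnd K))//.
  by rewrite (le_trans _ (ler_norm _))// subr0 le_eqVlt; apply/orP; left; apply/eqP; ring.
have pE : expR (- (pi * m%:R ^+ 2 * t^-1)) = (expR (pi * t * b ^+ 2))^-1.
  rewrite -expRN; congr (expR (- _)); rewrite /b; field; rewrite gt_eqF//.
have -> : (fun K => \int[leb]_(y in seg 0 K%:R) gfcos m y) = (fun K : nat =>
    (\int[leb]_(y in seg 0 K%:R) gf y - e K) * (expR (pi * t * b ^+ 2))^-1).
  by apply/funext => K; rewrite -key opprB addrC subrK mulrAC divff ?mul1r// gt_eqF ?expR_gt0.
rewrite pE; apply: cvgMl; rewrite -[rp _ _ / 2]subr0; exact: cvgB gf_integral_cvg e_cvg.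
Qed.

End GaussFourier.

Section RintMore.
Context {R : realType}.
Notation leb := (@lebesgue_measure R).
Implicit Types (f h : R -> R).

Lemma rint_seg_le f a b (M : R) : a <= b -> (forall x, seg a b x -> {for x, continuous f}) ->
  (forall x, seg a b x -> `|f x| <= M) -> `|\int[leb]_(x in seg a b) f x| <= M * (b - a).
Proof.
move=> ab fc fM; rewrite -rint_cst_seg//.
have If := rintegrable_seg fc.
apply: le_trans (le_normr_Rintegral (mseg a b) If) _.
apply: le_Rintegral; [exact: mseg|exact: rintegrable_norm| |exact: fM].
by apply: rintegrable_seg => x _; exact: cst_continuous.
Qed.

Lemma rint_sum (d : measure_display) (T : measurableType d) (mu : {measure set T -> \bar R})
    (D : set T) (F : nat -> T -> R) (k : nat) : measurable D ->
  (forall i, rintegrable mu D (F i)) ->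
  rintegrable mu D (fun x => \sum_(i < k) F i x) /\
  \int[mu]_(x in D) (\sum_(i < k) F i x) = \sum_(i < k) \int[mu]_(x in D) F i x.
Proof.
move=> mD IF; elim: k => [|k [I1 I2]].
  split.
    have := rintegrableZ mD 0 (IF 0%N); apply: rintegrable_eq => // x _.
    by rewrite big_ord0 mul0r.
  rewrite big_ord0; under eq_Rintegral do rewrite big_ord0.
  by rewrite Rintegral_cst// mul0r.
have E : (fun x => \sum_(i < k.+1) F i x) = (fun x => \sum_(i < k) F i x + F k x).
  by apply/funext => x; rewrite big_ord_recr.
rewrite E; split; first exact: rintegrableD.
by rewrite big_ord_recr/= -I2 RintegralD//; exact: IF.
Qed.

Lemma rint_unit_sum h (K : nat) : (forall x : R, {for x, continuous h}) ->
  \sum_(n < K) \int[leb]_(x in seg n%:R n.+1%:R) h x = \int[leb]_(x in seg 0 K%:R) h x.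
Proof.
move=> hc; elim: K => [|K IH].
  by rewrite big_ord0 /seg set_itv1 Rintegral_set1.
have h0 : 0 <= K%:R :> R by [].
have h1 : K%:R <= K.+1%:R :> R by rewrite ler_nat.
by rewrite big_ord_recr/= IH (rint_split h0 h1 (rintegrable_seg (fun x _ => hc x))).
Qed.

Lemma cvg_osum (u : nat -> nat -> R) (l : nat -> R) k : (forall i, (fun n => u i n) @ \oo --> l i) ->
  (fun n => \sum_(i < k) u i n) @ \oo --> \sum_(i < k) l i.
Proof.
move=> ul; elim: k => [|k IH].
  by rewrite big_ord0; under eq_fun do rewrite big_ord0; exact: cvg_cst.
rewrite big_ord_recr/=; under eq_fun do rewrite big_ord_recr/=.
by apply: cvgD => //; exact: ul.
Qed.

Lemma cvg_norm_le (u : nat -> R) (l B : R) : u @ \oo --> l -> (forall n, `|u n| <= B) -> `|l| <= B.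
Proof.
move=> ul uB; have c : (fun n => `|u n|) @ \oo --> `|l| by exact: cvg_norm.
rewrite -(cvg_lim _ c)//; apply: limr_le; first by apply/cvg_ex; exists `|l|.
by apply: nearW => n; exact: uB.
Qed.

End RintMore.

Section Theta.
Context {R : realType}.
Notation leb := (@lebesgue_measure R).
Variable t : R.
Hypothesis t0 : 0 < t.

Let g := gf t.
Let g' := gf' t.

(** The remainder when [g * fejer M] is integrated by parts over a unit interval, the primitive
    being centred at [n + 1/2]. Its boundary values -1/2 and 1/2 produce the mean of [g] at both
    ends. *)
Definition perr (n M : nat) : R :=
  \int[leb]_(y in seg n%:R n.+1%:R) (g' y * (fejer_prim M y - (n%:R + 2^-1))).

Lemma fejer_continuous M (y : R) : {for y, continuous (fejer M)}.
Proof.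
have H k : is_derive y 1 (dirichlet k) (\sum_(i < k) (2 * (- sin (2 * pi * i.+1%:R * y) * (2 * pi * i.+1%:R * 1)))).
  apply: (rderE (rderD (rder_cst 1 y) (rder_sum k (fun i => rderZ 2 (rder_cos (rderZ (2 * pi * i.+1%:R) (rder_id y))))))).
  by rewrite add0r.
exact: rder_continuous (rderZ _ (rder_sum M.+1 H)).
Qed.

Lemma perr_continuous n M (y : R) :
  {for y, continuous (fun y => g' y * (fejer_prim M y - (n%:R + 2^-1)))}.
Proof.
apply: continuousM; first exact: gf'_continuous.
exact: rder_continuous (rderB (rder_fejer_prim M y) (rder_cst (n%:R + 2^-1) y)).
Qed.

Lemma gfejer_continuous M (y : R) : {for y, continuous (fun y => g y * fejer M y)}.
Proof. by apply: continuousM; [exact: gf_continuous|exact: fejer_continuous]. Qed.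

Lemma unit_parts n M : \int[leb]_(y in seg n%:R n.+1%:R) (g y * fejer M y) =
  (g n%:R + g n.+1%:R) / 2 - perr n M.
Proof.
have nn : n%:R <= n.+1%:R :> R by rewrite ler_nat.
have c1 (y : R) : seg n%:R n.+1%:R y -> {for y, continuous (fun y => g y * fejer M y)}.
  by move=> _; exact: gfejer_continuous.
have c2 (y : R) : seg n%:R n.+1%:R y -> {for y, continuous (fun y => g' y * (fejer_prim M y - (n%:R + 2^-1)))}.
  by move=> _; exact: perr_continuous.
pose F y := g y * (fejer_prim M y - (n%:R + 2^-1)).
have dF (y : R) : seg n%:R n.+1%:R y -> is_derive y 1 F (g y * fejer M y + g' y * (fejer_prim M y - (n%:R + 2^-1))).
  move=> _; apply: (rderE (rderM (rder_gf t y) (rderB (rder_fejer_prim M y) (rder_cst (n%:R + 2^-1) y)))).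
  by rewrite subr0 (mulrC (g' y)).
have c3 (y : R) : seg n%:R n.+1%:R y -> {for y, continuous (fun y => g y * fejer M y + g' y * (fejer_prim M y - (n%:R + 2^-1)))}.
  by move=> ys; apply: continuousD; [exact: c1|exact: c2].
have := rint_FTC nn c3 dF.
rewrite (RintegralD (mseg _ _) (rintegrable_seg c1) (rintegrable_seg c2)) -/(perr n M).
rewrite /F !fejer_prim_nat -(natr1 n) => /eqP; rewrite -subr_eq0 => /eqP E.
apply/eqP; rewrite -subr_eq0; apply/eqP; rewrite -[RHS]E; by field.
Qed.

Let C : R := 2 * pi * t * expR ((pi * t)^-1).

Lemma pC_ge0 : 0 <= C.
Proof. by rewrite /C !mulr_ge0 ?pi_ge0 ?expR_ge0// ltW. Qed.

(** With [a = pi t]: [y <= e^y], and [a (y - 1/a)^2 >= 0] gives [y - a y^2 <= 1/a - y]. This is the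
    origin of the exponential in [C]. *)
Lemma gf'_bound (n : nat) (y : R) : n%:R <= y -> `|g' y| <= C * expR (- n%:R).
Proof.
move=> ny; have y0 : 0 <= y by rewrite (le_trans _ ny).
have a0 := pi_t_gt0 t0; set a := pi * t in a0.
have c0 : 0 <= 2 * pi * t * y by rewrite !mulr_ge0 ?pi_ge0 ?(ltW t0).
rewrite /g' /gf' normrM normrN (ger0_norm c0).
rewrite /gf ger0_norm ?expR_ge0// -/a /C -/a.
have E : y * expR (- (a * y ^+ 2)) <= expR (a^-1) * expR (- n%:R).
  rewrite -expRD (le_trans (ler_wpM2r (expR_ge0 _) (_ : y <= expR y)))//.
    by rewrite (le_trans _ (expR_ge1Dx _))// lerDr.
  rewrite -expRD ler_expR.
  have K : 0 <= a * (y - a^-1) ^+ 2 by rewrite mulr_ge0 ?sqr_ge0// ltW.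
  have K2 : a * (y - a^-1) ^+ 2 = a * y ^+ 2 - 2 * y + a^-1.
    by field; rewrite gt_eqF.
  rewrite K2 in K; lra.
rewrite [leLHS](_ : _ = 2 * pi * t * (y * expR (- (a * y ^+ 2)))); last by ring.
by rewrite -[leRHS]mulrA ler_wpM2l// !mulr_ge0 ?pi_ge0// ltW.
Qed.

(** Near each end the primitive is only within 1/2 of its centre, but the length is [del]; in
    between it is close to the centre by [fejer_prim_far]. The factor [expR (- n%:R)] makes the
    bounds summable over [n]. *)
Lemma perr_bound (n M : nat) (del : R) : 0 < del < 2^-1 ->
  `|perr n M| <= C * expR (- n%:R) * (del + (M.+1%:R * sin (pi * del) ^+ 2)^-1).
Proof.
move=> dd; have /andP[d0 d2] := dd.
set et := (_ * _)^-1; set B := C * expR (- n%:R).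
have B0 : 0 <= B by rewrite mulr_ge0 ?pC_ge0 ?expR_ge0.
have n1 : n.+1%:R = n%:R + 1 :> R by rewrite natr1.
have e0 : 0 <= et by rewrite invr_ge0 mulr_ge0// sqr_ge0.
have Ic (a b : R) : rintegrable leb (seg a b) (fun y => g' y * (fejer_prim M y - (n%:R + 2^-1))).
  by apply: rintegrable_seg => y _; exact: perr_continuous.
have h1 : n%:R <= n%:R + del by lra.
have h2 : n%:R + del <= n.+1%:R by lra.
have h3 : n%:R + del <= n.+1%:R - del by lra.
have h4 : n.+1%:R - del <= n.+1%:R by lra.
rewrite /perr (rint_split h1 h2 (Ic _ _)) (rint_split h3 h4 (Ic _ _)).
have P1 (a b e : R) : a <= b -> n%:R <= a -> 0 <= e -> (forall y, a <= y <= b -> `|fejer_prim M y - (n%:R + 2^-1)| <= e) ->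
   `|\int[leb]_(y in seg a b) (g' y * (fejer_prim M y - (n%:R + 2^-1)))| <= B * e * (b - a).
  move=> ab na e00 He; apply: rint_seg_le => // y; first by move=> _; exact: perr_continuous.
  rewrite /seg/= in_itv/= => /andP[ay yb]; rewrite normrM ler_pM//.
    by apply: gf'_bound; exact: le_trans ay.
  by apply: He; rewrite ay.
have b1 := P1 _ _ 2^-1 h1 (lexx _) _ _.
have b2 := P1 _ _ et h3 h1 e0 (fun y => fejer_prim_far M dd).
have b3 := P1 _ _ 2^-1 h4 (le_trans h1 h3) _ _.
have {}b1 : `|\int[leb]_(y in seg n%:R (n%:R + del)) (g' y * (fejer_prim M y - (n%:R + 2^-1)))| <= B * 2^-1 * del.
  rewrite (le_trans (b1 _ _))//; last by rewrite addrAC subrr add0r.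
  by move=> y /andP[y1 y2]; apply: fejer_prim_dist; rewrite y1 (le_trans y2).
have {}b3 : `|\int[leb]_(y in seg (n.+1%:R - del) n.+1%:R) (g' y * (fejer_prim M y - (n%:R + 2^-1)))| <= B * 2^-1 * del.
  rewrite (le_trans (b3 _ _))//; last by rewrite opprB addrC subrK.
  by move=> y /andP[y1 y2]; apply: fejer_prim_dist; rewrite y2 (le_trans h1)// (le_trans h3).
have {}b2 : `|\int[leb]_(y in seg (n%:R + del) (n.+1%:R - del)) (g' y * (fejer_prim M y - (n%:R + 2^-1)))| <= B * et.
  have w1 : n.+1%:R - del - (n%:R + del) <= 1 by rewrite n1; lra.
  by apply: le_trans b2 _; rewrite ler_piMr// mulr_ge0.
rewrite (le_trans (ler_normD _ _))// (le_trans (lerD b1 (ler_normD _ _)))//.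
rewrite (le_trans (lerD (lexx _) (lerD b2 b3)))// le_eqVlt; apply/orP; left; apply/eqP.
by field.
Qed.

Definition ccoef (m K : nat) : R := \int[leb]_(y in seg 0 K%:R) gfcos t m y.

Lemma fejer_integral (M K : nat) : \int[leb]_(y in seg 0 K%:R) (g y * fejer M y) =
  M.+1%:R^-1 * \sum_(k < M.+1) (ccoef 0 K + 2 * \sum_(i < k) ccoef i.+1 K).
Proof.
have I1 m : rintegrable leb (seg 0 K%:R) (gfcos t m).
  by apply: rintegrable_seg => y _; exact: gfcos_continuous.
pose F (k : nat) y := gfcos t 0 y + 2 * \sum_(i < k) gfcos t i.+1 y.
have IF (k : nat) : rintegrable leb (seg 0 K%:R) (F k) /\
    \int[leb]_(y in seg 0 K%:R) F k y = ccoef 0 K + 2 * \sum_(i < k) ccoef i.+1 K.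
  have [J1 J2] := rint_sum k (mseg 0 K%:R) (fun i => I1 i.+1).
  split; first by apply: (rintegrableD (mseg _ _) (I1 0%N)); exact: (rintegrableZ (mseg _ _)).
  rewrite /F RintegralD; [|exact: mseg|exact: I1|exact: (rintegrableZ (mseg _ _))].
  by rewrite RintegralZl ?J2//; exact: mseg.
have [J1 J2] := rint_sum M.+1 (mseg 0 K%:R) (fun k => (IF k).1).
have -> : \sum_(k < M.+1) (ccoef 0 K + 2 * \sum_(i < k) ccoef i.+1 K) =
    \int[leb]_(y in seg 0 K%:R) \sum_(k < M.+1) F k y.
  by rewrite J2; apply: eq_bigr => k _; rewrite (IF k).2.
rewrite -RintegralZl//; last exact: mseg.
apply: eq_Rintegral => y _; rewrite /fejer mulrCA; congr (_ * _).
rewrite mulr_sumr; apply: eq_bigr => k _; rewrite /dirichlet /F mulrDr mulr1 /gfcos.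
rewrite !mulr0 mul0r cos0 mulr1; congr (_ + _).
by rewrite !mulr_sumr; apply: eq_bigr => i _; rewrite mulrCA.
Qed.

Lemma psiN_gf K : psiN K t = \sum_(n < K) g n.+1%:R.
Proof. by apply: eq_bigr => n _; rewrite /g /gf mulrAC. Qed.

(* Poisson summation: [fejer M] approximates unit masses at the integers, so the integral of
   [g * fejer M] gives the sum of [g] by parts on unit intervals, and Cesaro means of Fourier
   coefficients of [g] term by term. *)
Lemma poisson_finite (M K : nat) (del : R) : 0 < del < 2^-1 ->
  `|2^-1 + psiN K t - g K%:R / 2 -
    M.+1%:R^-1 * \sum_(k < M.+1) (ccoef 0 K + 2 * \sum_(i < k) ccoef i.+1 K)| <=
  C / (1 - expR (- 1)) * (del + (M.+1%:R * sin (pi * del) ^+ 2)^-1).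
Proof.
move=> dd; rewrite -fejer_integral -rint_unit_sum; last by move=> y; exact: gfejer_continuous.
have -> : 2^-1 + psiN K t - g K%:R / 2 = \sum_(n < K) (g n%:R + g n.+1%:R) / 2.
  rewrite psiN_gf; elim: K => [|K IH].
    by rewrite !big_ord0 addr0 /g /gf expr0n/= mulr0 oppr0 expR0 mul1r subrr.
  by rewrite !big_ord_recr/= -IH; field.
rewrite -sumrB.
under eq_bigr do rewrite unit_parts opprB addrCA subrr addr0.
have [d0 _] := andP dd.
have q1 : expR (- 1) < 1 :> R by rewrite -[ltRHS]expR0 ltr_expR oppr_lt0.
rewrite (le_trans (ler_norm_sum _ _ _))//.
rewrite (le_trans (ler_sum _ (fun (n : 'I_K) _ => perr_bound n M dd)))//.
have e0 : 0 <= del + (M.+1%:R * sin (pi * del) ^+ 2)^-1.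
  by rewrite addr_ge0 ?(ltW d0)// invr_ge0 mulr_ge0// sqr_ge0.
rewrite -mulr_suml; apply: ler_wpM2r => //.
rewrite -mulr_sumr; apply: ler_wpM2l; first exact: pC_ge0.
suff -> : \sum_(n < K) expR (- n%:R) = (1 - expR (- 1) ^+ K) / (1 - expR (- 1)) :> R.
  by rewrite ler_pdivrMr ?subr_gt0// mulVf ?gt_eqF ?subr_gt0// gerBl exprn_ge0// expR_ge0.
elim: K => [|K IH]; first by rewrite big_ord0 expr0 subrr mul0r.
rewrite big_ord_recr/= IH (_ : expR (- K%:R) = expR (- 1) ^+ K); last first.
  by rewrite -expRM_natr mulN1r.
by rewrite exprS; field; rewrite gt_eqF// subr_gt0.
Qed.

(** [poisson_finite] is uniform in [K]. So first [K] tends to infinity with [M] and [del] fixed,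
    then [M], when the Cesàro means reach the full sum and the second error term disappears, and
    last [del] tends to 0. *)
Theorem theta_functional : 2^-1 + psi t = rp (- (1 / 2)) t * (2^-1 + psi t^-1).
Proof.
pose r := rp (- (1 / 2)) t.
pose S (k : nat) := r * (2^-1 + psiN k t^-1).
have ti0 : 0 < t^-1 by rewrite invr_gt0.
pose l (m : nat) := r / 2 * expR (- (pi * m%:R ^+ 2 * t^-1)).
have cl m : (fun K => ccoef m K) @ \oo --> l m by exact: gfcos_integral_cvg.
have SE k : l 0%N + 2 * \sum_(i < k) l i.+1 = S k.
  rewrite /l /S /psiN -mulr_sumr expr0n/= mulr0 mul0r oppr0 expR0; by field.
have gK : (fun K : nat => g K%:R) @ \oo --> (0 : R).
  have := psi_term_cvg0 t0; rewrite (cvg_shiftS (fun K : nat => expR (- (pi * K%:R ^+ 2 * t)))).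
  by move=> H; apply: cvg_eqn H => K; rewrite /g /gf mulrAC.
have step (M : nat) (del : R) : 0 < del < 2^-1 ->
   `|2^-1 + psi t - arithmetic_mean S M| <= 
   C / (1 - expR (- 1)) * (del + (M.+1%:R * sin (pi * del) ^+ 2)^-1).
  move=> dd; apply: (cvg_norm_le _ (fun K => poisson_finite M K dd)).
  have -> : 2^-1 + psi t = 2^-1 + psi t - 0 / 2 by rewrite mul0r subr0.
  apply: cvgB; first apply: cvgB.
  - by apply: cvgD; [exact: cvg_cst|exact: psi_cvg].
  - exact: cvgMl.
  - rewrite /arithmetic_mean /series/= big_mkord; apply: cvgMr.
    apply: (@cvg_osum _ (fun k K => ccoef 0 K + 2 * \sum_(i < k) ccoef i.+1 K) S) => k.
    rewrite -SE; apply: cvgD; first exact: cl.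
    by apply: cvgMr; apply: (@cvg_osum _ (fun i K => ccoef i.+1 K) (fun i => l i.+1)) => i; exact: cl.
have Scv : S @ \oo --> r * (2^-1 + psi t^-1).
  by apply: cvgMr; apply: cvgD; [exact: cvg_cst|exact: psi_cvg].
have Mcv := cesaro Scv.
have q1 : expR (- 1) < 1 :> R by rewrite -[ltRHS]expR0 ltr_expR oppr_lt0.
pose B := C / (1 - expR (- 1)).
have B0 : 0 <= B by rewrite divr_ge0 ?pC_ge0// subr_ge0 ltW.
have lim (del : R) : 0 < del < 2^-1 -> `|2^-1 + psi t - r * (2^-1 + psi t^-1)| <= B * del.
  move=> dd; have /andP[d0 d2] := dd.
  have s0 : 0 < sin (pi * del) ^+ 2.
    rewrite exprn_gt0// sin_gt0_pi// mulr_gt0 ?pi_gt0//= gtr_pMr ?pi_gt0//; lra.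
  have c1 : (fun M => `|2^-1 + psi t - arithmetic_mean S M|) @ \oo --> `|2^-1 + psi t - r * (2^-1 + psi t^-1)|.
    by apply: cvg_norm; apply: cvgB; [exact: cvg_cst|exact: Mcv].
  have c2 : (fun M : nat => B * (del + (M.+1%:R * sin (pi * del) ^+ 2)^-1)) @ \oo --> B * (del + 0 * (sin (pi * del) ^+ 2)^-1).
    apply: cvgMr; apply: cvgD; first exact: cvg_cst.
    under eq_fun do rewrite invfM.
    by apply: cvgMl; exact: cvg_harmonic.
  rewrite mul0r addr0 in c2.
  by apply: (ler_cvg_to c1 c2); apply: nearW => M; exact: step.
apply/eqP; rewrite -subr_eq0 -normr_eq0 eq_le normr_ge0 andbT.
apply/ler_addgt0Pr => e e0; rewrite add0r.
pose del := Num.min (4^-1) (e / (B + 1)).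
have B1 : 0 < B + 1 by rewrite ltr_wpDl.
have d0 : 0 < del by rewrite lt_min invr_gt0 ltr0n/= divr_gt0.
have d4 : del <= 4^-1 by rewrite ge_min lexx.
have de : del * (B + 1) <= e by rewrite -ler_pdivlMr// ge_min lexx orbT.
rewrite (le_trans (lim del _))//; first by apply/andP; split; lra.
by rewrite mulrC (le_trans _ de)// ler_wpM2l ?(ltW d0)// lerDl.
Qed.

End Theta.

(** * The Mellin transform of theta *)

Section OneInfty.
Context {R : realType}.
Notation leb := (@lebesgue_measure R).
Implicit Types (w s z : R[i]).

Definition geR1 : set (measurableTypeR R) := `[1, +oo[%classic.

Lemma mgeR1 : measurable geR1. Proof. exact: measurable_itv. Qed.

Lemma geR1P (x : R) : geR1 x = (1 <= x) :> Prop.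
Proof. by rewrite /geR1/= in_itv/= andbT. Qed.

Lemma geR1_pos : geR1 `<=` posR.
Proof. by move=> x; rewrite geR1P posRP; exact: lt_le_trans. Qed.

Definition exh1 (n : nat) : set (measurableTypeR R) := seg 1 n.+1%:R.

Lemma exh1_sub n : exh1 n `<=` geR1.
Proof. by move=> x; rewrite geR1P /exh1 /seg/= in_itv/= => /andP[]. Qed.

Lemma exh1_mem (x : R) : geR1 x -> exists N, forall n, (N <= n)%N -> exh1 n x.
Proof.
rewrite geR1P => x1; exists (Num.truncn x).+1 => n Nn; rewrite /exh1 /seg/= in_itv/= x1/=.
by rewrite (le_trans (ltW (truncnS_gt _)))// ler_nat ltnW.
Qed.

Lemma one_le_nat n : 1 <= n.+1%:R :> R. Proof. by rewrite ler1n. Qed.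

Lemma rp_le (a b t : R) : 1 <= t -> a <= b -> rp a t <= rp b t.
Proof. by move=> t1 ab; rewrite /rp ler_expR ler_wpM2r// ln_ge0. Qed.

Lemma rp_integrable (a : R) : a < -1 -> rintegrable leb geR1 (rp a).
Proof.
move=> a1; have a0 : a + 1 < 0 by lra.
have rc (x : R) : 0 < x -> {for x, continuous (rp a)} by move=> x0; exact: rp_continuous.
apply: (rint_ge0_exhaust mgeR1 (Dn := exh1) (C := (- (a + 1))^-1)).
- by move=> n; exact: mseg.
- move=> m n mn; apply/subsetPset => x; rewrite /exh1 /seg/= !in_itv/= => /andP[-> xm]/=.
  by rewrite (le_trans xm)// ler_nat.
- apply/seteqP; split=> [x /exh1_mem[N NP]|x [n _]]; first by exists N => //; exact: NP.
  exact: exh1_sub.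
- exact: measurable_funS mposR geR1_pos (measurable_posR rc).
- by move=> x _; exact: ltW (rp_gt0 _ _).
- by move=> n; apply: rintegrable_seg => x /exh1_sub /geR1_pos; rewrite posRP; exact: rc.
- move=> n; have c1 (x : R) : seg 1 n.+1%:R x -> {for x, continuous (rp a)}.
    by move=> /(@exh1_sub n) /geR1_pos; rewrite posRP; exact: rc.
  have d1 (x : R) : seg 1 n.+1%:R x -> is_derive x 1 (fun t => (a + 1)^-1 * rp (a + 1) t) (rp a x).
    move=> /(@exh1_sub n) /geR1_pos; rewrite posRP => x0.
    apply: (rderE (rderZ (a + 1)^-1 (rder_rp (a + 1) x0))).
    by rewrite mulrA mulVf ?lt_eqF// mul1r addrK.
  rewrite /exh1 (rint_FTC (one_le_nat n) c1 d1) {2}/rp ln1 mulr0 expR0 mulr1.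
  by rewrite invrN gerDr mulr_le0_ge0 ?(ltW (rp_gt0 _ _))// invr_le0 ltW.
Qed.

Lemma rder_pw w (t : R) : 0 < t ->
  is_derive t 1 (fun t => complex.Re (pw w t)) (complex.Re (w * pw (w - 1) t)) /\
  is_derive t 1 (fun t => complex.Im (pw w t)) (complex.Im (w * pw (w - 1) t)).
Proof.
move=> t0; case: w => a b.
have E : (a +i* b) * pw ((a +i* b) - 1) t = (t^-1)%:C * ((a +i* b) * pw (a +i* b) t).
  by rewrite pwD pwN pw1// -fmorphV/=; ring.
have PE (x : R) : pw (a +i* b) x = (expR (ln x * a) * cos (ln x * b)) +i* (expR (ln x * a) * sin (ln x * b)).
  rewrite /pw /expC /cexp ReM ImM/= !mulr0 subr0 add0r; by rewrite ![_ * ln x]mulrC.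
have dln := rder_ln t0 (rder_id t).
split.
  have := rder_comp (f := fun u => expR (u * a) * (1 * cos (u * b) + 0 * sin (u * b)))
    (rder_expcos a b 1 0 (ln t)) dln.
  rewrite (_ : (fun x => expR (ln x * a) * (1 * cos (ln x * b) + 0 * sin (ln x * b))) = 
    (fun t => complex.Re (pw (a +i* b) t))); last first.
    by apply/funext => x; rewrite PE/=; ring.
  by move=> /rderE; apply; rewrite E PE !ReM/= ?ImM/=; ring.
have := rder_comp (f := fun u => expR (u * a) * (0 * cos (u * b) + 1 * sin (u * b)))
  (rder_expcos a b 0 1 (ln t)) dln.
rewrite (_ : (fun x => expR (ln x * a) * (0 * cos (ln x * b) + 1 * sin (ln x * b))) = 
  (fun t => complex.Im (pw (a +i* b) t))); last first.
  by apply/funext => x; rewrite PE/=; ring.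
by move=> /rderE; apply; rewrite E PE !ImM/= ?ReM/=; ring.
Qed.

Lemma cmeas_pw1 w : cmeas geR1 (pw w).
Proof.
apply: cmeas_expC; apply: measurable_funS mposR geR1_pos _; exact: measurable_lnpos.
Qed.

Lemma pw_cintble w : complex.Re w < -1 -> cintble leb geR1 (pw w).
Proof.
move=> w1; have [m1 m2] := cmeas_pw1 w.
by apply: (cintble_dom mgeR1 m1 m2 _ (rp_integrable w1)) => t _; rewrite cmod_pw.
Qed.

Lemma ccvg_bound (u : nat -> R[i]) l (e : nat -> R) : (forall n, cmod (u n - l) <= e n) ->
  e @ \oo --> (0 : R) -> ccvg u l.
Proof.
move=> ue e0; split; apply/cvgrPdist_lt => d d0; move/cvgr0Pnorm_lt : e0 => /(_ d d0);
  apply: filterS => n; apply: le_lt_trans; rewrite distrC (le_trans _ (ler_norm _))// (le_trans _ (ue n))//.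
  by rewrite -ReN -ReD Re_le_cmod.
by rewrite -ImN -ImD Im_le_cmod.
Qed.

Lemma pw_integral w : complex.Re w < -1 -> cint leb geR1 (pw w) = - (w + 1)^-1.
Proof.
move=> w1; have w0 : w + 1 != 0.
  apply: contraTneq w1 => /(congr1 (@complex.Re R)); rewrite ReD/= => E.
  by rewrite -leNgt -subr_ge0 opprK E.
have a0 : complex.Re (w + 1) < 0 by rewrite ReD/=; lra.
have c := cint_exhaust mgeR1 (fun n => mseg _ _) exh1_sub exh1_mem (pw_cintble w1).
apply: (ccvg_unique c).
have H n : cint leb (exh1 n) (pw w) = (w + 1)^-1 * pw (w + 1) n.+1%:R - (w + 1)^-1.
  have x0 (x : R) : seg 1 n.+1%:R x -> 0 < x.
    by move=> /(@exh1_sub n) /geR1_pos; rewrite posRP.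
  have c1 (x : R) : seg 1 n.+1%:R x -> ccontR (pw w) x by move=> /x0; exact: ccontR_pw.
  have Ip : cintble leb (seg 1 n.+1%:R) (pw w) by exact: cintble_seg c1.
  rewrite -[pw w](_ : (fun t => (w + 1)^-1 * ((w + 1) * pw w t)) = pw w); last first.
    by apply/funext => t; rewrite mulrA mulVf ?mul1r.
  rewrite /exh1 cintZ; [|exact: mseg|exact: (cintbleZ (mseg _ _))].
  have -> : cint leb (seg 1 n.+1%:R) (fun t => (w + 1) * pw w t) = pw (w + 1) n.+1%:R - 1.
    have c2 (x : R) : seg 1 n.+1%:R x -> ccontR (fun t => (w + 1) * pw w t) x.
      move=> xs; apply: ccontRM; last exact: c1.
      by move=> e e0; exists 1; [exact: ltr01|move=> y _; rewrite subrr cmod0].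
    have dR (x : R) : seg 1 n.+1%:R x -> is_derive x 1 (fun t => complex.Re (pw (w + 1) t)) (complex.Re ((w + 1) * pw w x)).
      by move=> /x0 /(rder_pw (w + 1))[+ _]; rewrite addrK.
    have dI (x : R) : seg 1 n.+1%:R x -> is_derive x 1 (fun t => complex.Im (pw (w + 1) t)) (complex.Im ((w + 1) * pw w x)).
      by move=> /x0 /(rder_pw (w + 1))[_ +]; rewrite addrK.
    have p1 : pw (w + 1) (1 : R) = 1 by rewrite /pw ln1 mulr0 expC0.
    apply: complex_ext.
      rewrite Re_cint (rint_FTC (one_le_nat n) (fun x xs => ccontR_Re (c2 x xs)) dR).
      by rewrite p1 ReD ReN.
    rewrite Im_cint (rint_FTC (one_le_nat n) (fun x xs => ccontR_Im (c2 x xs)) dI).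
    by rewrite p1 ImD ImN.
  by rewrite mulrBr mulr1.
apply: (ccvg_bound (e := fun n => cmod (w + 1)^-1 * rp (complex.Re (w + 1)) n.+1%:R)).
  by move=> n; rewrite H opprK subrK cmodM cmod_pw.
rewrite -[X in _ --> X](mulr0 (cmod (w + 1)^-1)); apply: cvgMr.
apply/cvgr0Pnorm_lt => e e0.
pose a := - complex.Re (w + 1); have a1 : 0 < a by rewrite oppr_gt0.
exists (Num.truncn (expR (- ln e / a))).+1 => // n /= Nn.
rewrite ger0_norm ?(ltW (rp_gt0 _ _))// /rp -[complex.Re _]opprK -/a mulNr.
rewrite -[ltRHS]lnK ?posrE// ltr_expR ltrNl mulrC -ltr_pdivrMr//.
have n0 : 0 < n.+1%:R :> R by [].
rewrite -ltr_expR lnK ?posrE// (lt_le_trans (truncnS_gt _))// ler_nat.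
exact: leq_trans Nn _.
Qed.

End OneInfty.

(** * Riemann's symmetric form of the completed zeta function *)

Section Completed.
Context {R : realType}.
Notation leb := (@lebesgue_measure R).
Implicit Types (w s z : R[i]).

Lemma psiN_continuous N (t : R) : {for t, continuous (psiN N)}.
Proof.
have H i : is_derive t 1 (fun t => expR (- (pi * i.+1%:R ^+ 2 * t))) (expR (- (pi * i.+1%:R ^+ 2 * t)) * (- (pi * i.+1%:R ^+ 2 * 1))).
  exact: (rder_exp (rderN (rderZ (pi * i.+1%:R ^+ 2) (rder_id t)))).
exact: rder_continuous (rder_sum N H).
Qed.

Lemma measurable_psi : measurable_fun (@posR R) psi.
Proof.
apply: (measurable_fun_cvg (h := psiN)).
  by move=> N; apply: measurable_posR => x _; exact: psiN_continuous.
by move=> x; rewrite posRP; exact: psi_cvg.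
Qed.

Lemma psi_rp_integrable (a : R) : rintegrable leb geR1 (fun t => psi t * rp a t).
Proof.
(* On [[1, oo[] one has [t^a <= t^|a|], and the exponent [|a|] is admissible for
   [rp_expR_integrable] whatever [a] is. *)
have n1 : -1 < `|a| by rewrite (lt_le_trans _ (normr_ge0 _))// oppr_lt0.
have I0 := integrableS mposR mgeR1 geR1_pos (rp_expR_integrable n1 ltr01).
apply: (rintegrable_dom mgeR1 _ _ (rintegrableZ mgeR1 2 I0)).
  apply: measurable_funM; apply: measurable_funS mposR geR1_pos _; first exact: measurable_psi.
  by apply: measurable_posR => x; exact: rp_continuous.
move=> t; rewrite geR1P => t1; have t0 : 0 < t by rewrite (lt_le_trans _ t1).
rewrite ger0_norm ?mulr_ge0 ?psi_ge0 ?(ltW (rp_gt0 _ _))//.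
rewrite mul1r mulrCA mulrC ler_pM ?psi_ge0 ?(ltW (rp_gt0 _ _)) ?psi_le_exp//.
by apply: rp_le => //; exact: ler_norm.
Qed.

(** The Mellin integral of [psi] cut off at 1; entire in [w] because [psi] decays exponentially. *)
Definition psiM w : R[i] := param leb geR1 (@ln R) (fun t => (psi t)%:C) w.

Lemma psiM_dom : forall (al be t : R), al < t < be ->
  rintegrable leb geR1 (fun x => cmod ((psi x)%:C) * expR (t * ln x)).
Proof.
move=> al be t _; apply: (rintegrable_eq mgeR1 _ (psi_rp_integrable t)) => x.
rewrite geR1P => x1; rewrite cmod_real ger0_norm ?psi_ge0//.
by rewrite (lt_le_trans _ x1).
Qed.

Lemma mln1 : measurable_fun geR1 (@ln R).
Proof. by apply: measurable_funS mposR geR1_pos _; exact: measurable_lnpos. Qed.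

Lemma cmeas_psi1 : cmeas geR1 (fun t : R => (psi t)%:C).
Proof.
apply: cmeas_real; apply: measurable_funS mposR geR1_pos _; exact: measurable_psi.
Qed.

Lemma psiM_cdiff w : cdiff psiM w.
Proof.
have wI : complex.Re w - 1 < complex.Re w < complex.Re w + 1 by apply/andP; split; lra.
exact: (param_cdiff mgeR1 mln1 cmeas_psi1 (@psiM_dom _ _) wI).
Qed.

Lemma psiM_int w : cintble leb geR1 (fun t => pw w t * (psi t)%:C).
Proof.
have wI : complex.Re w - 1 < complex.Re w < complex.Re w + 1 by apply/andP; split; lra.
exact: (param_int mgeR1 mln1 cmeas_psi1 (@psiM_dom _ _) wI).
Qed.

(* [pi ^ (- s / 2) * Gamma (s / 2) * zeta s] in Riemann's symmetric form *)
Definition xiL s : R[i] :=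
  psiM (s / 2 - 1) + psiM (- (s / 2) - 1 / 2) - s^-1 - (1 - s)^-1.

Lemma xiL_sym s : xiL (1 - s) = xiL s.
Proof.
rewrite /xiL.
have -> : (1 - s) / 2 - 1 = - (s / 2) - 1 / 2 by field.
have -> : - ((1 - s) / 2) - 1 / 2 = s / 2 - 1 by field.
have -> : 1 - (1 - s) = s by ring.
ring.
Qed.

Lemma cdiff_half s : cdiff (fun s : R[i] => s / 2) s.
Proof. exact: cdiffM (cdiff_id _) (cdiff_cst _ _). Qed.

Lemma xiL_cdiff s : s != 0 -> s != 1 -> cdiff xiL s.
Proof.
move=> s0 s1; have d2 := cdiff_half s.
apply: cdiffB; first apply: cdiffB; first apply: cdiffD.
- apply: (@cdiff_comp _ (fun s => s / 2 - 1) psiM); last exact: psiM_cdiff.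
  exact: cdiffB d2 (cdiff_cst _ _).
- apply: (@cdiff_comp _ (fun s => - (s / 2) - 1 / 2) psiM); last exact: psiM_cdiff.
  exact: cdiffB (cdiffN d2) (cdiff_cst _ _).
- exact: cdiffV (cdiff_id _).
- apply: cdiffV; first by rewrite subr_eq0 eq_sym.
  exact: cdiffB (cdiff_cst _ _) (cdiff_id _).
Qed.

End Completed.

(** * Zeta as a Mellin transform in the half-plane of convergence *)

Section Mellin.
Context {R : realType}.
Notation leb := (@lebesgue_measure R).
Variable s : R[i].
Hypothesis s1 : 1 < complex.Re s.

Let w : R[i] := s / 2.
Let sg : R := complex.Re w.

Lemma Re_half (z : R[i]) : complex.Re (z / 2) = complex.Re z / 2.
Proof.
have -> : (2 : R[i])^-1 = (2^-1)%:C by rewrite fmorphV/= rmorph_nat.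
by rewrite ReM/= mulr0 subr0.
Qed.

Lemma sgE : sg = complex.Re s / 2. Proof. exact: Re_half. Qed.

Lemma sg_gt : 2^-1 < sg. Proof. by rewrite sgE -[ltLHS]mul1r ltr_pM2r// invr_gt0. Qed.

Lemma w_gt0 : 0 < complex.Re w. Proof. by apply: lt_trans sg_gt; rewrite invr_gt0. Qed.

Definition mel (N : nat) (t : R) : R[i] := pw (w - 1) t * (psiN N t)%:C.

(** Term by term, [gammaL_scale] with [c = pi n^2] gives [pi^(-w) n^(-2w) Gamma(w)] as the integral
    of [t^(w-1) e^(-pi n^2 t)], and [2w = s]. *)
Lemma mel_sum N : cintble leb posR (mel N) /\
  pw (- w) pi * gammaI w * \sum_(n < N) pw (- s) n.+1%:R = cint leb posR (mel N).
Proof.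
elim: N => [|N [I1 I2]].
  have E : cint leb posR (mel 0) = 0 /\ cintble leb posR (mel 0).
    have [I0 _] := gammaL_pos w_gt0 ltr01.
    have Z := cintbleZ mposR 0 I0.
    have E t : posR t -> 0 * (expC ((1 : R)%:C * (- t)%:C) * pw (w - 1) t) = mel 0 t.
      by move=> _; rewrite /mel /psiN big_ord0 mul0r mulr0.
    split; last exact: (cintble_eq mposR E Z).
    by rewrite -(cint_eq _ E) (cintZ mposR 0 I0) mul0r.
  by rewrite big_ord0 mulr0 E.1; split => //; exact: E.2.
have c0 : 0 < pi * N.+1%:R ^+ 2 :> R by rewrite mulr_gt0 ?pi_gt0// exprn_gt0.
have [J _] := gammaL_pos w_gt0 c0.
have E t : posR t -> mel N t + expC ((pi * N.+1%:R ^+ 2)%:C * (- t)%:C) * pw (w - 1) t = mel N.+1 t.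
  move=> _; rewrite /mel /psiN big_ord_recr/= rmorphD/= mulrDr; congr (_ + _).
  by rewrite mulrC -rmorphM/= expC_real mulrN.
split; first exact: (cintble_eq mposR E (cintbleD mposR I1 J)).
rewrite -(cint_eq _ E) (cintD mposR I1 J) big_ord_recr/= mulrDr I2; congr (_ + _).
rewrite -[cint _ _ _]/(gammaL w (pi * N.+1%:R ^+ 2)%:C) (gammaL_scale w_gt0 c0).
have n0 : 0 < N.+1%:R :> R by [].
rewrite pwM ?pi_gt0 ?exprn_gt0// expr2 pwM//.
have -> : pw (- s) N.+1%:R = (pw w N.+1%:R)^-1 * (pw w N.+1%:R)^-1 :> R[i].
  rewrite -(pwN w N.+1%:R) -(pwD (- w) (- w) N.+1%:R).
  by rewrite (_ : - w + - w = - s) // /w; field.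
rewrite (pwN w pi); have := pw_neq0 w (pi : R); have := pw_neq0 w (N.+1%:R : R).
by move: (pw w pi) (pw w N.+1%:R) => a b b0 a0; field; rewrite a0 b0.
Qed.

(* Folds ]0, oo[ onto [1, oo[ along [t = 1 / u]. *)
Definition fold (u : R -> R[i]) (t : R) : R[i] := ((t ^+ 2)^-1)%:C * u t^-1 + u t.

Lemma fold_int (u : R -> R[i]) : (forall x : R, 0 < x -> ccontR u x) -> cintble leb posR u ->
  cintble leb geR1 (fold u) -> cint leb posR u = cint leb geR1 (fold u).
Proof.
move=> uc I0 I1.
have C0 := cint_exhaust mposR (fun n => mseg _ _) (@exh_sub R) (@exh_mem R) I0.
have C1 := cint_exhaust mgeR1 (fun n => mseg _ _) (@exh1_sub R) (@exh1_mem R) I1.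
apply: (ccvg_unique C0); apply: ccvg_eq C1 => n.
have n1 : 1 <= n.+1%:R :> R by exact: one_le_nat.
have n1' : (n.+1%:R : R)^-1 <= 1 by rewrite invf_le1// ltr0n.
have Ie : cintble leb (exh n) u.
  by apply: cintble_seg => x /exh_sub; rewrite posRP; exact: uc.
have xp (x : R) : seg 1 n.+1%:R x -> 0 < x.
  by move=> /(@exh1_sub R n) /geR1_pos; rewrite posRP.
have ui : cintble leb (exh1 n) u by apply: cintble_seg => x /xp; exact: uc.
rewrite /exh (cint_split n1' n1 Ie).
have := cint_invert ltr01 n1 uc; rewrite invr1 => ->.
have iv : cintble leb (exh1 n) (fun x => ((x ^+ 2)^-1)%:C * u x^-1).
  have H (x : R) : seg 1 n.+1%:R x -> ccontR (fun x => ((x ^+ 2)^-1)%:C * u x^-1) x.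
    move=> /xp x0; apply: ccontRM.
      apply: ccontR_real; apply: continuousV; first by rewrite expf_neq0// gt_eqF.
      exact: exprn_continuous.
    move=> e e0; have xi0 : 0 < x^-1 by rewrite invr_gt0.
    have [r r0 H] := uc _ xi0 e e0.
    have /cvgrPdist_lt /(_ r r0) /nbhs_ballP[q q0 K] : {for x, continuous (@GRing.inv R)}.
      by apply: inv_continuous; rewrite gt_eqF.
    exists q => // y yx; apply: H; rewrite distrC; apply: K.
    by rewrite /ball/= distrC.
  exact: cintble_seg H.
by rewrite /fold (cintD (mseg _ _) iv ui).
Qed.

Lemma fold_mel N (t : R) : 0 < t ->
  fold (mel N) t = pw (- w - 1) t * (psiN N t^-1)%:C + pw (w - 1) t * (psiN N t)%:C.
Proof.
move=> t0; rewrite /fold /mel; congr (_ + _).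
have -> : ((t ^+ 2)^-1)%:C = pw (-1) t * pw (-1) t.
  by rewrite pwN pw1// -invfM -rmorphM/= -expr2 -fmorphV.
have -> : - w - 1 = -1 + -1 + - (w - 1) by ring.
by rewrite (pwV (w - 1) t0) mulrA (pwD (-1 + -1)) (pwD (-1)).
Qed.

Definition melInf (t : R) : R[i] :=
  pw (- w - 1) t * (psi t^-1)%:C + pw (w - 1) t * (psi t)%:C.

Lemma psi_inv (t : R) : 0 < t -> psi t^-1 = rp (1 / 2) t * (2^-1 + psi t) - 2^-1.
Proof.
move=> t0; have ti : 0 < t^-1 by rewrite invr_gt0.
have := theta_functional ti; rewrite invrK => E.
have -> : rp (1 / 2) t = rp (- (1 / 2)) t^-1 by rewrite /rp lnV// mulrNN.
by rewrite -E addrAC subrr add0r.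
Qed.

(** Dominates the folded integrands of all partial sums. These obey no functional equation, but
    [psiN N t^-1 <= psi t^-1], and [psi_inv] bounds the latter by [t^(1/2) (1/2 + psi t)]. The bare
    power [- sg - 1/2] is integrable since [sg > 1/2]. *)
Definition melG (t : R) : R :=
  psi t * rp (sg - 1) t + (2^-1 * rp (- sg - 1 / 2) t + psi t * rp (- sg - 1 / 2) t).

Lemma melG_int : rintegrable leb geR1 melG.
Proof.
apply: (rintegrableD mgeR1); first exact: psi_rp_integrable.
apply: (rintegrableD mgeR1); last exact: psi_rp_integrable.
by apply: (rintegrableZ mgeR1); apply: rp_integrable; have := sg_gt; lra.
Qed.

Lemma mel_bound (a b t : R) : 1 <= t -> 0 <= a <= psi t^-1 -> 0 <= b <= psi t ->
  cmod (pw (- w - 1) t * a%:C + pw (w - 1) t * b%:C) <= melG t.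
Proof.
move=> t1 /andP[a0 a1] /andP[b0 b1]; have t0 : 0 < t by rewrite (lt_le_trans _ t1).
rewrite (le_trans (cmodD _ _))// !cmodM !cmod_pw !cmod_real !ger0_norm//.
rewrite !(ReD, ReN) /= -/sg addrC /melG lerD//.
  by rewrite mulrC ler_wpM2r// ltW// rp_gt0.
have a2 : a <= rp (1 / 2) t * (2^-1 + psi t).
  by rewrite (le_trans a1)// psi_inv// gerBl invr_ge0.
rewrite (le_trans (ler_wpM2l (ltW (rp_gt0 _ _)) a2))// mulrA -rpD.
rewrite (_ : - sg - 1 + 1 / 2 = - sg - 1 / 2); last by field.
by rewrite mulrDr le_eqVlt; apply/orP; left; apply/eqP; ring.
Qed.

Lemma cmeas_fold_mel N : cmeas geR1 (fun t => pw (- w - 1) t * (psiN N t^-1)%:C + pw (w - 1) t * (psiN N t)%:C).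
Proof.
have D (u v : R -> R[i]) : cmeas (@geR1 R) u -> cmeas geR1 v -> cmeas geR1 (fun t => u t + v t).
  move=> [u1 u2] [v1 v2]; split.
    rewrite (_ : (fun x => _) = (fun x => complex.Re (u x) + complex.Re (v x))); last first.
      by apply/funext => x; rewrite ReD.
    exact: measurable_funD.
  rewrite (_ : (fun x => _) = (fun x => complex.Im (u x) + complex.Im (v x))); last first.
    by apply/funext => x; rewrite ImD.
  exact: measurable_funD.
apply: D; (apply: cmeasM; first exact: cmeas_pw1); apply: cmeas_real;
  apply: measurable_funS mposR geR1_pos _; apply: measurable_posR => x x0.
  apply: (@continuous_comp _ _ _ (fun t : R => t^-1) (psiN N)); last exact: psiN_continuous.
  by apply: inv_continuous; rewrite gt_eqF.
exact: psiN_continuous.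
Qed.

Lemma mel_fold_ineq N (t : R) : 1 <= t ->
  cmod (pw (- w - 1) t * (psiN N t^-1)%:C + pw (w - 1) t * (psiN N t)%:C) <= melG t.
Proof.
move=> t1; have t0 : 0 < t by rewrite (lt_le_trans _ t1).
by apply: mel_bound; rewrite ?psiN_ge0 ?psiN_le ?invr_gt0.
Qed.

Lemma mel_fold N : cint leb posR (mel N) =
  cint leb geR1 (fun t => pw (- w - 1) t * (psiN N t^-1)%:C + pw (w - 1) t * (psiN N t)%:C).
Proof.
have [m1 m2] := cmeas_fold_mel N.
have I1 : cintble leb geR1 (fun t => pw (- w - 1) t * (psiN N t^-1)%:C + pw (w - 1) t * (psiN N t)%:C).
  apply: (cintble_dom mgeR1 m1 m2 _ melG_int) => t; rewrite geR1P; exact: mel_fold_ineq.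
have E t : geR1 t -> pw (- w - 1) t * (psiN N t^-1)%:C + pw (w - 1) t * (psiN N t)%:C = fold (mel N) t.
  by move=> /geR1_pos; rewrite posRP => t0; rewrite fold_mel.
rewrite (cint_eq _ E); apply: fold_int; last exact: (cintble_eq mgeR1 E I1).
  move=> x x0; apply: ccontRM; first exact: ccontR_pw.
  apply: ccontR_real; exact: psiN_continuous.
by have [] := mel_sum N.
Qed.

Lemma mel_cvg : ccvg (fun N => cint leb posR (mel N)) (cint leb geR1 melInf).
Proof.
have pc (t : R) : geR1 t -> ccvg (fun N => pw (- w - 1) t * (psiN N t^-1)%:C + pw (w - 1) t * (psiN N t)%:C) (melInf t).
  rewrite geR1P => t1; have t0 : 0 < t by rewrite (lt_le_trans _ t1).
  have ti : 0 < t^-1 by rewrite invr_gt0.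
  have Hc (x : R) : 0 < x -> ccvg (fun N => (psiN N x)%:C) (psi x)%:C.
    by move=> x0; split=> /=; [exact: psi_cvg|exact: cvg_cst].
  by apply: ccvgD; apply: ccvgM; (exact: ccvg_cst || exact: Hc).
have bd (N : nat) (t : R) : geR1 t ->
    cmod (pw (- w - 1) t * (psiN N t^-1)%:C + pw (w - 1) t * (psiN N t)%:C) <= melG t.
  by rewrite geR1P; exact: mel_fold_ineq.
have [_ c] := cint_dct mgeR1 cmeas_fold_mel pc melG_int bd.
by apply: ccvg_eq c => N; rewrite mel_fold.
Qed.

(** Inserting [psi_inv] leaves two values of [psiM] and two integrals of pure powers; the latter are
    the terms [- (1 - s)^-1] and [- s^-1] of [xiL]. *)
Lemma melInfE : cint leb geR1 melInf = xiL s.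
Proof.
have wr : complex.Re (- w - 1 / 2) < -1.
  have -> : (1 : R[i]) / 2 = (2^-1)%:C by rewrite mul1r fmorphV/= rmorph_nat.
  by rewrite ReD !ReN /= -/sg; have := sg_gt; lra.
have wr1 : complex.Re (- w - 1) < -1 by rewrite ReD !ReN /= -/sg; have := sg_gt; lra.
have J1 := psiM_int (w - 1); have J2 := psiM_int (- w - 1 / 2).
have K1 := cintbleZ mgeR1 (2^-1) (pw_cintble wr); have K2 := cintbleZ mgeR1 (2^-1) (pw_cintble wr1).
have E t : geR1 t -> pw (w - 1) t * (psi t)%:C + pw (- w - 1 / 2) t * (psi t)%:C +
    2^-1 * pw (- w - 1 / 2) t - 2^-1 * pw (- w - 1) t = melInf t.
  move=> /geR1_pos; rewrite posRP => t0; rewrite /melInf psi_inv//.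
  have h2 : (2^-1 : R)%:C = (2 : R[i])^-1 by rewrite fmorphV/= rmorph_nat.
  rewrite !(rmorphB, rmorphD, rmorphM)/= h2 -pw_real.
  have -> : pw (- w - 1 / 2) t = pw (- w - 1) t * pw ((1 / 2)%:C) t.
    rewrite (_ : - w - 1 / 2 = - w - 1 + (1 / 2)%:C); first exact: pwD.
    by rewrite [(1 / 2)%:C]rmorphM/= h2 rmorph1; field.
  by ring.
rewrite -(cint_eq _ E) (cintB mgeR1 (cintbleD mgeR1 (cintbleD mgeR1 J1 J2) K1) K2).
rewrite (cintD mgeR1 (cintbleD mgeR1 J1 J2) K1) (cintD mgeR1 J1 J2).
rewrite (cintZ mgeR1 _ (pw_cintble wr)) (cintZ mgeR1 _ (pw_cintble wr1)).
rewrite (pw_integral wr) (pw_integral wr1) /xiL -/w.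
rewrite -[cint leb geR1 (fun t => pw (w - 1) t * (psi t)%:C)]/(psiM (w - 1)).
rewrite -[cint leb geR1 (fun t => pw (- w - 1 / 2) t * (psi t)%:C)]/(psiM (- w - 1 / 2)).
have s0 : s != 0.
  by apply: contraTneq s1 => ->; rewrite -leNgt.
have s10 : 1 - s != 0.
  by apply: contraTneq s1 => /eqP; rewrite subr_eq0 => /eqP <-; rewrite ltxx.
have -> : - w - 1 / 2 + 1 = (1 - s) / 2 by rewrite /w; field.
have -> : - w - 1 + 1 = - (s / 2) by rewrite /w; ring.
move: (psiM (w - 1)) (psiM (- w - 1 / 2)) => A B; by field; rewrite s0 s10.
Qed.

Lemma xiL_mellin (zs : R[i]) : ccvg (fun N => \sum_(n < N) pw (- s) n.+1%:R) zs ->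
  pw (- (s / 2)) pi * gammaI (s / 2) * zs = xiL s.
Proof.
move=> zc; rewrite -melInfE; apply: ccvg_unique mel_cvg.
apply: ccvg_eq (ccvgM (ccvg_cst (pw (- w) pi * gammaI w)) zc) => N.
exact: (mel_sum N).2.
Qed.

End Mellin.

(** * From the topology of the complex plane to epsilon estimates *)

Section Bridge.
Context {R : realType}.
Implicit Types (f : Cplx R -> Cplx R) (s z : R[i]).

Lemma ballC (x y : Cplx R) (r : R) : cmod (x - y) < r -> ball x r%:C y.
Proof.
by move=> H; rewrite -ball_normE /ball_/= cmod_norm ltcR.
Qed.

Lemma posC_real (e : R[i]) : 0 < e -> exists2 r : R, 0 < r & e = r%:C.
Proof.
case: e => a b; rewrite ltcE/= => /andP[/eqP -> a0]; by exists a.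
Qed.

Lemma near_ccond (P : Cplx R -> Prop) (x : Cplx R) : (\forall y \near x, P y) ->
  exists2 r : R, 0 < r & forall h : R[i], cmod h < r -> P (x + h).
Proof.
move=> /nbhs_ballP[e /= /posC_real[r r0 ->] H]; exists r => // h hr.
by apply: H; apply: ballC; rewrite opprD addNKr cmodN.
Qed.

Lemma ccvg_of_cvg (u : nat -> Cplx R) (l : Cplx R) : u @ \oo --> l -> ccvg u l.
Proof.
move=> /cvgrPdist_lt ul.
have H e : 0 < e -> \forall n \near \oo, cmod (l - u n) < e.
  move=> e0; have e0c : 0 < e%:C by rewrite ltcR.
  by apply: filterS (ul _ e0c) => n; rewrite cmod_norm ltcR.
split; apply/cvgrPdist_lt => e /H; apply: filterS => n; apply: le_lt_trans.
  by rewrite -ReN -ReD Re_le_cmod.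
by rewrite -ImN -ImD Im_le_cmod.
Qed.

Lemma cderiv_of_derivable f s : derivable f s 1 -> cderiv f s ('D_1 f s).
Proof.
move=> fd e e0; have e0c : 0 < e%:C by rewrite ltcR.
have : (fun h => h^-1 *: ((f \o shift (s : Cplx R)) (h *: (1 : Cplx R)) - f s)) @ (0 : Cplx R)^' --> ('D_1 f s : Cplx R) by exact: fd.
move=> /cvgrPdist_lt /(_ _ e0c) /near_ccond[r r0 H].
exists r => // h hr; have [->|h0] := eqVneq h 0.
  by rewrite addr0 subrr mulr0 subr0 cmod0 mulr0.
have := H h hr; rewrite add0r => /(_ h0) /=.
rewrite cmod_norm ltcR => K.
have -> : f (s + h) - f s - 'D_1 f s * h = - (('D_1 f s - h^-1 * (f (h * 1 + s) - f s)) * h).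
  by rewrite mulr1 (addrC h) mulrBl [h^-1 * _]mulrC mulfVK// opprB.
by rewrite cmodN cmodM ler_wpM2r ?cmod_ge0// ltW.
Qed.

Lemma lim_of_eps (F : Cplx R -> Cplx R) s (l : R[i]) :
  (forall e, 0 < e -> exists2 r, 0 < r & forall h, h != 0 -> cmod h < r -> cmod (F (s + h) - l) < e) ->
  lim (F w @[w --> (s : Cplx R)^']) = l.
Proof.
move=> H; apply: (@cvg_lim (Cplx R)); first exact: norm_hausdorff.
apply/cvgrPdist_lt => e /posC_real[d d0 ->]; have [r r0 K] := H d d0.
apply/nbhs_ballP; exists r%:C => /=; first by rewrite ltcR.
move=> y; rewrite -ball_normE /ball_/= cmod_norm ltcR => yr ys.
have yE : y = s + (y - s) by rewrite addrC subrK.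
rewrite cmod_norm ltcR cmodB yE; apply: K; first by rewrite subr_eq0.
by rewrite cmodB.
Qed.

End Bridge.

(** * Continuation of zeta *)

Section Continuation.
Context {R : realType}.
Variable zeta : Cplx R -> Cplx R.
Hypothesis hzeta : is_riemann_zeta zeta.
Implicit Types (s w z : R[i]).

Lemma zeta_cderiv z : z != 1 -> cderiv zeta z ('D_1 zeta z).
Proof. by move=> z1; apply: cderiv_of_derivable; exact: hzeta.1. Qed.

Lemma zeta_cdiff z : z != 1 -> cdiff zeta z.
Proof. by move=> /zeta_cderiv ?; eexists; eassumption. Qed.

Lemma zeta_series s : 1 < complex.Re s -> ccvg (fun N => \sum_(n < N) pw (- s) n.+1%:R) (zeta s).
Proof.
move=> s1; apply: ccvg_eq (ccvg_of_cvg (hzeta.2 s s1)) => N.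
by rewrite /series/= big_mkord.
Qed.

Lemma neq_Im z w : complex.Im z != complex.Im w -> z != w.
Proof. by apply: contra_neq => ->. Qed.

Lemma cdiff_pwexp (t : R) z : cdiff (fun z => pw (- (z / 2)) t) z.
Proof.
apply: cdiff_expC; apply: cdiffM (cdiff_cst _ _).
exact: cdiffN (cdiff_half z).
Qed.

Lemma cdiff_gammahalf (k : nat) z : 0 < complex.Re z + k%:R * 2 ->
  cdiff (fun z => gammaI (z / 2 + k%:R)) z.
Proof.
move=> zk; apply: (@cdiff_comp _ (fun z => z / 2 + k%:R) gammaI).
  exact: cdiffD (cdiff_half z) (cdiff_cst _ _).
apply: gammaI_cdiff; rewrite ReD Re_half natC/=.
by rewrite -(pmulr_lgt0 _ (ltr0n R 2)) mulrDl divfK.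
Qed.

Lemma cdiff_prodhalf (k : nat) z : cdiff (fun z => \prod_(0 <= i < k) (z / 2 + i%:R)) z.
Proof.
elim: k => [|k IH].
  by rewrite (_ : (fun z => _) = (fun=> 1)); [exact: cdiff_cst|apply/funext => y; rewrite big_geq].
rewrite (_ : (fun z => _) = (fun z => (\prod_(0 <= i < k) (z / 2 + i%:R)) * (z / 2 + k%:R))).
  apply: cdiffM IH _; exact: cdiffD (cdiff_half z) (cdiff_cst _ _).
by apply/funext => y; rewrite big_nat_recr.
Qed.

(* The identity theorem along a horizontal segment going to the half-plane of convergence. *)
Lemma xiL_eq (k : nat) z : complex.Im z != 0 -> 0 < complex.Re z + k%:R * 2 ->
  pw (- (z / 2)) pi * gammaI (z / 2 + k%:R) * zeta z = xiL z * \prod_(0 <= i < k) (z / 2 + i%:R).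
Proof.
move=> z0 zk.
(* Shifting Gamma's argument by [k] and clearing the poles by the product extends the identity to
   [Re z > -2k] with Euler's integral alone. *)
pose F (z : R[i]) := pw (- (z / 2)) pi * gammaI (z / 2 + k%:R) * zeta z - 
   xiL z * \prod_(0 <= i < k) (z / 2 + i%:R).
have Fd s : complex.Im s != 0 -> 0 < complex.Re s + k%:R * 2 -> cdiff F s.
  move=> s0 sk.
  have s1 : s != 1 by apply: neq_Im.
  have s00 : s != 0 by apply: neq_Im.
  apply: cdiffB; first apply: cdiffM; first apply: cdiffM.
  - exact: cdiff_pwexp. - exact: cdiff_gammahalf. - exact: zeta_cdiff.
  - exact: cdiffM (xiL_cdiff s00 s1) (cdiff_prodhalf k s).
have F0 s : 1 < complex.Re s -> F s = 0.
  move=> s1; have s2 : 0 < complex.Re (s / 2) by rewrite Re_half divr_gt0// (lt_trans ltr01).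
  rewrite /F gammaI_recn// -(xiL_mellin s1 (zeta_series s1)); ring.
(* The segment starts at real part at least 2, so the unit disc there lies in the half-plane of
   convergence. *)
pose X : R := `|complex.Re z| + 2.
(* Discs of radius [3 * p] along the segment meet neither the real axis nor the line [Re = -2k]. *)
pose p : R := Num.min `|complex.Im z| (complex.Re z + k%:R * 2) / 3.
have p0 : 0 < p by rewrite divr_gt0// lt_min normr_gt0 z0.
have p3 : 3 * p = Num.min `|complex.Im z| (complex.Re z + k%:R * 2) by rewrite /p; field.
have [||e e0 H] := @identity_segment R F (z + X%:C) (- X%:C) p p0.
- move=> t s /andP[t0 t1]; rewrite p3 lt_min => /andP[h1 h2].
  set q := z + X%:C + t%:C * - X%:C in h1 h2.
  have qI : complex.Im q = complex.Im z by rewrite /q !(ImD, ImM, ImN, ReN)/=; ring.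
  have qR : complex.Re z <= complex.Re q.
    rewrite /q !(ReD, ReM, ImN, ReN)/= oppr0 mulr0 subr0 mulrN -addrA lerDl subr_ge0.
    by rewrite ler_piMl// /X addr_ge0.
  apply: Fd.
    apply: contraTneq h1 => sI; rewrite -leNgt (le_trans _ (Im_le_cmod _))//.
    by rewrite ImD ImN sI sub0r normrN qI.
  have := Re_le_cmod (s - q); rewrite ReD ReN ler_norml => /andP[h3 _].
  move: h3 h2 qR; set a := cmod _; lra.
- exists 1 => // s sX; apply: F0.
  have := Re_le_cmod (s - (z + X%:C)); rewrite !(ReD, ReN)/= ler_norml => /andP[h3 _].
  have := ler_norm (- complex.Re z); rewrite normrN => h4.
  move: h3 h4 sX; rewrite /X; set a := cmod _; lra.
have := H z; rewrite addrK subrr cmod0 => /(_ e0) /eqP.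
by rewrite subr_eq0 => /eqP.
Qed.

(** A real point is approached vertically. This carries identities proved off the real axis to real
    arguments, such as [1/2 + t] for small real [t]. *)
Lemma cont_eq (f g : R[i] -> R[i]) z : ccont f z -> ccont g z ->
  (forall w, complex.Im w != 0 -> cmod (w - z) < 1 -> f w = g w) -> f z = g z.
Proof.
move=> fc gc fg; have [z0|z0] := eqVneq (complex.Im z) 0; last first.
  by apply: fg => //; rewrite subrr cmod0.
apply/eqP; rewrite -subr_eq0 -cmod_eq0 eq_le cmod_ge0 andbT.
apply/ler_addgt0Pr => e e0; rewrite add0r.
have e2 : 0 < e / 2 by rewrite divr_gt0.
have [r r0 H] := fc _ e2; have [q q0 K] := gc _ e2.
pose y := Num.min (Num.min r q) 1 / 2.
have m0 : 0 < Num.min (Num.min r q) 1 by rewrite !lt_min r0 q0 ltr01.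
have y0 : 0 < y by rewrite divr_gt0.
have : y < Num.min (Num.min r q) 1 by rewrite /y ltr_pdivrMr// mulr2n mulrDr mulr1 ltrDl.
rewrite !lt_min => /andP[/andP[yr yq] y1].
pose h : R[i] := 0 +i* y.
have hE : cmod h = y by rewrite cmodE/= expr0n/= add0r sqrtr_sqr gtr0_norm.
have E : f (z + h) = g (z + h).
  apply: fg; first by rewrite ImD z0/= add0r gt_eqF.
  by rewrite addrAC subrr add0r hE.
rewrite -hE in yr yq.
have -> : f z - g z = (g (z + h) - g z) - (f (z + h) - f z) by rewrite E; ring.
rewrite (le_trans (cmodD _ _))// cmodN (splitr e) lerD// ltW//; [exact: K|exact: H].
Qed.

Lemma xiL_zeta s : 0 < complex.Re s -> s != 1 ->
  pw (- (s / 2)) pi * gammaI (s / 2) * zeta s = xiL s.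
Proof.
move=> s0 s1.
have s00 : s != 0 by apply: contraTneq s0 => ->; rewrite ltxx.
have gd w : 0 < complex.Re w -> cdiff (fun z => gammaI (z / 2)) w.
  move=> w0; have := @cdiff_gammahalf 0 w; rewrite mul0r addr0 => /(_ w0).
  by under [X in cdiff X]eq_fun do rewrite addr0.
have H w : 0 < complex.Re w -> w != 1 -> cdiff (fun s => pw (- (s / 2)) pi * gammaI (s / 2) * zeta s) w.
  move=> w0 w1; apply: cdiffM; first apply: cdiffM.
  - exact: cdiff_pwexp. - exact: gd. - exact: zeta_cdiff.
pose r := Num.min 1 (complex.Re s).
have E w : complex.Im w != 0 -> 0 < complex.Re w -> pw (- (w / 2)) pi * gammaI (w / 2) * zeta w = xiL w.
  move=> w0 w1; have := @xiL_eq 0 w w0; rewrite mul0r addr0 => /(_ w1).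
  by rewrite addr0 big_geq// mulr1.
(* [cont_eq] wants equality on a unit disc, which may leave the half-plane [Re w > 0]; beyond it [f]
   is set equal to [xiL]. *)
pose f w := if 0 < complex.Re w then pw (- (w / 2)) pi * gammaI (w / 2) * zeta w else xiL w.
have : f s = xiL s.
  apply: cont_eq; last by move=> w w0 _; rewrite /f; case: ifP => // /(E _ w0).
    apply: cdiff_cont; apply: (cdiff_near _ (H s s0 s1)); exists (complex.Re s) => // w ws.
    rewrite /f ifT//; have := Re_le_cmod (w - s); rewrite ReD ReN ler_norml => /andP[h _].
    by move: h ws; set a := cmod _; lra.
  exact: cdiff_cont (xiL_cdiff s00 s1).
by rewrite /f s0.
Qed.

Lemma xi_formulaE s : 0 < complex.Re s -> s != 1 ->
  xi_formula zeta s = 2^-1 * s * (s - 1) * xiL s.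
Proof.
move=> s0 s1; rewrite /xi_formula cGammaE ?Re_half ?divr_gt0//.
rewrite -(xiL_zeta s0 s1) -[rcpow _ _]/(pw (- (s / 2)) pi).
move: (pw _ _) (gammaI _) (zeta s) => a b c; ring.
Qed.

Lemma xiE s : 0 < complex.Re s -> s != 1 -> xi zeta s = 2^-1 * s * (s - 1) * xiL s.
Proof.
move=> s0 s1; apply: lim_of_eps => e e0.
have s00 : s != 0 by apply: contraTneq s0 => ->; rewrite ltxx.
have c : cdiff (fun s => 2^-1 * s * (s - 1) * xiL s) s.
  apply: cdiffM (xiL_cdiff s00 s1); apply: cdiffM.
    exact: cdiffM (cdiff_cst _ _) (cdiff_id _).
  exact: cdiffB (cdiff_id _) (cdiff_cst _ _).
have [r r0 H] := cdiff_cont c e0.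
(* In this disc the points keep a positive real part and avoid 1, so [xi_formula] agrees with the
   continuous expression. *)
pose r' := Num.min r (Num.min (complex.Re s) (cmod (s - 1))).
exists r'; first by rewrite !lt_min r0 s0 cmod_gt0 subr_eq0.
move=> h h0; rewrite !lt_min => /andP[hr /andP[hs h1]].
rewrite xi_formulaE; first exact: H.
  have := Re_le_cmod h; rewrite ReD ler_norml => /andP[h3 _].
  by move: h3 hs; set a := cmod _; lra.
apply: contraTneq h1 => E; rewrite -leNgt cmodB -E (addrC s) addrK; exact: lexx.
Qed.

End Continuation.

(** * Zeros of the completed zeta function *)

Section Nonvanishing.
Context {R : realType}.
Notation leb := (@lebesgue_measure R).
Implicit Types (s w z : R[i]).

Lemma realC_div (a b : nat) : (a%:R / b%:R : R[i]) = (a%:R / b%:R)%:C.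
Proof. by rewrite rmorphM fmorphV !rmorph_nat. Qed.

(** Square of [e^(t/2) = e * e^(t/2 - 1) >= 2 * (t/2)]. *)
Lemma sqr_lt_expR (t : R) : 1 <= t -> t ^+ 2 <= expR t.
Proof.
move=> t1; have E : expR t = expR (t / 2) ^+ 2 by rewrite -expRM_natr divfK.
rewrite E ler_sqr ?nnegrE ?expR_ge0 ?(le_trans ler01)//.
rewrite (_ : t / 2 = 1 + (t / 2 - 1)); last by rewrite addrC subrK.
rewrite expRD.
have h1 := expR_ge1Dx (1 : R); have h2 := expR_ge1Dx (t / 2 - 1).
have h3 : 0 <= 1 + (t / 2 - 1) by rewrite addrC subrK divr_ge0// (le_trans ler01).
rewrite (le_trans _ (ler_pM _ h3 h1 h2))//.
by rewrite -mulr2n addrC subrK mulrC divfK.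
Qed.

(** For [t >= 1], [psi t <= 2 e^(-t) <= 2 t^(-2)], and the integral of [t^(-11/4)] over [[1, oo[] is
    4/7. Any bound below 2 would do for [xiL_half_neq0]. *)
Lemma Re_psiM_small : complex.Re (psiM (- (3 / 4)) : R[i]) <= 8 / 7.
Proof.
have wR : complex.Re (- (3 / 4) : R[i]) = - (3 / 4) by rewrite realC_div.
have wI : complex.Im (- (3 / 4) : R[i]) = 0 by rewrite realC_div/= oppr0.
have vE : (- (11 / 4) : R[i]) = (- (11 / 4))%:C by rewrite realC_div rmorphN.
have v1 : complex.Re (- (11 / 4) : R[i]) < -1 by rewrite vE/=; lra.
have I : \int[leb]_(t in geR1) rp (- (11 / 4)) t = 4 / 7 :> R.
  have -> : 4 / 7 = complex.Re (cint leb geR1 (pw (- (11 / 4) : R[i]))) :> R.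
    rewrite pw_integral// (_ : - (- (11 / 4) + 1)^-1 = 4 / 7) ?realC_div//; by field.
  rewrite Re_cint; apply: eq_Rintegral => t _.
  by rewrite /pw vE -rmorphM expC_real.
rewrite Re_cint; have -> : 8 / 7 = 2 * (4 / 7) :> R by field.
rewrite -I -RintegralZl//; last 2 first.
- exact: mgeR1.
- by apply: rp_integrable; lra.
apply: le_Rintegral.
- exact: mgeR1.
- by have [] := psiM_int (- (3 / 4) : R[i]).
- by apply: (rintegrableZ mgeR1); apply: rp_integrable; lra.
move=> t; rewrite geR1P => t1.
have t0 : 0 < t by exact: lt_le_trans t1.
have -> : (- (3 / 4) : R[i]) = (- (3 / 4))%:C by rewrite realC_div rmorphN.
rewrite -rmorphM expC_real -rmorphM/=.
have -> : rp (- (11 / 4)) t = rp (- (3 / 4)) t * (t ^+ 2)^-1.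
  rewrite /rp (_ : - (11 / 4) * ln t = - (3 / 4) * ln t - (ln t *+ 2)); last by rewrite mulr2n; field.
  by rewrite expRD expRN mulr2n expRD lnK ?posrE// -expr2.
rewrite mulrCA ler_wpM2l ?expR_ge0//.
apply: le_trans (psi_le_exp t1) _; rewrite ler_pM2l// expRN lef_pV2 ?posrE ?expR_gt0 ?exprn_gt0//.
exact: sqr_lt_expR.
Qed.

Lemma xiL_half_neq0 : xiL (2^-1 : R[i]) != 0.
Proof.
have -> : xiL (2^-1 : R[i]) = 2 * psiM (- (3 / 4)) - 4.
  rewrite /xiL (_ : 2^-1 / 2 - 1 = - (3 / 4) :> R[i]); last by field.
  rewrite (_ : - (2^-1 / 2) - 1 / 2 = - (3 / 4) :> R[i]); last by field.
  by field.
apply/negP => /eqP E; have := Re_psiM_small.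
have : complex.Re (2 * psiM (- (3 / 4)) - 4 : R[i]) = 0 by rewrite E.
move: (psiM _) => p; rewrite !natC ReD ReM ReN/= mul0r subr0; move: (complex.Re p) => x; lra.
Qed.

(* By the identity theorem a local zero of xiL would spread, horizontally and then vertically, to 1/2. *)
Lemma xiL_not_loc0 z : complex.Im z != 0 ->
  ~ exists2 e : R, 0 < e & forall w, cmod (w - z) < e -> xiL w = 0.
Proof.
move=> z0 He.
pose y := complex.Im z.
have y0 : 0 < `|y| / 3 by rewrite divr_gt0 ?normr_gt0.
have nz w : complex.Im w != 0 -> cdiff (xiL : R[i] -> R[i]) w.
  by move=> w0; apply: xiL_cdiff; apply: neq_Im.
(* Horizontal move to [Re = 1/2]: discs of radius [|y|] around points of height [y] miss the real
   axis. *)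
have [|e e0 H] := identity_segment (v := ((2^-1 - complex.Re z)%:C : R[i])) y0 _ He.
  move=> t w _; rewrite (mulrC 3) divfK ?pnatr_eq0// => ws; apply: nz.
  apply: contraTneq ws => w0; rewrite -leNgt (le_trans _ (Im_le_cmod _))//.
  by rewrite !(ImD, ImN, ImM)/= w0 mulr0 mul0r !addr0 add0r normrN.
(* [3 * 6^-1 = 1/2]: on the vertical move along [Re = 1/2], open discs of this radius miss the poles
   0 and 1. *)
have h6 : 0 < 6^-1 :> R by rewrite invr_gt0.
have [||q q0 K] := identity_segment (f := xiL) (a := (2^-1 +i* y)) (v := 0 -i* y) h6.
- move=> t w _; have -> : 3 * 6^-1 = 2^-1 :> R by field.
  move=> ws; have := Re_le_cmod (w - ((2^-1 +i* y) + t%:C * (0 -i* y))).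
  rewrite !(ReD, ReN, ReM)/= !mul0r mulr0 subr0 addr0 ler_norml => /andP[h1 h2].
  move: h1 h2 ws; move: (cmod _) => a /= h1 h2 ws.
  by apply: xiL_cdiff; apply/negP => /eqP wE; move: h1 h2; rewrite wE/=; lra.
- exists e => // w we; apply: H; rewrite (_ : z + _ = 2^-1 +i* y)//.
  by apply: complex_ext; rewrite ?ReD ?ImD/= ?addr0// addrC subrK.
have := K 2^-1; rewrite (_ : 2^-1 +i* y + (0 -i* y) = 2^-1).
  by rewrite subrr cmod0 => /(_ q0) /eqP; apply/negP; exact: xiL_half_neq0.
have -> : (2^-1 : R[i]) = (2^-1)%:C by rewrite fmorphV rmorph_nat.
by apply: complex_ext; rewrite ?ReD ?ImD/= ?addr0 ?subrr.
Qed.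

End Nonvanishing.

(** * The sine factor and the function n *)

Section SineFactor.
Context {R : realType}.
Implicit Types (s w z : R[i]).

Lemma ReiM z : complex.Re ('i * z) = - complex.Im z.
Proof. by rewrite ReM/= mul0r mul1r add0r. Qed.

Lemma csinE z : csin z = (expC ('i * z) - expC (- ('i * z))) / (2 * 'i) :> R[i].
Proof. by []. Qed.

Lemma iC_neq0 : 2 * 'i != 0 :> R[i].
Proof. by rewrite mulf_neq0 ?pnatr_eq0//; apply: neq_Im; rewrite /= oner_neq0. Qed.

(** Off the real axis [e^(iz)] and [e^(-iz)] have different moduli. *)
Lemma csin_neq0 z : complex.Im z != 0 -> csin z != 0 :> R[i].
Proof.
move=> z0; rewrite csinE mulf_neq0// ?invr_eq0 ?iC_neq0// subr_eq0.
apply: contra_neq z0 => /(congr1 cmod); rewrite !cmod_expC ReN ReiM => /expR_inj; lra.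
Qed.

Lemma cderiv_csin z : cderiv csin z ((expC ('i * z) + expC (- ('i * z))) / 2 : R[i]).
Proof.
have iz : cderiv (fun z : R[i] => 'i * z) z 'i%R.
  by have := cderivM (cderiv_cst 'i z) (cderiv_id z); rewrite mul0r mulr1 add0r.
have niz : cderiv (fun z : R[i] => - ('i * z)) z (- 'i).
  have := cderivM (cderiv_cst (- 'i) z) (cderiv_id z); rewrite mul0r mulr1 add0r.
  by apply: cderiv_near; exists 1 => // w _; rewrite mulNr.
have e1 := cderiv_comp iz (cderiv_expC ('i * z)).
have e2 := cderivM (cderiv_cst (-1) z) (cderiv_comp niz (cderiv_expC (- ('i * z)))).
have := cderivM (cderivD e1 e2) (cderiv_cst (2 * 'i)^-1 z).
rewrite (_ : (_ + _) = (expC ('i * z) + expC (- ('i * z))) / 2).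
  by apply: cderiv_near; exists 1 => // w _; rewrite csinE mulN1r.
have := iC_neq0; rewrite mulf_eq0 negb_or => /andP[_].
by move: (expC _) (expC _) => a b; move: ('i%R) => i i0; field.
Qed.

Lemma cdiff_csin4 s : cdiff (fun s => csin (pi%:C * s / 4)) s.
Proof.
apply: (@cdiff_comp _ (fun s => pi%:C * s / 4) csin); last by eexists; exact: cderiv_csin.
apply: cdiffM (cdiff_cst _ _); exact: cdiffM (cdiff_cst _ _) (cdiff_id _).
Qed.

Lemma csin4_neq0 s : complex.Im s != 0 -> csin (pi%:C * s / 4) != 0 :> R[i].
Proof.
move=> s0; apply: csin_neq0.
rewrite (_ : pi%:C * s / 4 = (pi / 4)%:C * s); last by rewrite rmorphM fmorphV rmorph_nat mulrAC.
have p0 : 0 < pi / 4 :> R by rewrite divr_gt0 ?pi_gt0.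
by rewrite ImM/= mul0r addr0 mulf_neq0// gt_eqF.
Qed.

(* The product on C of which nfun is the value away from the removable singularities. *)
Definition sinxi s : R[i] := csin (pi%:C * s / 4) * ((2^-1 + s) * ((2^-1 + s) - 1) * xiL (2^-1 + s)).

Lemma sinxi_cdiff s : 2^-1 + s != 0 -> 2^-1 + s != 1 -> cdiff sinxi s.
Proof.
move=> s0 s1; apply: cdiffM; first exact: cdiff_csin4.
have sd : cdiff (fun s : R[i] => 2^-1 + s) s by exact: cdiffD (cdiff_cst _ _) (cdiff_id _).
apply: cdiffM; first by apply: cdiffM => //; exact: cdiffB (cdiff_cst _ _).
exact: cdiff_comp sd (xiL_cdiff s0 s1).
Qed.

Lemma Im_halfD s : complex.Im (2^-1 + s) = complex.Im s.
Proof. by rewrite (_ : (2^-1 : R[i]) = (2^-1)%:C) ?ImD/= ?add0r// fmorphV rmorph_nat. Qed.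

Lemma Re_halfD s : complex.Re (2^-1 + s) = 2^-1 + complex.Re s.
Proof. by rewrite (_ : (2^-1 : R[i]) = (2^-1)%:C) ?ReD// fmorphV rmorph_nat. Qed.

Lemma sinxi_eq0 s : complex.Im s != 0 -> sinxi s = 0 -> xiL (2^-1 + s) = 0.
Proof.
move=> s0 /eqP; rewrite mulf_eq0 (negbTE (csin4_neq0 s0))/= mulf_eq0 => /orP[|/eqP//].
rewrite mulf_eq0 subr_eq0 => /orP[] /eqP /(congr1 (@complex.Im R)); rewrite Im_halfD/= => E.
  by rewrite E eqxx in s0.
by rewrite E eqxx in s0.
Qed.

End SineFactor.

(** * Consequences of the hypothesis on f *)

Section CharFun.
Context {R : realType}.
Variable zeta : Cplx R -> Cplx R.
Hypothesis hzeta : is_riemann_zeta zeta.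
Hypothesis hf : analytic_char_fun (vstrip 0 4) (ffun zeta).
Implicit Types (s w z : R[i]).

Lemma nfunE s : - 2^-1 < complex.Re s -> 2^-1 + s != 1 -> nfun zeta s = sinxi s.
Proof.
move=> s0 s1; rewrite /nfun (xiE hzeta)//; last by rewrite Re_halfD -ltrBlDl sub0r.
by rewrite /sinxi; congr (_ * _); rewrite -!mulrA mulVKf ?pnatr_eq0// mulrA.
Qed.

Lemma ffun_cont s : 0 < complex.Re s < 4 -> ccont (ffun zeta) s.
Proof. by move=> s04; apply: cderiv_cont (cderiv_of_derivable (hf.1 s s04)). Qed.

(** [|e^(sy)| = e^(y Re s)] and [mu] is positive; the 2 comes from [cint_le]. The integral
    representation is used here only. *)
Lemma ffun_le s : 0 < complex.Re s < 4 ->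
  cmod (ffun zeta s) <= 2 * cmod (ffun zeta (complex.Re s)%:C).
Proof.
move=> s04; have [mu H] := hf.2; have [si ->] := H s s04.
have [ti ->] := H (complex.Re s)%:C s04.
have ri : rintegrable mu setT (fun y : measurableTypeR R => expR (complex.Re s * y)).
  apply: rintegrable_eq ti.1 => // y _.
  by rewrite -rmorphM -[cexp _]/(expC _) expC_real.
have := cint_le measurableT si _ ri.
move=> /(_ _)/le_trans; apply.
  by move=> y _; rewrite -[cexp _]/(expC _) cmod_expC ReM/= mulr0 subr0.
rewrite ler_pM2l// (le_trans _ (Re_le_cmod _))// (le_trans _ (ler_norm _))//.
rewrite Re_cint le_eqVlt; apply/orP; left; apply/eqP; apply: eq_Rintegral => y _.
by rewrite -rmorphM -[cexp _]/(expC _) expC_real.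
Qed.

(* At a zero of nfun, ffun has the junk value 0 and is continuous, which is impossible near an
   isolated zero; and a zero of xiL is isolated. *)
Lemma xiL_neq0_strip w : complex.Im w != 0 -> 2^-1 < complex.Re w < 2^-1 + 4 -> xiL w != 0.
Proof.
move=> w0 /andP[w1 w2]; pose s := w - 2^-1.
have wE : w = 2^-1 + s by rewrite addrC subrK.
have sI : complex.Im s != 0 by rewrite -Im_halfD -wE.
have sR : 0 < complex.Re s < 4.
  by move: w1 w2; rewrite wE Re_halfD; move: (complex.Re s) => a ? ?; apply/andP; split; lra.
have [sR0 sR4] := andP sR.
apply/negP => /eqP; rewrite wE => xi0.
have N0 : sinxi s = 0 by rewrite /sinxi xi0 !mulr0.
have nE z : complex.Im z != 0 -> 0 < complex.Re z -> nfun zeta z = sinxi z.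
  by move=> z0 zR; apply: nfunE; [lra|apply: neq_Im; rewrite Im_halfD].
have f0 : ffun zeta s = 0 by rewrite /ffun nE// N0 invr0 mulr0.
(* Near [s] both [n] and [f] have modulus below 1. Where [n] is nonzero they are reciprocal, which
   is absurd; so [n] vanishes on a disc. *)
have [r r0 H] := ffun_cont sR (@ltr01 R).
have sc : ccont sinxi s.
  by apply: cdiff_cont; apply: sinxi_cdiff; apply: neq_Im; rewrite Im_halfD.
have [q q0 K] := sc 1 ltr01.
apply: (@xiL_not_loc0 _ (2^-1 + s)); first by rewrite Im_halfD.
exists (Num.min (Num.min r q) (Num.min `|complex.Im s| (complex.Re s))).
  by rewrite !lt_min r0 q0 normr_gt0 sI sR0.
move=> v; rewrite !lt_min => /andP[/andP[vr vq] /andP[vI vR]].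
pose h := v - (2^-1 + s).
have vE : v = 2^-1 + (s + h) by rewrite addrA [RHS]addrC subrK.
rewrite -/h in vr vq vI vR.
have hI : complex.Im (s + h) != 0.
  apply: contraTneq vI => E; rewrite -leNgt (le_trans _ (Im_le_cmod _))//.
  by move: E; rewrite ImD => /eqP; rewrite addr_eq0 => /eqP ->; rewrite normrN.
have hR : 0 < complex.Re (s + h).
  have := Re_le_cmod h; rewrite ReD ler_norml => /andP[h3 _].
  by move: h3 vR; move: (cmod h) => a; lra.
rewrite vE; apply: sinxi_eq0 => //; apply/eqP; apply: contraT => n0.
have := H h vr; have := K h vq; rewrite f0 N0 !subr0 /ffun nE// mul1r cmodV.
rewrite -cmod_gt0 in n0 => k1; rewrite invf_lt1// => k2.
by have := lt_trans k1 k2; rewrite ltxx.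
Qed.

End CharFun.

(** * Nonvanishing to the right of the critical line *)

Section HalfPlane.
Context {R : realType}.
Variable zeta : Cplx R -> Cplx R.
Hypothesis hzeta : is_riemann_zeta zeta.
Hypothesis hf : analytic_char_fun (vstrip 0 4) (ffun zeta).
Implicit Types (s w z : R[i]).

Lemma Im_half z : complex.Im (z / 2) = complex.Im z / 2.
Proof.
have -> : (2 : R[i])^-1 = (2^-1)%:C by rewrite fmorphV/= rmorph_nat.
by rewrite ImM/= mulr0 add0r.
Qed.

(* Since [xiL w] has the factor [gammaI (w / 2)], nonvanishing in the strip carries over to
   [1/4 < Re w < 9/4], and the functional equation of Gamma extends it to the right. *)
Lemma gammaI_neq0 w : complex.Im w != 0 -> 4^-1 < complex.Re w -> gammaI w != 0.
Proof.
(* [n] bounds the number of unit shifts down to [Re v < 9/4]; after a shift the real part is still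
   at least 5/4. *)
suff H (n : nat) (v : R[i]) : complex.Im v != 0 -> 4^-1 < complex.Re v < 9 / 4 + n%:R -> gammaI v != 0.
  move=> w0 w1; apply: (H (Num.truncn (complex.Re w)).+1) => //; rewrite w1/=.
  have := truncnS_gt (complex.Re w); move: (complex.Re w) (_%:R) => a b; lra.
elim: n v => [|n IH] v v0 /andP[v1 v2].
  have E : xiL (v * 2) != 0.
    rewrite natC; apply: (xiL_neq0_strip hzeta hf); first by rewrite ImM/= mulr0 add0r mulf_neq0.
    rewrite ReM/= mulr0 subr0; apply/andP; split; lra.
  apply: contra_neq E => g0; rewrite -(xiL_zeta hzeta); last 2 first.
  - rewrite natC ReM/= mulr0 subr0; lra.
  - by apply: neq_Im; rewrite natC ImM/= mulr0 add0r mulf_neq0.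
  by rewrite mulfK ?pnatr_eq0// g0 mulr0 mul0r.
have [v3|v3] := ltP (complex.Re v) (9 / 4).
  apply: IH => //; rewrite v1/= (lt_le_trans v3)// lerDl; exact: ler0n.
have vE : v = v - 1 + 1 by rewrite subrK.
have v4 : complex.Re (v - 1) = complex.Re v - 1 by rewrite ReD.
have v5 : complex.Im (v - 1) = complex.Im v by rewrite ImD ImN/= oppr0 addr0.
rewrite vE gammaI_rec ?v4; last by move: v3; move: (complex.Re v) => a; lra.
apply: mulf_neq0; first by apply: neq_Im; rewrite v5.
apply: IH; rewrite ?v5// v4; move: v2 v3; rewrite -(natr1 n); move: (complex.Re v) (n%:R) => a b *.
by apply/andP; split; lra.
Qed.

Lemma Re_pw_ge s (n : nat) : 2 <= complex.Re s -> - ((n.+1%:R ^+ 2)^-1) <= complex.Re (pw (- s) n.+1%:R).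
Proof.
move=> s2; have n0 : 0 < n.+1%:R :> R by rewrite ltr0n.
have := Re_le_cmod (pw (- s) n.+1%:R); rewrite /pw cmod_expC ler_norml => /andP[h _].
apply: le_trans h; rewrite lerN2 ReM/= mulr0 subr0 ReN.
rewrite -[X in X ^+ 2]lnK ?posrE// -expRM_natl -expRN ler_expR mulNr lerN2 ler_wpM2r ?ln_ge0//.
by rewrite ler1n.
Qed.

(** The real parts of the partial sums stay above 1/4. The term [1/N] in [H] makes the induction
    telescope: [1/x - 1/(x+1)^2 >= 1/(x+1)], starting from [1 - 1/4 = 1/4 + 1/2]. *)
Lemma zeta_neq0 s : 2 <= complex.Re s -> zeta s != 0.
Proof.
move=> s2.
have H N : 4^-1 + (N.+2%:R)^-1 <= complex.Re (\sum_(n < N.+2) pw (- s) n.+1%:R).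
  elim: N => [|N IH].
    have p1 : pw (- s) 1%:R = 1 by rewrite /pw ln1 mulr0 expC0.
    have -> : \sum_(n < 2) pw (- s) n.+1%:R = 1 + pw (- s) 2%:R.
      transitivity (0 + pw (- s) 1%:R + pw (- s) 2%:R); first by rewrite 2!big_ord_recr big_ord0.
      by rewrite add0r p1.
    rewrite ReD.
    have := @Re_pw_ge s 1 s2; rewrite expr2; move: (pw _ _) => p /=; move: (complex.Re p) => a; lra.
  rewrite big_ord_recr/= ReD (le_trans _ (lerD IH (@Re_pw_ge s N.+2 s2)))//.
  have -> : N.+3%:R = N.+2%:R + 1 :> R by rewrite natr1.
  have : 0 < N.+2%:R :> R by rewrite ltr0n.
  move: (N.+2%:R) => x x0; rewrite -subr_ge0.
  have -> : 4^-1 + x^-1 - ((x + 1) ^+ 2)^-1 - (4^-1 + (x + 1)^-1) = (x * (x + 1) ^+ 2)^-1.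
    have x1 : x + 1 != 0 by rewrite gt_eqF// addr_gt0.
    have x2 : x != 0 by rewrite gt_eqF.
    by field; rewrite x1 x2.
  by rewrite invr_ge0 mulr_ge0 ?exprn_ge0 ?addr_ge0// ltW.
have s1 : 1 < complex.Re s by move: s2; move: (complex.Re s) => a; lra.
have [/cvgrPdist_lt /(_ 4^-1) K _] := zeta_series hzeta s1.
apply/negP => /eqP z0; have [|N _ /(_ N.+2)] := K; first by rewrite invr_gt0.
rewrite z0 sub0r normrN => /(_ (leqW (leqnSn N))); apply/negP; rewrite -leNgt.
by rewrite (le_trans _ (ler_norm _))// (le_trans _ (H N))// lerDl invr_ge0.
Qed.

Lemma xiL_neq0_right w : complex.Im w != 0 -> 2^-1 < complex.Re w -> xiL w != 0.
Proof.
move=> w0 w1; have [w2|w2] := ltP (complex.Re w) (2^-1 + 4).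
  by apply: (xiL_neq0_strip hzeta hf); rewrite // w1.
rewrite -(xiL_zeta hzeta); last 2 first.
- by move: w1; move: (complex.Re w) => a; lra.
- exact: neq_Im.
rewrite !mulf_neq0 ?expC_neq0//; last by apply: zeta_neq0; move: w2; move: (complex.Re w) => a; lra.
apply: gammaI_neq0; last by rewrite Re_half; move: w2; move: (complex.Re w) => a; lra.
by rewrite Im_half mulf_neq0// invr_eq0 pnatr_eq0.
Qed.

(** With [k] large enough for [z], [xiL_eq] applies, and the factors [z / 2 + i] of its product are
    nonreal. *)
Lemma zeta0_xiL0 z : complex.Im z != 0 -> zeta z = 0 -> xiL z = 0.
Proof.
move=> z0 zz; pose k := (Num.truncn `|complex.Re z|).+1.
have zk : 0 < complex.Re z + k%:R * 2.
  have := truncnS_gt `|complex.Re z|; have := ler_norm (- complex.Re z); rewrite normrN -/k.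
  have : 0 < k%:R :> R by rewrite ltr0n.
  move: (complex.Re z) (k%:R) => c b; move: `|c| => a; lra.
have := xiL_eq hzeta z0 zk; rewrite zz mulr0 => /esym/eqP.
rewrite mulf_eq0 => /orP[/eqP//|]; rewrite prodf_seq_eq0 => /hasP[i _] /= /eqP.
move=> /(congr1 (@complex.Im R)); rewrite (natC i) ImD Im_half/= addr0 => /eqP.
by rewrite mulf_eq0 (negbTE z0) invr_eq0 pnatr_eq0.
Qed.

Lemma zeta0_Re z : complex.Im z != 0 -> zeta z = 0 -> complex.Re z = 2^-1.
Proof.
move=> z0 /(zeta0_xiL0 z0) x0; case: (ltgtP (complex.Re z) 2^-1) => // zr.
  have : xiL (1 - z) != 0.
    apply: xiL_neq0_right; first by rewrite ImD ImN/= add0r oppr_eq0.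
    by rewrite ReD ReN/=; move: zr; move: (complex.Re z) => a; lra.
  by rewrite xiL_sym x0 eqxx.
by have := xiL_neq0_right z0 zr; rewrite x0 eqxx.
Qed.

End HalfPlane.

(** * Simple zeros *)

Section SimpleZeros.
Context {R : realType}.
Variable zeta : Cplx R -> Cplx R.
Hypothesis hzeta : is_riemann_zeta zeta.
Hypothesis hf : analytic_char_fun (vstrip 0 4) (ffun zeta).
Implicit Types (s w z : R[i]).

(** The sine vanishes at 0 with slope [pi / 4], so the other factor enters by its value alone, where
    [- 4^-1 = (1/2)(1/2 - 1)]. *)
Lemma cderiv_sinxi0 : cderiv (sinxi : R[i] -> R[i]) 0 (pi%:C / 4 * - 4^-1 * xiL 2^-1).
Proof.
have sd : cderiv (fun s : R[i] => pi%:C * s / 4) 0 (pi%:C / 4).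
  have := cderivM (cderivM (cderiv_cst (pi%:C : R[i]) 0) (cderiv_id 0)) (cderiv_cst 4^-1 0).
  by rewrite !mul0r !mulr0 mulr1 add0r addr0.
have cd : cderiv (fun s : R[i] => csin (pi%:C * s / 4)) 0 (pi%:C / 4).
  have := cderiv_comp sd (cderiv_csin _).
  by rewrite mulr0 mul0r mulr0 oppr0 expC0 (_ : (1 + 1) / 2 = 1) ?mul1r//; field.
have qd s : cdiff (fun s : R[i] => 2^-1 + s) s by exact: cdiffD (cdiff_cst _ _) (cdiff_id _).
have h2 : (2^-1 : R[i]) = (2^-1)%:C by rewrite fmorphV rmorph_nat.
have [d Bd] : cdiff (fun s : R[i] => (2^-1 + s) * (2^-1 + s - 1) * xiL (2^-1 + s)) 0.
  apply: cdiffM; first by apply: cdiffM => //; exact: cdiffB (cdiff_cst _ _).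
  apply: cdiff_comp (qd 0) (xiL_cdiff _ _); rewrite addr0.
    by rewrite invr_eq0 pnatr_eq0.
  by rewrite h2; apply/negP => /eqP /(congr1 (@complex.Re R)) /=; lra.
have E : (2^-1 + 0) * (2^-1 + 0 - 1) = - 4^-1 :> R[i] by field.
by have := cderivM cd Bd; rewrite mulr0 mul0r csinE mulr0 oppr0 subrr mul0r mul0r addr0 E addr0 mulrA.
Qed.

(** By the product rule a multiple zero passes from zeta to [xiL] and on to [sinxi], the other
    factors being differentiable. *)
Lemma cderiv_sinxi_critical z : zeta z = 0 -> 'D_1 zeta z = 0 -> complex.Im z != 0 ->
  0 < complex.Re z -> sinxi (z - 2^-1) = 0 /\ cderiv sinxi (z - 2^-1) 0.
Proof.
move=> z0 dz zI zR; have z1 : z != 1 by exact: neq_Im.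
have x0 : xiL z = 0 by rewrite -(xiL_zeta hzeta)// z0 mulr0.
have xd : cderiv xiL z 0.
  have [d Gd] : cdiff (fun w => pw (- (w / 2)) pi * gammaI (w / 2)) z.
    apply: cdiffM (cdiff_pwexp _ _) _.
    have := @cdiff_gammahalf _ 0 z; rewrite mul0r addr0 => /(_ zR).
    by under [X in cdiff X]eq_fun do rewrite addr0.
  have := cderivM Gd (zeta_cderiv hzeta z1); rewrite z0 dz !mulr0 addr0.
  apply: cderiv_near; exists (Num.min (complex.Re z) (cmod (z - 1))).
    by rewrite lt_min zR cmod_gt0 subr_eq0.
  move=> w; rewrite lt_min => /andP[w1 w2]; apply: (xiL_zeta hzeta).
    have := Re_le_cmod (w - z); rewrite ReD ReN ler_norml => /andP[h3 _].
    by move: h3 w1; move: (cmod _) => a; lra.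
  by apply: contraTneq w2 => ->; rewrite cmodB ltxx.
have zE : 2^-1 + (z - 2^-1) = z by rewrite addrC subrK.
split; first by rewrite /sinxi zE x0 !mulr0.
have qd : cderiv (fun s : R[i] => 2^-1 + s) (z - 2^-1) 1.
  by have := cderivD (cderiv_cst (2^-1) (z - 2^-1)) (cderiv_id _); rewrite add0r.
have xd' : cderiv xiL (2^-1 + (z - 2^-1)) 0 by rewrite zE.
have [d pd] : cdiff (fun s : R[i] => (2^-1 + s) * (2^-1 + s - 1)) (z - 2^-1).
  by apply: cdiffM; last apply: cdiffB (cdiff_cst _ _); eexists; exact: qd.
have [e ed] := cdiff_csin4 (z - 2^-1).
have := cderivM ed (cderivM pd (cderiv_comp qd xd')).
by rewrite zE x0 mul0r !mulr0 !addr0 mulr0 ?addr0.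
Qed.

(* Along the line of a double zero sinxi would be o(Re s), but |f(s)| <= 2 f(Re s), and sinxi has
   only a simple zero at 0. *)
Lemma zeta0_simple z : zeta z = 0 -> complex.Im z != 0 -> 'D_1 zeta z != 0.
Proof.
move=> z0 zI; have zR := zeta0_Re hzeta hf zI z0.
apply/negP => /eqP dz.
have zR0 : 0 < complex.Re z by rewrite zR invr_gt0.
have [N0 Nd] := cderiv_sinxi_critical z0 dz zI zR0.
set s := z - 2^-1 in N0 Nd.
have zE : z = 2^-1 + s by rewrite addrC subrK.
have sI : complex.Im s != 0 by rewrite -Im_halfD -zE.
have sR : complex.Re s = 0.
  by have := Re_halfD s; rewrite -zE zR; move: (complex.Re s) => a; lra.
pose D : R[i] := pi%:C / 4 * - 4^-1 * xiL 2^-1.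
have D0 : D != 0.
  rewrite !mulf_neq0 ?oppr_eq0 ?invr_eq0 ?pnatr_eq0 ?xiL_half_neq0//.
  by rewrite -cmod_eq0 cmod_real normr_eq0 gt_eqF// pi_gt0.
(* A quarter of the slope at 0: then [|sinxi t| >= 4et - et = 3et], while [|sinxi (s + t)| <= et].
   The ratio 3 contradicts the factor 2 of [ffun_le]. *)
pose e := cmod D / 4.
have e0 : 0 < e by rewrite divr_gt0// cmod_gt0.
have [r r0 Hs] := Nd e e0; have [q q0 H0] := cderiv_sinxi0 e0.
(* Below 1/2, so that [1/2 + t] differs from 1, as [nfunE] requires, and [t] lies in the strip. *)
pose t := Num.min (Num.min r q) 2^-1 / 2.
have m0 : 0 < Num.min (Num.min r q) 2^-1 by rewrite !lt_min r0 q0 invr_gt0 ltr0n.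
have t0 : 0 < t by rewrite divr_gt0.
have : t < Num.min (Num.min r q) 2^-1 by rewrite /t ltr_pdivrMr// mulr2n mulrDr mulr1 ltrDl.
rewrite !lt_min => /andP[/andP[tr tq] t2].
have tC : cmod (t%:C : R[i]) = t by rewrite cmod_real gtr0_norm.
have tr' : cmod (t%:C : R[i]) < r by rewrite tC.
have tq' : cmod (t%:C : R[i]) < q by rewrite tC.
have A1 : cmod (sinxi (s + t%:C)) <= e * t.
  by have := Hs _ tr'; rewrite N0 subr0 mul0r subr0 tC.
have A2 : 3 * (e * t) <= cmod (sinxi (t%:C : R[i])).
  have N00 : sinxi (0 : R[i]) = 0 by rewrite /sinxi mulr0 mul0r csinE mulr0 oppr0 subrr !mul0r.
  have := H0 _ tq'; rewrite add0r N00 subr0 tC -/D => B.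
  have := cmodBD (D * t%:C) (sinxi t%:C); rewrite cmodB cmodM tC.
  have -> : cmod D = 4 * e by rewrite /e mulrC divfK.
  rewrite -mulrA; move: B; move: (cmod _) (cmod _) (e * t) => a b c; lra.
have I : complex.Im (s + t%:C) != 0 by rewrite ImD/= addr0.
have Rst : complex.Re (s + t%:C) = t by rewrite ReD/= sR add0r.
(* Needed since the junk value 1/0 = 0 would make [|f(s + t)|] vanish and the comparison void. *)
have nz : sinxi (s + t%:C) != 0.
  apply/negP => /eqP /(sinxi_eq0 I); apply/eqP.
  apply: (xiL_neq0_right hzeta hf); first by rewrite Im_halfD.
  by rewrite Re_halfD Rst ltrDl.
have t4 : 0 < complex.Re (s + t%:C) < 4 by rewrite Rst t0/=; move: t2; move: (t) => a; lra.
have nE1 : nfun zeta (s + t%:C) = sinxi (s + t%:C).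
  apply: (nfunE hzeta); first by rewrite Rst (lt_trans _ t0)// oppr_lt0 invr_gt0.
  by apply: neq_Im; rewrite Im_halfD.
have nE2 : nfun zeta t%:C = sinxi t%:C.
  apply: (nfunE hzeta); first by rewrite /= (lt_trans _ t0)// oppr_lt0 invr_gt0.
  apply/negP => /eqP /(congr1 (@complex.Re R)); rewrite Re_halfD/=.
  by move: (t) t2 => a; lra.
have fE w u : nfun zeta w = u -> cmod (ffun zeta w) = (cmod u)^-1.
  by move=> <-; rewrite /ffun mul1r cmodV.
have F u v : cmod (ffun zeta (s + t%:C)) = u -> cmod (ffun zeta t%:C) = v -> u <= 2 * v.
  by move=> <- <-; have := ffun_le hf t4; rewrite Rst.
have {}F := F _ _ (fE _ _ nE1) (fE _ _ nE2).
have et : 0 < e * t by rewrite mulr_gt0.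
move: A1 A2 nz F; rewrite -cmod_gt0; move: (cmod _) (cmod _) (e * t) et => b a c c0 A1 A2 a0.
have b0 : 0 < b by lra.
rewrite ler_pdivlMr// ler_pdivrMl//; lra.
Qed.

End SimpleZeros.

Theorem mainTheorem11 (R : realType) (zeta : Cplx R -> Cplx R)
    (hzeta : is_riemann_zeta zeta)
    (hf : analytic_char_fun (vstrip 0 4) (ffun zeta)) :
  forall z : Cplx R, zeta z = 0 -> complex.Im z != 0 ->
    complex.Re z = 1 / 2 /\ 'D_1 zeta z != 0.
Proof.
move=> z z0 zI; split; last exact: zeta0_simple.
by rewrite (zeta0_Re hzeta hf zI z0) mul1r.
Qed.
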